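(* Let $G$ be a contact Carnot group. There exist constants $C_1, C_2>0$ and $R_1,R_2\in\mathbb{R}$ such that for every point $p=(x,z)\in G$ all of whose components $x_1,\dots,x_k$ are different from zero, the number $\hat\nu(p)$ of geodesics joining the origin with $p$ satisfies $$C_1\frac{|z|}{\|x\|^2}+R_1\;\le\;\hat\nu(p)\;\le\; C_2\frac{|z|}{\|x\|^2}+R_2 .$$
   Context: A contact Carnot group $G$ is a connected, simply connected Lie group of dimension $2n+1$ whose Lie algebra of left-invariant vector fields splits as $\mathfrak g=\mathfrak g_1\oplus\mathfrak g_2$ with $\dim\mathfrak g_2=1$, $[\mathfrak g_1,\mathfrak g_1]=\mathfrak g_2$, $[\mathfrak g_1,\mathfrak g_2]=[\mathfrak g_2,\mathfrak g_2]=0$, with a scalar product on $\mathfrak g_1$ having orthonormal basis $f_1,\dots,f_{2n}$. Fix a generator $f_0$ of $\mathfrak g_2$; then $[f_i,f_j]=A_{ij}f_0$ for a skew-symmetric matrix $A$, which is required to be non-degenerate. Exponential coordinates: $p=(x,z)\in\mathbb{R}^{2n}\times\mathbb{R}$ means $p=\exp_G(\sum_i x_if_i+zf_0)$; the origin is the identity $p_0=(0,0)$. Let $0<\alpha_1<\dots<\alpha_k$ be the distinct singular values of $A$, with multiplicities $n_j$ (the associated invariant subspace has dimension $2n_j$, $\sum_j n_j=n$), and let $x_j\in\mathbb{R}^{2n_j}$ be the orthogonal projection of $x$ on the invariant subspace of $\alpha_j$; write $p=(x_1,\dots,x_k,z)$. A horizontal curve is a Lipschitz curve $\gamma:[0,1]\to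 G$ with $\dot\gamma(t)\in\mathfrak g_1|_{\gamma(t)}$ for a.e. $t$; its energy is $J(\gamma)=\frac12\int_0^1\|\dot\gamma\|^2dt$. A geodesic is a non-constant horizontal curve $\gamma:[0,1]\to G$ that is locally energy minimizing (each $t$ has an interval around it on which $\gamma$ minimizes the energy between its endpoints). $\hat\nu(p)\in\mathbb{N}\cup\{\infty\}$ is the number of geodesics $\gamma$ with $\gamma(0)=p_0$, $\gamma(1)=p$. *)

(* Defs.v *)
From HB Require Import structures.
From mathcomp Require Import all_boot all_order all_algebra.
From mathcomp Require Import all_classical all_reals all_analysis.
From mathcomp Require Import ring lra.

Set Implicit Arguments.
Unset Strict Implicit.
Unset Printing Implicit Defensive.

Import Order.TTheory GRing.Theory Num.Theory.
Import numFieldNormedType.Exports.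

Local Open Scope classical_set_scope.
Local Open Scope ring_scope.

(* In a basis f_1, ..., f_2n (orthonormal), f_0 adapted to g = g_1 + g_2, the
   pair (x, z) stands both for the Lie algebra element sum_i x_i f_i + z f_0 and,
   in exponential coordinates, for its image under exp_G. *)
Notation carnot R n := ('rV[R]_(2 * n) * R)%type (only parsing).

Section ContactCarnot.
Context {R : realType} {n : nat}.

Local Notation carnot := (carnot R n).

Implicit Types (A : 'M[R]_(2 * n)) (x u : 'rV[R]_(2 * n)).
Implicit Types (p q v w : carnot) (c : R -> carnot).

(* [f_i, f_j] = A_ij f_0, and f_0 is central. *)
Definition lie_bracket A v w : carnot := (0, (v.1 *m A *m w.1^T) 0 0).

(* Baker-Campbell-Hausdorff formula; the algebra is 2-step nilpotent. *)
Definition carnot_mul A p q : carnot := p + q + 2^-1 *: lie_bracket A p q.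

(* The left-invariant vector field with value v at the identity (which is 0),
   that is, p |-> (dL_p)_0 (v). *)
Definition left_field A v p : carnot := 'D_v (carnot_mul A p) 0.

(* The fibre over p of the distribution g_1. *)
Definition horizontal_space A p : set carnot :=
  [set left_field A (u, 0) p | u in [set: 'rV[R]_(2 * n)]].

Definition sqnorm x : R := \sum_i x 0 i ^+ 2.

Local Notation mu := (@lebesgue_measure R).

(* c is only meaningful on [a, b]. The Lipschitz condition is the one of the
   coordinate chart, which on compact sets agrees with that of any Riemannian
   metric on the group. *)
Definition horizontal_curve A (a b : R) c : Prop :=
  [lipschitz c t | t in `[a, b]] /\
  \forall t \ae mu, t \in `]a, b[ ->
    derivable c t 1 /\ horizontal_space A (c t) (derive1 c t).

(* f_1, ..., f_2n being orthonormal, the squared norm of the horizontal vector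
   left_field A (u, 0) p is sqnorm u, and u is its first component
   (left_field_hor below). *)
Definition energy (a b : R) c : \bar R :=
  ((2^-1)%:E * \int[mu]_(t in `[a, b]) (sqnorm (derive1 c t).1)%:E)%E.

Definition energy_minimizing A (a b : R) c : Prop :=
  horizontal_curve A a b c /\
  forall d, horizontal_curve A a b d -> d a = c a -> d b = c b ->
    (energy a b c <= energy a b d)%E.

Definition geodesic A c : Prop :=
  [/\ horizontal_curve A 0 1 c,
      exists s t : R, [/\ s \in `[0, 1], t \in `[0, 1] & c s <> c t] &
      forall t : R, t \in `[0, 1] -> exists a b : R,
        [/\ a < b, `[a, b] `<=` `[0, 1]%classic,
            \forall s \near t, s \in `[0, 1] -> s \in `[a, b] &
            energy_minimizing A a b c]].

(* Curves are functions on the whole line, hence are counted up to their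
   restriction to [0, 1]. *)
Definition geodesics_to A p : set (R -> carnot) :=
  [set c \_ `[0, 1] | c in [set c | [/\ geodesic A c, c 0 = 0 & c 1 = p]]].

Definition geodesic_count A p : \bar R := counting (geodesics_to A p).

Definition singular_value A (alpha : R) : Prop :=
  0 <= alpha /\ eigenvalue (A^T *m A) (alpha ^+ 2).

Definition orth_proj (V : 'M[R]_(2 * n)) x : 'rV[R]_(2 * n) :=
  x *m proj_mx V (kermx V^T).

(* The orthogonal projection of x on the A-invariant subspace associated with
   the singular value alpha. *)
Definition component A (alpha : R) x : 'rV[R]_(2 * n) :=
  orth_proj (eigenspace (A^T *m A) (alpha ^+ 2)) x.

Lemma is_derive_carnot_mul A v p :
  is_derive 0 v (carnot_mul A p) (v + 2^-1 *: lie_bracket A p v).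
Proof.
set l := v + _.
have E : (fun h : R => h^-1 *: ((carnot_mul A p \o shift 0) (h *: v)
   - carnot_mul A p 0)) @ 0^' --> l.
  apply: cvg_near_cst; near=> h.
  have h0 : h != 0 by near: h; exact: nbhs_dnbhs_neq.
  have e w : lie_bracket A p (h *: w) = h *: lie_bracket A p w.
    rewrite /lie_bracket /=; congr pair; first by rewrite scaler0.
    by rewrite linearZ /= -scalemxAr mxE.
  have e0 : lie_bracket A p 0 = 0.
    by rewrite /lie_bracket trmx0 mulmx0 mxE.
  rewrite /carnot_mul /= addr0 e e0 scaler0 !addr0 addrAC.
  rewrite (addrAC p) subrr add0r scalerA mulrC -scalerA -scalerDr scalerA.
  by rewrite mulVf // scale1r.
by split; [apply/cvg_ex; exists l | apply/cvg_lim].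
Unshelve. all: by end_near.
Qed.

Lemma left_fieldE A v p : left_field A v p = v + 2^-1 *: lie_bracket A p v.
Proof. by have d := is_derive_carnot_mul A v p; rewrite /left_field derive_val. Qed.

Lemma left_field_hor A u p : (left_field A (u, 0) p).1 = u.
Proof. by rewrite left_fieldE /= scaler0 addr0. Qed.

Lemma carnot_mulA A : associative (carnot_mul A).
Proof.
move=> [x z] [y w] [u t]; rewrite /carnot_mul /lie_bracket.
have D (M N : 'M[R]_1) : (M + N) 0 0 = M 0 0 + N 0 0 by rewrite mxE.
apply/pair_equal_spec; split=> /=; first by rewrite !scaler0 !addr0 addrA.
rewrite !scaler0 !addr0 linearD /= !mulmxDl mulmxDr !D /GRing.scale /=; ring.
Qed.

(* The left-invariant fields realise the structure constants A. *)
Lemma left_field_bracket A v w p : A^T = - A ->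
  'D_(left_field A v p) (left_field A w) p
  - 'D_(left_field A w p) (left_field A v) p = left_field A (lie_bracket A v w) p.
Proof.
move=> skA.
have H a b : 'D_(left_field A a p) (left_field A b) p = 2^-1 *: lie_bracket A a b.
  apply/cvg_lim => //; apply: cvg_near_cst; near=> h.
  have h0 : h != 0 by near: h; exact: nbhs_dnbhs_neq.
  rewrite /= !left_fieldE /lie_bracket; apply/pair_equal_spec; split=> /=.
    by rewrite !scaler0 subrr scaler0.
  rewrite scaler0 addr0 !mulmxDl mxE -!scalemxAl mxE /GRing.scale /=; field.
  exact: h0.
rewrite !H left_fieldE /lie_bracket; apply/pair_equal_spec; split=> /=.
  by rewrite !scaler0 subrr addr0.
have -> : (w.1 *m A *m v.1^T) 0 0 = - (v.1 *m A *m w.1^T) 0 0.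
  rewrite -[in LHS](trmxK (w.1 *m _ *m _)) mxE !trmx_mul trmxK skA.
  by rewrite mulNmx mulmxN mulmxA mxE.
move: (_ 0 0) => r; rewrite linear0 mulmx0 mxE /GRing.scale /=; field.
Unshelve. all: by end_near.
Qed.

Lemma orth_proj_sub V x : (orth_proj V x <= V)%MS.
Proof. exact: proj_mx_sub. Qed.

Lemma orth_proj_orth V x : (x - orth_proj V x) *m V^T = 0.
Proof.
apply/eqP; rewrite -sub_kermx; apply: proj_mx_compl_sub.
have dx : (V :&: kermx V^T = 0)%MS.
  apply/eqP; rewrite -submx0; apply/rV_subP => u; rewrite sub_capmx => /andP[uV].
  rewrite sub_kermx => /eqP uV0.
  have /submxP[D uD] := uV.
  have : u *m u^T = 0 by rewrite {2}uD trmx_mul mulmxA uV0 mul0mx.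
  move/matrixP => /(_ 0 0); rewrite !mxE => /eqP.
  rewrite psumr_eq0 => [/allP u0|i _]; last by rewrite mxE -expr2 sqr_ge0.
  suff -> : u = 0 by rewrite sub0mx.
  apply/rowP => i; have := u0 i (mem_index_enum i).
  by rewrite !mxE -expr2 sqrf_eq0 => /eqP.
suff -> : (x <= V + kermx V^T)%MS = true by [].
apply: submx_full; rewrite /row_full.
have := mxrank_sum_cap V (kermx V^T); rewrite dx mxrank0 addn0 => ->.
by rewrite mxrank_ker mxrank_tr subnKC // rank_leq_row.
Qed.

End ContactCarnot.

(* Main.v *)
(** The geodesics issued from the origin are the curves whose horizontal
    velocity is [u = v + th *: (x *m A)] with [v] and [th] constant. A minimizer
    has such a velocity by a two-parameter variation, one parameter restoring
    the height of the endpoint; conversely such a curve is calibrated on short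
    intervals. On the invariant subspace of the singular value [al j] the
    velocity rotates with angular speed [th * al j]. For [th != 0] the endpoint
    [x], all of whose components are nonzero, determines [v] from [th], and
    requires [sin (th * al j / 2) != 0] for all [j]; its height is then
      [z = \sum_j w j * (al j / 4) * h (th * al j / 2)],
    with [h y = (y - sin y * cos y) / sin y ^+ 2] and [w j] the squared norm of
    the [j]-th component. So one counts the solutions [th] of this equation.

    The function [h] is convex between consecutive positive poles, hence each
    interval between poles of the sum contains at most two solutions; and [h y]
    grows at least linearly in [y], which bounds the number of intervals that
    contain solutions by a multiple of [`|z| / \sum_j w j]. Conversely there
    are, at spacing of the order of [2 * pi / al j], points at which no sine is
    small and the sum is at most a multiple of [th * \sum_j w j]; past each of
    those points where it is below [z], the sum tends to infinity at the next
    pole, so a solution follows. *)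
Require Import Defs.
From HB Require Import structures.
From mathcomp Require Import all_boot all_order all_algebra.
From mathcomp Require Import spectral sesquilinear complex.
From mathcomp Require Import all_classical all_reals all_analysis.
From mathcomp Require Import measurable_realfun.
From mathcomp Require Import ring lra zify.

Set Implicit Arguments.
Unset Strict Implicit.
Unset Printing Implicit Defensive.

Import Order.TTheory GRing.Theory Num.Theory.
Import numFieldNormedType.Exports.

Local Open Scope classical_set_scope.
Local Open Scope ring_scope.

(** The constants must not depend on [x], which enters the equation only through the weights [w j],
    possibly very unbalanced. Hence both counting estimates fix their constants from [al] alone and
    compare each term of the sum with its own weight, at a rate common to all terms. The [al j] may
    be incommensurable, so poles of different terms can come arbitrarily close; the lower bound
    therefore needs points far from the poles of all terms at once, with gaps that do not depend on
    the location.

    A competitor is only Lipschitz, and its derivative may be meaningless on a null set. Curves are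
    therefore handled through a bounded measurable representative of their velocity, from which they
    are recovered by integration. The extremal equation, first known almost everywhere, becomes
    pointwise because its right-hand side is continuous.

    Counting is done by injections. The upper bound uses that [v] and [th] determine the geodesic,
    the lower bound that distinct [th] give distinct curves. The value [th = 0] gives the straight
    segment, at most one curve, which accounts for an extra 1 in the upper bound. *)

Section pointwise_derivation_rules.
Context {R : realType}.
Implicit Types (f g : R -> R) (t a b : R).

Lemma der_eq f t a b : is_derive t 1 f a -> a = b -> is_derive t 1 f b.
Proof. by move=> + <-. Qed.

Lemma derivable_der f t a : is_derive t 1 f a -> derivable f t 1.
Proof. by case. Qed.

Lemma derive1_der f t a : is_derive t 1 f a -> derive1 f t = a.
Proof. by rewrite derive1E; case. Qed.

Lemma der_derive1 f t : derivable f t 1 -> is_derive t 1 f (derive1 f t).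
Proof. by rewrite derive1E => /derivableP. Qed.

Lemma der_unique f t a b : is_derive t 1 f a -> is_derive t 1 f b -> a = b.
Proof. by move=> /derive1_der <- /derive1_der. Qed.

Lemma der_continuous f t a : is_derive t 1 f a -> {for t, continuous f}.
Proof.
by move=> /derivable_der df; apply/differentiable_continuous/derivable1_diffP.
Qed.

Lemma der_cst t (k : R) : is_derive t 1 (fun=> k) 0.
Proof. exact: is_derive_cst. Qed.

Lemma der_id t : is_derive t 1 (fun s : R => s) 1.
Proof. exact: is_derive_id. Qed.

Lemma derD f g t a b : is_derive t 1 f a -> is_derive t 1 g b ->
  is_derive t 1 (fun s => f s + g s) (a + b).
Proof. by move=> df dg; exact: is_deriveD. Qed.

Lemma derN f t a : is_derive t 1 f a -> is_derive t 1 (fun s => - f s) (- a).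
Proof. by move=> df; exact: is_deriveN. Qed.

Lemma derB f g t a b : is_derive t 1 f a -> is_derive t 1 g b ->
  is_derive t 1 (fun s => f s - g s) (a - b).
Proof. by move=> df dg; exact: is_deriveB. Qed.

Lemma derM f g t a b : is_derive t 1 f a -> is_derive t 1 g b ->
  is_derive t 1 (fun s => f s * g s) (a * g t + f t * b).
Proof.
move=> df dg; apply: (der_eq (is_deriveM df dg)).
by rewrite /GRing.scale/=; ring.
Qed.

Lemma derZ (k : R) f t a : is_derive t 1 f a ->
  is_derive t 1 (fun s => k * f s) (k * a).
Proof. by move=> df; apply: der_eq (derM (der_cst t k) df) _; ring. Qed.

Lemma derV f t a : f t != 0 -> is_derive t 1 f a ->
  is_derive t 1 (fun s => (f s)^-1) (- (a / f t ^+ 2)).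
Proof.
move=> ft0 df; apply: der_eq (is_deriveV ft0 df) _.
by rewrite /GRing.scale/= mulNr mulrC.
Qed.

Lemma der_sum (I : Type) (r : seq I) (f : I -> R -> R) (a : I -> R) t :
  (forall i, is_derive t 1 (f i) (a i)) ->
  is_derive t 1 (fun s => \sum_(i <- r) f i s) (\sum_(i <- r) a i).
Proof.
move=> df; elim: r => [|i r IH].
  by under eq_fun do rewrite big_nil; rewrite big_nil; exact: der_cst.
by under eq_fun do rewrite big_cons; rewrite big_cons; exact: derD.
Qed.

Lemma der_comp f g t a b : is_derive (g t) 1 f a -> is_derive t 1 g b ->
  is_derive t 1 (fun s => f (g s)) (a * b).
Proof. by move=> df dg; exact: is_derive1_comp. Qed.

Lemma der_near f g t a : (\forall s \near t, f s = g s) ->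
  is_derive t 1 f a -> is_derive t 1 g a.
Proof. exact: near_eq_is_derive. Qed.

Lemma der_within_continuous f df (a b : R) :
  {in `[a, b], forall t, is_derive t 1 f (df t)} ->
  {within `[a, b], continuous f}.
Proof.
move=> d; apply/continuous_in_subspaceT => t /set_mem tab.
exact: der_continuous (d t tab).
Qed.

Lemma der0_constant f a b : a <= b -> {within `[a, b], continuous f} ->
  {in `]a, b[, forall t, is_derive t 1 f 0} -> f b = f a.
Proof.
move=> ab cf d; have [c _] := MVT_segment ab d cf.
by rewrite mul0r => /subr0_eq.
Qed.

Lemma der0_constant_oo f a b : {in `]a, b[, forall t, is_derive t 1 f 0} ->
  {in `]a, b[ &, forall s t, f s = f t}.
Proof.
move=> d s t; wlog st : s t / s <= t.
  by move=> H; have [/H|/ltW/H H' sab tab] := leP s t; last rewrite H'.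
rewrite !in_itv/= => /andP[as_ _] /andP[_ tb].
have sub r : r \in `[s, t] -> is_derive r 1 f 0.
  rewrite in_itv/= => /andP[sr rt]; apply: d.
  by rewrite in_itv/= (lt_le_trans as_)// (le_lt_trans rt).
apply/esym/der0_constant => //.
  exact: (@der_within_continuous _ (fun=> 0)).
by move=> r; rewrite in_itv/= => /andP[/ltW sr /ltW rt]; apply: sub; rewrite in_itv/= sr.
Qed.

End pointwise_derivation_rules.

(** * Integrals of functions controlled almost everywhere *)

Section ae_integral.
Context {d : measure_display} {T : measurableType d} {R : realType}.
Variable mu : {measure set T -> \bar R}.
Local Open Scope ereal_scope.

(* The library versions of the next two facts assume measurability; here [f]
   may fail to be measurable on a null set. *)
Lemma ge0_le_integral_nonmeas (D : set T) (f g : T -> \bar R) :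
  (forall x, D x -> 0 <= f x) -> (forall x, D x -> f x <= g x) ->
  \int[mu]_(x in D) f x <= \int[mu]_(x in D) g x.
Proof.
move=> f0 fg.
have g0 x : D x -> 0 <= g x by move=> Dx; exact: le_trans (f0 _ Dx) (fg _ Dx).
rewrite !ge0_integralE//; apply: ereal_sup_le => _ [h /= hf <-].
exists h => //= x; apply: le_trans (hf x) _.
by rewrite /patch; case: ifPn => //; rewrite inE => /fg.
Qed.

Lemma ge0_ae_eq_integral_nonmeas (D : set T) (f g : T -> \bar R) :
  measurable D -> measurable_fun D g ->
  (forall x, D x -> 0 <= f x) -> (forall x, D x -> 0 <= g x) ->
  ae_eq mu D f g -> \int[mu]_(x in D) f x = \int[mu]_(x in D) g x.
Proof.
move=> mD mg f0 g0 [N [mN N0 subN]].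
(* Nothing is known of [f] on the null set [N]: the values [+oo] and [0] there give measurable
   bounds of [f] from above and below, both with the integral of [g]. *)
pose h c := (fun x => if x \in N then c else g x).
have hE c : 0 <= c -> \int[mu]_(x in D) h c x = \int[mu]_(x in D) g x.
  move=> c0; apply: ge0_ae_eq_integral => //.
  - apply: measurable_fun_if => //; last exact: measurable_funS mg.
    apply: (measurable_fun_bool true); apply: measurableI => //.
    by rewrite (_ : _ @^-1` _ = N)//; apply/seteqP; split => x /=; [exact: set_mem|exact: mem_set].
  - by move=> x Dx; rewrite /h; case: ifPn => // _; exact: g0.
  - exists N; split => // x /=.
    by rewrite /h; case: ifPn => [/[!inE]//|_]; apply: contra_notP.
have fgN x : D x -> x \notin N -> f x = g x.
  move=> Dx; rewrite notin_setE; apply: contra_notP => fg; apply: subN => /=.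
  by move=> /(_ Dx).
apply/eqP; rewrite eq_le; apply/andP; split.
  rewrite -(hE +oo)//; apply: ge0_le_integral_nonmeas => // x Dx.
  by rewrite /h; case: ifPn => [_|/fgN ->//]; rewrite leey.
rewrite -(hE 0)//; apply: ge0_le_integral_nonmeas => x Dx.
  by rewrite /h; case: ifPn => // _; exact: g0.
by rewrite /h; case: ifPn => [_|/fgN ->//]; exact: f0.
Qed.

End ae_integral.

Section bounded_measurable.
Context {R : realType}.
Local Notation mu := (@lebesgue_measure R).
Implicit Types (f g : R -> R) (a b : R).

Lemma aeS (P Q : R -> Prop) : (forall t, P t -> Q t) ->
  (\forall t \ae mu, P t) -> \forall t \ae mu, Q t.
Proof.
by move=> PQ; apply: filterS => //; exact: (ae_filter_ringOfSetsType mu).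
Qed.

Lemma aeS2 (P Q S : R -> Prop) : (forall t, P t -> Q t -> S t) ->
  (\forall t \ae mu, P t) -> (\forall t \ae mu, Q t) -> \forall t \ae mu, S t.
Proof.
by move=> PQS; apply: filterS2 => //; exact: (ae_filter_ringOfSetsType mu).
Qed.

Lemma ae_neq (r : R) : \forall t \ae mu, t != r.
Proof.
exists [set r]; split => //=; first exact: lebesgue_measure_set1.
by move=> t /= /negP; rewrite negbK => /eqP.
Qed.

(** Unlike integrability, this class is stable under products, so the integrability of every
    integrand below follows from its shape. *)
Definition bdmeas a b f :=
  measurable_fun `[a, b] f /\ exists M : R, {in `[a, b], forall t, `|f t| <= M}.

Lemma bdmeas_cst a b (k : R) : bdmeas a b (fun=> k).
Proof. by split; [exact: measurable_cst | exists `|k|]. Qed.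

Lemma bdmeasD a b f g : bdmeas a b f -> bdmeas a b g ->
  bdmeas a b (fun t => f t + g t).
Proof.
move=> [mf [M fM]] [mg [N gN]]; split; first exact: measurable_funD.
exists (M + N) => t tab; rewrite (le_trans (ler_normD _ _))//.
by rewrite lerD ?fM ?gN.
Qed.

Lemma bdmeasM a b f g : bdmeas a b f -> bdmeas a b g ->
  bdmeas a b (fun t => f t * g t).
Proof.
move=> [mf [M fM]] [mg [N gN]]; split; first exact: measurable_funM.
by exists (M * N) => t tab; rewrite normrM ler_pM ?fM ?gN.
Qed.

Lemma bdmeasN a b f : bdmeas a b f -> bdmeas a b (fun t => - f t).
Proof.
move=> /(bdmeasM (bdmeas_cst a b (-1))).
by congr bdmeas; apply/funext => t; rewrite mulN1r.
Qed.

Lemma bdmeas_sum a b (I : Type) (s : seq I) (f : I -> R -> R) :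
  (forall i, bdmeas a b (f i)) -> bdmeas a b (fun t => \sum_(i <- s) f i t).
Proof.
move=> bf; elim: s => [|i s IH].
  by under eq_fun do rewrite big_nil; exact: bdmeas_cst.
by under eq_fun do rewrite big_cons; apply: bdmeasD.
Qed.

Lemma bdmeas_continuous a b f : a <= b -> {within `[a, b], continuous f} ->
  bdmeas a b f.
Proof.
move=> ab cf; split; first exact: subspace_continuous_measurable_fun.
have [c _ fc] := EVT_max ab cf; have [d _ fd] := EVT_min ab cf.
exists (`|f c| + `|f d|) => t tab; rewrite ler_norml; apply/andP; split.
  rewrite (le_trans _ (fd _ tab))//.
  by have := ler_norm (- f d); rewrite normrN; have := normr_ge0 (f c); lra.
by rewrite (le_trans (fc _ tab))// (le_trans (ler_norm _))// lerDl.
Qed.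

Lemma bdmeasS a b c d f : `[c, d] `<=` `[a, b] -> bdmeas a b f -> bdmeas c d f.
Proof.
move=> cdab [mf [M fM]]; split; first exact: measurable_funS mf.
by exists M => t tcd; apply: fM; apply: cdab.
Qed.

Lemma bdmeas_integrable a b f : bdmeas a b f ->
  mu.-integrable `[a, b] (EFin \o f).
Proof.
move=> [mf [M fM]]; apply: measurable_bounded_integrable => //.
  by rewrite /= lebesgue_measure_itv/=; case: ifPn => // _; rewrite -EFinB ltry.
exists M; split; first exact: num_real.
by move=> r Mr t /= /fM /le_trans -> //; exact: ltW.
Qed.

End bounded_measurable.

(** * Lipschitz functions and their almost everywhere derivatives *)

Section lipschitz_FTC.
Context {R : realType}.
Local Notation mu := (@lebesgue_measure R).
Implicit Types (f g : R -> R) (a b : R).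

Lemma is_derive_cvg_seq f (t d : R) : is_derive t 1 f d ->
  n.+1%:R * (f (t + n.+1%:R^-1) - f t) @[n --> \oo] --> d.
Proof.
move=> [/cvg_ex[l fl] df].
have ld : l = d by rewrite -df; apply/esym/cvg_lim.
rewrite ld in fl; move=> A /= /fl /= [e /= e0 eA].
change (\forall n \near \oo, A (n.+1%:R * (f (t + n.+1%:R^-1) - f t))).
near=> n; have n0 : 0 < n.+1%:R^-1 :> R by rewrite invr_gt0.
have := eA n.+1%:R^-1; rewrite /= sub0r normrN gtr0_norm// gt_eqF// invrK.
rewrite /GRing.scale/= mulr1 (addrC _ t); apply => //.
near: n; exact: near_infty_natSinv_lt (PosNum e0).
Unshelve. all: by end_near. Qed.

Lemma lipschitz_continuous f (K : R) :
  (forall s t, `|f s - f t| <= K * `|s - t|) -> continuous f.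
Proof.
move=> fK t; apply/cvgrPdist_lt => e e0.
have K1 : 0 < `|K| + 1 by rewrite ltr_wpDl.
exists (e / (`|K| + 1)) => /=; first by rewrite divr_gt0.
move=> s /=; rewrite ltr_pdivlMr// => st.
apply: le_lt_trans (fK _ _) _; apply: le_lt_trans st.
by rewrite mulrC ler_wpM2l// (le_trans (ler_norm _))// lerDl.
Qed.

(** The difference quotients with step [n.+1%:R^-1] are bounded by [K] and converge almost
    everywhere to the derivative, so dominated convergence applies. The integral of such a quotient
    is a difference of quotients of a primitive [F] of [f], which tends to [f t - f a]. *)
Lemma lipschitz_FTC f a b (K : R) : a < b ->
  {in `[a, b] &, forall s t, `|f s - f t| <= K * `|s - t|} ->
  (\forall t \ae mu, t \in `]a, b[ -> derivable f t 1) ->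
  exists g, [/\ measurable_fun setT g, forall t, `|g t| <= K,
    (\forall t \ae mu, t \in `]a, b[ -> g t = derive1 f t) &
    forall t, t \in `[a, b] -> f t - f a = \int[mu]_(s in `[a, t]) g s].
Proof.
move=> ab fK df.
have K0 : 0 <= K.
  have := fK a b; rewrite !in_itv/= !lexx (ltW ab) => /(_ isT isT).
  rewrite -[X in X -> _]/(is_true _) => /(le_trans (normr_ge0 _)).
  by rewrite pmulr_lge0// normr_gt0 subr_eq0 lt_eqF.
(* Clamping the argument extends [f] to a function [h] on the line with the same Lipschitz constant,
   so that the quotients make sense up to [b]. *)
pose cl t := Num.max a (Num.min t b).
have clab t : cl t \in `[a, b].
  by rewrite in_itv/= /cl le_max lexx /= ge_max (ltW ab) ge_min lexx orbT.
have clE t : t \in `[a, b] -> cl t = t.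
  by rewrite in_itv/= /cl => /andP[ta tb]; rewrite (min_idPl tb) (max_idPr ta).
have clK s t : `|cl s - cl t| <= `|s - t|.
  have := ler_norm (s - t); have := ler_norm (- (s - t)); rewrite normrN ler_norml.
  rewrite /cl; case: (leP s b) => ?; case: (leP t b) => ?;
  by rewrite ?(max_idPr (ltW ab)); case: (leP a s) => ?;
    case: (leP a t) => ? ? ?; apply/andP; split; lra.
pose h := f \o cl.
have hK s t : `|h s - h t| <= K * `|s - t|.
  by apply: le_trans (fK _ _ (clab _) (clab _)) _; rewrite ler_wpM2l.
have ch : continuous h := lipschitz_continuous hK.
pose q n t := n.+1%:R * (h (t + n.+1%:R^-1) - h t).
have n1 n : 0 < n.+1%:R^-1 :> R by rewrite invr_gt0.
have qK n t : `|q n t| <= K.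
  rewrite normrM ger0_norm// mulrC -ler_pdivlMr//.
  by apply: le_trans (hK _ _) _; rewrite addrAC subrr add0r gtr0_norm.
have cq n : continuous (q n).
  have ch1 : continuous (h \o +%R^~ n.+1%:R^-1).
    move=> t; apply: continuous_comp; last exact: ch.
    by apply: cvgD; [exact: cvg_id|exact: cvg_cst].
  move=> t; apply: cvgM; first exact: cvg_cst.
  by apply: cvgB; [exact: ch1|exact: ch].
(* The lower end [a - 1] makes [F] differentiable at [a] itself, where a two-sided derivative is
   used. *)
pose F t := \int[mu]_(s in `[a - 1, t]) h s.
have dF t : a - 1 < t -> is_derive t 1 F (h t).
  move=> at1; have tt1 : t < t + 1 by rewrite ltrDl.
  have ih : mu.-integrable `[a - 1, t + 1] (EFin \o h).
    by apply: continuous_compact_integrable;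
      [exact: segment_compact|exact: continuous_subspaceT].
  have [] := continuous_FTC1 tt1 ih _ (ch t); first by rewrite lte_fin.
  by move=> dF F't; split => //; rewrite -derive1E.
pose g0 t := limn_sup (q ^~ t).
(* The upper limit is measurable; clamping it gives the bound [K] at every point and changes nothing
   where the quotients converge. *)
pose g t := Num.max (- K) (Num.min (g0 t) K).
have mg0 : measurable_fun setT g0.
  apply: measurable_fun_limn_sup => [t _|t _|n].
  - by exists K => _ [n _ <-]; rewrite (le_trans (ler_norm _)).
  - by exists (- K) => _ [n _ <-]; have := qK n t; rewrite ler_norml => /andP[].
  - exact: continuous_measurable_fun.
have gK t : `|g t| <= K.
  by rewrite ler_norml /g le_max lexx/= ge_max ge_min lexx orbT andbT; lra.
have qf : \forall t \ae mu, t \in `]a, b[ -> q ^~ t @ \oo --> derive1 f t.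
  apply: aeS df => t + tab => /(_ tab) dft.
  apply: is_derive_cvg_seq; rewrite derive1E.
  apply: near_eq_is_derive (derivableP dft).
  near=> s; rewrite /h/= clE//.
  have : s \in `]a, b[ by near: s; exact: near_in_itvoo.
  by rewrite !in_itv/= => /andP[/ltW -> /ltW ->].
have gf : \forall t \ae mu, t \in `]a, b[ -> g t = derive1 f t.
  apply: aeS qf => t + tab => /(_ tab) qft.
  rewrite /g /g0 (cvg_limn_inf_sup qft).2.
  have : `|derive1 f t| <= K.
    rewrite -(cvg_lim (@Rhausdorff R) (cvg_norm qft)).
    apply: limr_le; first by apply/cvg_ex; eexists; exact: (cvg_norm qft).
    by apply: nearW => n.
  rewrite ler_norml => /andP[f1 f2].
  by rewrite (min_idPl f2) (max_idPr f1).
have mg : measurable_fun setT g.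
  by apply: measurable_maxr => //; exact: measurable_minr.
exists g; split=> // t tab.
move: (tab); rewrite in_itv/= => /andP[]; rewrite le_eqVlt => /predU1P[<- _|].
  by rewrite subrr set_itv1 Rintegral_set1.
move=> a_t tb.
have : [sequence (\int[mu]_(x in `[a, t]) (q n x)%:E)%E]_n @ \oo
    --> (\int[mu]_(x in `[a, t]) (g x)%:E)%E.
  have [//||||||] := @dominated_convergence _ _ R mu `[a, t] _
    (fun n x => (q n x)%:E) (EFin \o g) (cst K%:E).
  - move=> n; apply/measurable_EFinP.
    by apply: measurable_funTS; exact: continuous_measurable_fun.
  - by apply/measurable_EFinP; exact: measurable_funTS.
  - have H1 := aeS2 (fun x => @conj _ _) qf gf.
    have H2 := aeS2 (fun x => @conj _ _) (ae_neq a) (ae_neq b).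
    apply: aeS2 H1 H2 => x [qfx gfx] [xa xb]; rewrite /= in_itv/= => /andP[ax xt].
    have xab : x \in `]a, b[.
      by rewrite in_itv/= !lt_neqAle eq_sym xa ax xb (le_trans xt).
    by apply/cvg_EFin; [exact: nearW|rewrite /= gfx//; exact: qfx].
  - exact: (bdmeas_integrable (bdmeas_cst a t K)).
  - by apply: aeW => x n _; rewrite lee_fin.
  - by move=> _ _.
have qF n : (\int[mu]_(x in `[a, t]) (q n x)%:E)%E =
    (n.+1%:R * (F (t + n.+1%:R^-1) - F t)
       - n.+1%:R * (F (a + n.+1%:R^-1) - F a))%:E.
  pose H s := n.+1%:R * (F (s + n.+1%:R^-1) - F s).
  rewrite EFinB -/(H t) -/(H a).
  have dH s : a <= s -> is_derive s 1 H (q n s).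
    move=> sa.
    have d1 : is_derive (s + n.+1%:R^-1) 1 F (h (s + n.+1%:R^-1)).
      by apply: dF; have := n1 n; move: n.+1%:R^-1 => e; lra.
    have d2 : is_derive s 1 F (h s) by apply: dF; lra.
    apply: derZ; apply: derB => //; rewrite -[X in is_derive _ _ _ X]mulr1.
    apply: (der_comp (g := +%R^~ n.+1%:R^-1)) => //.
    by apply: der_eq (derD (der_id s) (der_cst s _)) _; rewrite addr0.
  have cH s : a <= s -> H @ s --> H s by move=> /dH; exact: der_continuous.
  apply: continuous_FTC2 => //; first exact: continuous_subspaceT.
  - split => [s||].
    + by rewrite in_itv/= => /andP[/ltW sa _]; exact: derivable_der (dH s sa).
    + by apply: cvg_at_right_filter; apply: cH.
    + by apply: cvg_at_left_filter; apply: cH; exact: ltW.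
  - move=> s; rewrite in_itv/= => /andP[/ltW sa _].
    exact: derive1_der (dH s sa).
rewrite (_ : [sequence _]_n = EFin \o (fun n => n.+1%:R * (F (t + n.+1%:R^-1) - F t)
       - n.+1%:R * (F (a + n.+1%:R^-1) - F a))); last first.
  by apply/funext => n /=; rewrite qF.
have cF : (n.+1%:R * (F (t + n.+1%:R^-1) - F t)
       - n.+1%:R * (F (a + n.+1%:R^-1) - F a)) @[n --> \oo] --> f t - f a.
  have -> : f t - f a = h t - h a.
    by rewrite /h /= !clE// in_itv/= lexx ltW.
  by apply: cvgB; apply: is_derive_cvg_seq; apply: dF; lra.
set u := EFin \o _ => cI.
have cF' : u @ \oo --> (f t - f a)%:E by apply: cvg_EFin; [exact: nearW|exact: cF].
by have := cvg_unique _ cI cF'; rewrite /Rintegral => ->.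
Unshelve. all: by end_near. Qed.

End lipschitz_FTC.

Section primitive.
Context {R : realType}.
Local Notation mu := (@lebesgue_measure R).
Implicit Types (f g : R -> R) (a b : R).

Lemma ae_eq_Rintegral a b f g : bdmeas a b f -> bdmeas a b g ->
  (\forall t \ae mu, t \in `]a, b[ -> f t = g t) ->
  \int[mu]_(t in `[a, b]) f t = \int[mu]_(t in `[a, b]) g t.
Proof.
move=> [mf _] [mg _] fg; rewrite /Rintegral; congr fine.
apply: ae_eq_integral => //; [exact/measurable_EFinP|exact/measurable_EFinP|].
apply: aeS2 fg (aeS2 (fun x => @conj _ _) (ae_neq a) (ae_neq b)).
move=> t fgt [ta tb] /=; rewrite in_itv/= => /andP[at_ tb'].
by rewrite /= fgt// in_itv/= !lt_neqAle eq_sym ta at_ tb.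
Qed.

Lemma Rintegral_bound a b f (M : R) : a <= b -> bdmeas a b f ->
  {in `[a, b], forall t, `|f t| <= M} ->
  `|\int[mu]_(t in `[a, b]) f t| <= M * (b - a).
Proof.
move=> ab bf fM.
have bn : bdmeas a b (fun t => `|f t|).
  split; first exact: measurableT_comp bf.1.
  by exists M => t /fM; rewrite normr_id.
apply: le_trans (le_normr_Rintegral _ (bdmeas_integrable bf)) _ => //.
have := le_Rintegral _ (bdmeas_integrable bn) (bdmeas_integrable (bdmeas_cst a b M)).
move=> /(_ (measurable_itv _)) /(_ (fun t tab => fM t tab)) /le_trans; apply.
rewrite Rintegral_cst//= lebesgue_measure_itv/= lte_fin.
have [->|ba] := eqVneq a b; first by rewrite ltxx/= subrr.
by rewrite lt_neqAle ba ab.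
Qed.

Lemma Rintegral_itvBcc a b f (s t : R) : bdmeas a b f ->
  a <= s -> s <= t -> t <= b ->
  \int[mu]_(r in `[a, t]) f r - \int[mu]_(r in `[a, s]) f r =
  \int[mu]_(r in `[s, t]) f r.
Proof.
move=> bf sa st tb.
have bat : bdmeas a t f by apply: bdmeasS bf; apply: subset_itvl; rewrite bnd_simp.
rewrite Rintegral_itvB//; last first.
  exact: bdmeas_integrable.
apply: Rintegral_itv_obnd_cbnd; apply: integrableS (bdmeas_integrable bat) => //.
by apply: subset_itvr; rewrite bnd_simp.
Qed.

Lemma lipschitz_primitive a b f (M : R) : bdmeas a b f ->
  {in `[a, b], forall t, `|f t| <= M} ->
  {in `[a, b] &, forall s t,
    `|\int[mu]_(r in `[a, s]) f r - \int[mu]_(r in `[a, t]) f r| <= M * `|s - t|}.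
Proof.
move=> bf fM s t; wlog st : s t / s <= t.
  move=> H; have [/H//|/ltW/H ts sI tI] := leP s t.
  by rewrite distrC (distrC s); exact: ts.
rewrite !in_itv/= => /andP[sa sb] /andP[ta tb].
rewrite distrC (Rintegral_itvBcc bf)// distrC (@ger0_norm _ (t - s)) ?subr_ge0//.
have stab : `[s, t] `<=` `[a, b] by apply: subset_itv; rewrite bnd_simp.
by apply: Rintegral_bound => //; [exact: bdmeasS bf|move=> r /stab/fM].
Qed.

Lemma ae_derive_primitive a b f : bdmeas a b f ->
  \forall t \ae mu, t \in `]a, b[ ->
    is_derive t 1 (fun s => \int[mu]_(r in `[a, s]) f r) (f t).
Proof.
move=> bf; pose g := f \_ `[a, b].
have ig : mu.-integrable setT (EFin \o g).
  have := bdmeas_integrable bf; rewrite integrable_mkcond//=.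
  by rewrite restrict_EFin.
have lg : locally_integrable [set: R] g by apply: integrable_locally => //; exact: bdmeas_integrable.
have igy y : mu.-integrable `[a, y] (EFin \o g) by exact: integrableS ig.
have := @FTC1 R g (BLeft a) igy lg.
apply: aeS => t /= + tab; move: (tab); rewrite in_itv/= => /andP[at_ tb].
move=> []; first by rewrite lte_fin.
move=> dg g't.
have gt : g t = f t by rewrite /g patchE mem_set//= in_itv/= !ltW.
rewrite -gt -g't; apply: der_near (der_derive1 dg).
near=> s; apply: eq_Rintegral => r /[!inE]/=; rewrite in_itv/= => /andP[ar rs].
rewrite /g patchE mem_set//= in_itv/= ar (le_trans rs)// ltW//.
by near: s; exact: lt_nbhsl.
Unshelve. all: by end_near. Qed.

End primitive.

Section lipder.
Context {R : realType}.
Local Notation mu := (@lebesgue_measure R).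
Implicit Types (f g h k : R -> R) (a b : R).

Lemma lipschitz_within_continuous (f : R -> R) a b (K : R) :
  {in `[a, b] &, forall s t, `|f s - f t| <= K * `|s - t|} ->
  {within `[a, b], continuous f}.
Proof.
move=> fK; apply/subspace_continuousP => t tab; apply/cvgrPdist_lt => e e0.
have K1 : 0 < `|K| + 1 by rewrite ltr_wpDl.
exists (e / (`|K| + 1)) => /=; first by rewrite divr_gt0.
move=> s /=; rewrite ltr_pdivlMr// => st sab.
apply: le_lt_trans (fK _ _ tab sab) _; apply: le_lt_trans st.
by rewrite mulrC ler_wpM2l// (le_trans (ler_norm _))// lerDl.
Qed.

Lemma lipschitz_bdmeas (f : R -> R) a b (K : R) : a <= b ->
  {in `[a, b] &, forall s t, `|f s - f t| <= K * `|s - t|} -> bdmeas a b f.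
Proof.
by move=> ab fK; apply: bdmeas_continuous => //; exact: lipschitz_within_continuous fK.
Qed.

(** The velocity [g] is part of the data because [derive1 f] is uncontrolled where [f] is not
    differentiable. Algebraic identities between velocities can then be used at every point, and
    integration by parts becomes the product rule [lipderM] followed by [lipder_integral]. *)
Definition lipder a b f g :=
  [/\ exists K : R, {in `[a, b] &, forall s t, `|f s - f t| <= K * `|s - t|},
      bdmeas a b g &
      \forall t \ae mu, t \in `]a, b[ -> is_derive t 1 f (g t)].

Lemma lipder_bdmeas a b f g : a <= b -> lipder a b f g -> bdmeas a b f.
Proof. by move=> ab [[K fK] _ _]; exact: lipschitz_bdmeas fK. Qed.

Lemma lipder_integral_itv a b f g : a < b -> lipder a b f g ->
  {in `[a, b], forall t, f t - f a = \int[mu]_(s in `[a, t]) g s}.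
Proof.
move=> ab [[K fK] bg fg].
have [|h [mh hK hf fh]] := lipschitz_FTC ab fK.
  by apply: aeS fg => t fg /fg; exact: derivable_der.
move=> t tab; rewrite fh//.
have tab' : `[a, t] `<=` `[a, b].
  by apply: subset_itvl; move: tab; rewrite in_itv/= bnd_simp => /andP[].
have bh : bdmeas a b h by split; [exact: measurable_funTS|exists K].
apply: ae_eq_Rintegral; [exact: bdmeasS bh|exact: bdmeasS bg|].
apply: aeS2 hf fg => s hs fs; rewrite in_itv/= => /andP[as_ st].
have sab : s \in `]a, b[.
  by move: tab; rewrite !in_itv/= as_ => /andP[_]; exact: lt_le_trans.
by rewrite hs// (derive1_der (fs sab)).
Qed.

Lemma lipder_integral a b f g : a < b -> lipder a b f g ->
  \int[mu]_(s in `[a, b]) g s = f b - f a.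
Proof.
by move=> ab fg; rewrite (lipder_integral_itv ab fg)// in_itv/= lexx ltW.
Qed.

Lemma lipder_cst a b (r : R) : lipder a b (fun=> r) (fun=> 0).
Proof.
split; [exists 0 => s t _ _|exact: bdmeas_cst|].
  by rewrite subrr normr0 mul0r.
by apply: aeW => t _; exact: der_cst.
Qed.

Lemma lipderD a b f g h k : lipder a b f g -> lipder a b h k ->
  lipder a b (fun t => f t + h t) (fun t => g t + k t).
Proof.
move=> [[K fK] bg fg] [[L hL] bk hk]; split; last 2 first.
- exact: bdmeasD.
- by apply: aeS2 fg hk => t fg hk tab; apply: derD; [exact: fg|exact: hk].
exists (K + L) => s t sab tab; rewrite opprD addrACA mulrDl.
by rewrite (le_trans (ler_normD _ _))// lerD ?fK ?hL.
Qed.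

Lemma lipderM a b f g h k : a <= b -> lipder a b f g -> lipder a b h k ->
  lipder a b (fun t => f t * h t) (fun t => g t * h t + f t * k t).
Proof.
move=> ab fg hk.
have [bf bh] : bdmeas a b f /\ bdmeas a b h.
  by split; [exact: lipder_bdmeas fg|exact: lipder_bdmeas hk].
move: (fg) (hk) => [[K fK] bg dfg] [[L hL] bk dhk]; split; last 2 first.
- by apply: bdmeasD; exact: bdmeasM.
- by apply: aeS2 dfg dhk => t dfg dhk tab; apply: derM; [exact: dfg|exact: dhk].
have [_ [M fM]] := bf; have [_ [P hP]] := bh.
exists (K * P + M * L) => s t sab tab.
have -> : f s * h s - f t * h t = (f s - f t) * h s + f t * (h s - h t) by ring.
rewrite (le_trans (ler_normD _ _))// !normrM mulrDl lerD//.
  by rewrite mulrAC ler_pM ?fK ?hP.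
by rewrite -mulrA ler_pM ?fM ?hL.
Qed.

Lemma lipder_eq a b f g k : lipder a b f g -> g =1 k -> lipder a b f k.
Proof. by move=> fg /funext <-. Qed.

Lemma lipderZ a b (r : R) f g : a <= b -> lipder a b f g ->
  lipder a b (fun t => r * f t) (fun t => r * g t).
Proof.
move=> ab fg; apply: lipder_eq (lipderM ab (lipder_cst a b r) fg) _ => t.
by rewrite mul0r add0r.
Qed.

Lemma lipderB a b f g h k : a <= b -> lipder a b f g -> lipder a b h k ->
  lipder a b (fun t => f t - h t) (fun t => g t - k t).
Proof.
move=> ab fg /(lipderZ (-1) ab) /(lipderD fg); congr lipder;
  by apply/funext => t; rewrite mulN1r.
Qed.

Lemma lipder_sum a b (I : Type) (r : seq I) (f g : I -> R -> R) :
  (forall i, lipder a b (f i) (g i)) ->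
  lipder a b (fun t => \sum_(i <- r) f i t) (fun t => \sum_(i <- r) g i t).
Proof.
move=> fg; elim: r => [|i r IH].
  by under eq_fun do rewrite big_nil; under [X in lipder _ _ _ X]eq_fun do
    rewrite big_nil; exact: lipder_cst.
by under eq_fun do rewrite big_cons; under [X in lipder _ _ _ X]eq_fun do
  rewrite big_cons; exact: lipderD.
Qed.

Lemma lipder_primitive a b g (y : R) : bdmeas a b g ->
  lipder a b (fun t => y + \int[mu]_(s in `[a, t]) g s) g.
Proof.
move=> bg; have [_ [M gM]] := bg; split => //.
  exists M => s t sab tab; rewrite opprD addrACA subrr add0r.
  exact: lipschitz_primitive bg gM _ _ sab tab.
apply: aeS (ae_derive_primitive bg) => t dg tab.
by have := derD (der_cst t y) (dg tab); rewrite add0r.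
Qed.

Lemma lipder_continuous a b f g t : lipder a b f g -> t \in `]a, b[ ->
  {for t, continuous f}.
Proof.
move=> [[K fK] _ _] tab; apply/cvgrPdist_lt => e e0.
have K1 : 0 < `|K| + 1 by rewrite ltr_wpDl.
have tabc : t \in `[a, b] by move: tab; rewrite !in_itv/= => /andP[/ltW -> /ltW ->].
near=> s; have sab : s \in `[a, b].
  have : s \in `]a, b[ by near: s; exact: near_in_itvoo.
  by rewrite !in_itv/= => /andP[/ltW -> /ltW ->].
apply: le_lt_trans (fK _ _ tabc sab) _.
apply: (@le_lt_trans _ _ ((`|K| + 1) * `|t - s|)).
  by rewrite ler_wpM2r// (le_trans (ler_norm _))// lerDl.
rewrite mulrC -ltr_pdivlMr//; near: s.
by exists (e / (`|K| + 1)) => //=; rewrite divr_gt0.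
Unshelve. all: by end_near. Qed.

(** Near [t] the function [f] is a primitive of [g]. This is what turns an almost everywhere
    differential equation with continuous right-hand side into a pointwise one. *)
Lemma der_lipder a b f g t : a < b -> lipder a b f g -> t \in `]a, b[ ->
  {for t, continuous g} -> is_derive t 1 f (g t).
Proof.
move=> ab fg tab cg; have [_ bg _] := fg.
move: (tab); rewrite in_itv/= => /andP[at_ tb].
have [|dg g't] := continuous_FTC1 tb (bdmeas_integrable bg) _ cg.
  by rewrite lte_fin.
have := der_derive1 dg; rewrite g't => {}dg.
apply: der_near (_ : is_derive t 1 (fun s => f a + \int[mu]_(r in `[a, s]) g r) (g t)).
  near=> s; rewrite -(lipder_integral_itv ab fg); first by rewrite addrCA subrr addr0.
  have : s \in `]a, b[ by near: s; exact: near_in_itvoo.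
  by rewrite !in_itv/= => /andP[/ltW -> /ltW ->].
by have := derD (der_cst t (f a)) dg; rewrite add0r.
Unshelve. all: by end_near. Qed.

Lemma derivable_lipder a b f g : a <= b -> 
  {in `[a, b], forall t : R, is_derive t 1 f (g t)} ->
  {within `[a, b], continuous g} -> lipder a b f g.
Proof.
move=> ab fg cg; have bg := bdmeas_continuous ab cg; split => //; last first.
  by apply: aeW => t; rewrite in_itv/= => /andP[ta tb]; apply: fg; rewrite in_itv/= !ltW.
have [_ [M gM]] := bg; exists M => s t; wlog st : s t / s <= t.
  move=> H sab tab; have [/H|/ltW/H] := leP s t; first exact.
  by rewrite distrC (distrC s); exact.
move=> sab tab; have stab r : r \in `[s, t] -> r \in `[a, b].
  move: sab tab; rewrite !in_itv/= => /andP[as_ _] /andP[_ tb] /andP[sr rt].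
  by rewrite (le_trans as_)// (le_trans rt).
have dst r : r \in `[s, t] -> is_derive r 1 f (g r) by move=> /stab; exact: fg.
have cst : {within `[s, t], continuous f} by exact: (@der_within_continuous _ f g).
have dst' r : r \in `]s, t[ -> is_derive r 1 f (g r).
  by rewrite in_itv/= => /andP[sr rt]; apply: dst; rewrite in_itv/= !ltW.
have [r rst E] := MVT_segment st dst' cst.
rewrite distrC E normrM distrC ler_wpM2r// gM//.
exact: stab.
Qed.

End lipder.

(** * Scalar product and derivatives of vector-valued curves *)

Section dot_product.
Context {R : realType} {N : nat}.
Implicit Types (x y z u v : 'rV[R]_N) (A : 'M[R]_N) (k : R).

Definition dot x y : R := \sum_i x 0 i * y 0 i.

Lemma dotC x y : dot x y = dot y x.
Proof. by apply: eq_bigr => i _; rewrite mulrC. Qed.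

Lemma dotDl x y z : dot (x + y) z = dot x z + dot y z.
Proof. by rewrite -big_split; apply: eq_bigr => i _; rewrite mxE mulrDl. Qed.

Lemma dotZl k x y : dot (k *: x) y = k * dot x y.
Proof. by rewrite mulr_sumr; apply: eq_bigr => i _; rewrite mxE mulrA. Qed.

Lemma dotDr x y z : dot x (y + z) = dot x y + dot x z.
Proof. by rewrite dotC dotDl !(dotC x). Qed.

Lemma dotZr k x y : dot x (k *: y) = k * dot x y.
Proof. by rewrite dotC dotZl dotC. Qed.

Lemma dotNl x y : dot (- x) y = - dot x y.
Proof. by rewrite -scaleN1r dotZl mulN1r. Qed.

Lemma dotNr x y : dot x (- y) = - dot x y.
Proof. by rewrite dotC dotNl dotC. Qed.

Lemma dot0l x : dot 0 x = 0.
Proof. by rewrite -(scale0r 0) dotZl mul0r. Qed.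

Lemma dot0r x : dot x 0 = 0.
Proof. by rewrite dotC dot0l. Qed.

Lemma dot_suml (I : Type) (r : seq I) (P : pred I) (F : I -> 'rV[R]_N) y :
  dot (\sum_(i <- r | P i) F i) y = \sum_(i <- r | P i) dot (F i) y.
Proof.
by elim/big_rec2: _ => [|i a b _ <-]; rewrite ?dot0l ?dotDl.
Qed.

Lemma dot_sumr (I : Type) (r : seq I) (P : pred I) (F : I -> 'rV[R]_N) y :
  dot y (\sum_(i <- r | P i) F i) = \sum_(i <- r | P i) dot y (F i).
Proof. by rewrite dotC dot_suml; apply: eq_bigr => i _; rewrite dotC. Qed.

Lemma dotE x y : dot x y = (x *m y^T) 0 0.
Proof. by rewrite mxE; apply: eq_bigr => i _; rewrite mxE. Qed.

Lemma dot_mulmx x y A : dot (x *m A) y = dot x (y *m A^T).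
Proof. by rewrite !dotE trmx_mul trmxK mulmxA. Qed.

Lemma dot_skew A x y : A^T = - A -> dot (x *m A) y = - dot x (y *m A).
Proof. by move=> skA; rewrite dot_mulmx skA mulmxN dotNr. Qed.

Lemma dot_skew_id A x : A^T = - A -> dot (x *m A) x = 0.
Proof.
move=> skA; have := dot_skew x x skA; rewrite (dotC x) => /eqP.
by rewrite -subr_eq0 opprK -mulr2n mulrn_eq0/= => /eqP.
Qed.

Lemma dot_ge0 x : 0 <= dot x x.
Proof. by apply: sumr_ge0 => i _; rewrite -expr2 sqr_ge0. Qed.

Lemma dot_eq0 x : (dot x x == 0) = (x == 0).
Proof.
apply/eqP/eqP => [/eqP|->]; last exact: dot0l.
rewrite psumr_eq0 => [/allP x0|i _]; last by rewrite -expr2 sqr_ge0.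
apply/rowP => i; have := x0 i (mem_index_enum i).
by rewrite mxE -expr2 sqrf_eq0 => /eqP.
Qed.

Lemma dot_gt0 x : (0 < dot x x) = (x != 0).
Proof. by rewrite lt_def dot_ge0 andbT dot_eq0. Qed.

Lemma dot_mulmx_bounded A :
  exists2 K : R, 0 < K & forall x, dot (x *m A) (x *m A) <= K * dot x x.
Proof.
pose B := A *m A^T; pose K := \sum_i \sum_j `|B j i|.
exists (K + 1) => [|x]; first by rewrite ltr_wpDl// !sumr_ge0// => i _; rewrite sumr_ge0.
rewrite dot_mulmx -mulmxA -/B.
have xi i : `|x 0 i| ^+ 2 <= dot x x.
  rewrite real_normK ?num_real// /dot (bigD1 i)//= -expr2 lerDl sumr_ge0// => j _.
  by rewrite -expr2 sqr_ge0.
have xij i j : `|x 0 i| * `|x 0 j| <= dot x x.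
  by have := sqr_ge0 (`|x 0 i| - `|x 0 j|); have := xi i; have := xi j; nra.
suff : dot x (x *m B) <= K * dot x x by have := dot_ge0 x; lra.
rewrite [X in X <= _]/dot mulr_suml; apply: ler_sum => i _.
rewrite mxE mulr_sumr mulr_suml; apply: ler_sum => j _.
rewrite mulrA mulrC (le_trans (ler_norm _))// !normrM ler_wpM2l//.
Qed.

End dot_product.

Section vector_derivative.
Context {R : realType}.

Lemma is_derive1_cvg (V : normedModType R) (c : R -> V) (t : R) (l : V) :
  is_derive t 1 c l <->
  (fun h => h^-1 *: ((c \o shift t) (h *: 1) - c t)) @ 0^' --> l.
Proof.
split=> [[/cvg_ex[/= m cm] <-]|cl].
  by rewrite /derive (cvg_lim _ cm)//; exact: norm_hausdorff.
split; first by apply/cvg_ex; exists l.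
by apply/cvg_lim => //; exact: norm_hausdorff.
Qed.

Lemma is_derive_pair (U V : normedModType R) (c : R -> U * V) (t : R) (l : U * V) :
  is_derive t 1 c l <->
  is_derive t 1 (fun s => (c s).1) l.1 /\ is_derive t 1 (fun s => (c s).2) l.2.
Proof.
split=> [/is_derive1_cvg cl|[/is_derive1_cvg cl1 /is_derive1_cvg cl2]].
  split; apply/is_derive1_cvg.
  - exact: (cvg_comp _ _ cl (@cvg_fst _ _ (nbhs l.1) (nbhs l.2) _)).
  - exact: (cvg_comp _ _ cl (@cvg_snd _ _ (nbhs l.1) (nbhs l.2) _)).
apply/is_derive1_cvg; rewrite [l]surjective_pairing.
exact: (cvg_pair cl1 cl2).
Qed.

Context {N : nat}.
Implicit Types (x y : R -> 'rV[R]_N) (u v w : 'rV[R]_N) (t : R).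

Definition vder x t w := forall i, is_derive t 1 (fun s => x s 0 i) (w 0 i).

Lemma vderP x t w : is_derive t 1 x w <-> vder x t w.
Proof.
split=> [[dx <-] i|dx].
  move/derivable_mxP: (dx) => dxi.
  by rewrite derive_mx// mxE; exact/derivableP.
have d : derivable x t 1 by apply/derivable_mxP => i j; rewrite ord1; exact: derivable_der.
split => //; rewrite derive_mx//; apply/matrixP => i j; rewrite mxE ord1.
by rewrite -derive1E; exact: derive1_der.
Qed.

Lemma vder_unique x t v w : vder x t v -> vder x t w -> v = w.
Proof. by move=> dv dw; apply/rowP => i; exact: der_unique (dv i) (dw i). Qed.

Lemma vder_eq x t v w : vder x t v -> v = w -> vder x t w.
Proof. by move=> + <-. Qed.

Lemma vder_cst t v : vder (fun=> v) t 0.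
Proof. by move=> i; rewrite mxE; exact: der_cst. Qed.

Lemma vderD x y t v w : vder x t v -> vder y t w ->
  vder (fun s => x s + y s) t (v + w).
Proof.
by move=> dx dy i; under eq_fun do rewrite mxE; rewrite mxE; exact: derD.
Qed.

Lemma vderZ (f : R -> R) x t a v : is_derive t 1 f a -> vder x t v ->
  vder (fun s => f s *: x s) t (a *: x t + f t *: v).
Proof.
by move=> df dx i; under eq_fun do rewrite mxE; rewrite !mxE; exact: derM.
Qed.

Lemma vderZl k x t v : vder x t v -> vder (fun s => k *: x s) t (k *: v).
Proof.
by move=> dx; apply: vder_eq (vderZ (der_cst t k) dx) _; rewrite scale0r add0r.
Qed.

Lemma vderZr (f : R -> R) t a v : is_derive t 1 f a ->
  vder (fun s => f s *: v) t (a *: v).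
Proof.
by move=> df; apply: vder_eq (vderZ df (vder_cst t v)) _; rewrite scaler0 addr0.
Qed.

Lemma vderN x t v : vder x t v -> vder (fun s => - x s) t (- v).
Proof.
by move=> dx i; under eq_fun do rewrite mxE; rewrite mxE; exact: derN.
Qed.

Lemma vderB x y t v w : vder x t v -> vder y t w ->
  vder (fun s => x s - y s) t (v - w).
Proof. by move=> dx /vderN; exact: vderD. Qed.

Lemma vder_mulmx (A : 'M[R]_N) x t v : vder x t v ->
  vder (fun s => x s *m A) t (v *m A).
Proof.
move=> dx i; under eq_fun do rewrite mxE; rewrite mxE; apply: der_sum => j.
by apply: der_eq (derM (dx j) (der_cst t _)) _; rewrite mulr0 addr0.
Qed.

Lemma der_dot x y t v w : vder x t v -> vder y t w ->
  is_derive t 1 (fun s => dot (x s) (y s)) (dot v (y t) + dot (x t) w).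
Proof.
by move=> dx dy; rewrite /dot -big_split; apply: der_sum => i; exact: derM.
Qed.

Lemma vder_near x y t w : (\forall s \near t, x s = y s) ->
  vder x t w -> vder y t w.
Proof.
by move=> xy dx i; apply: der_near (dx i); apply: filterS xy => s ->.
Qed.

End vector_derivative.

(** * Horizontal curves, their velocity and their energy *)

Section horizontal_curves.
Context {R : realType} {n : nat}.
Local Notation mu := (@lebesgue_measure R).
Local Notation V := 'rV[R]_(2 * n).
Implicit Types (A : 'M[R]_(2 * n)) (c : R -> V * R) (x u : R -> V) (a b t : R).

(** Here [u] is the velocity in the orthonormal frame; the second condition is the vertical part of
    [left_field A (u, 0)] at [c t], so the height has no freedom of its own. *)
Definition hvel A c t (u : V) :=
  vder (fun s => (c s).1) t u /\
  is_derive t 1 (fun s => (c s).2) (2^-1 * dot ((c t).1 *m A) u).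

Lemma horizontalP A c t :
  derivable c t 1 /\ horizontal_space A (c t) (derive1 c t) <->
  exists v : V, hvel A c t v.
Proof.
split=> [[dc [u _]]|[u [dx dz]]].
  rewrite left_fieldE /lie_bracket derive1E => uE; exists u.
  have /is_derive_pair[dx dz] := derivableP dc.
  move: dx dz; rewrite -uE /= scaler0 addr0 add0r -dotE => dx dz.
  by split=> //; exact/vderP.
have dc : is_derive t 1 c (u, 2^-1 * dot ((c t).1 *m A) u).
  by apply/is_derive_pair; split => //; exact/vderP.
split; first by case: dc.
exists u => //; rewrite left_fieldE /lie_bracket derive1E (@derive_val _ _ _ _ _ _ _ dc).
by apply/pair_equal_spec; rewrite /= scaler0 addr0 add0r -dotE.
Qed.

Lemma hvel_derive1 A c t (u : V) : hvel A c t u -> (derive1 c t).1 = u.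
Proof.
move=> [dx dz]; have dc : is_derive t 1 c (u, 2^-1 * dot ((c t).1 *m A) u).
  by apply/is_derive_pair; split => //; exact/vderP.
by rewrite derive1E (@derive_val _ _ _ _ _ _ _ dc).
Qed.

Lemma lipschitz_carnotP c a b : [lipschitz c t | t in `[a, b]] <->
  exists K : R, {in `[a, b] &, forall s t,
    (forall i, `|(c s).1 0 i - (c t).1 0 i| <= K * `|s - t|) /\
    `|(c s).2 - (c t).2| <= K * `|s - t|}.
Proof.
split=> [[M [_ cM]]|[K cK]].
  exists (M + 1) => s t sab tab.
  have := cM (M + 1); rewrite ltrDl ltr01 => /(_ isT (s, t)) /=.
  move=> /(_ (conj sab tab)); rewrite /self_sub/= prod_normE/= ge_max.
  move=> /andP[h1 h2]; split=> // i; apply: le_trans h1.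
  rewrite [leRHS]/Num.Def.normr/= mx_normrE.
  by apply: le_trans; last exact: (le_bigmax _ _ (0, i)); rewrite !mxE.
exists `|K|; split; first exact: num_real.
move=> M KM [s t] /= [sab tab]; have [h1 h2] := cK _ _ sab tab.
have KM' : K * `|s - t| <= M * `|s - t|.
  by rewrite ler_wpM2r// (le_trans (ler_norm _))// ltW.
rewrite /self_sub/= prod_normE/= ge_max (le_trans h2)// andbT.
rewrite [leLHS]/Num.Def.normr/= mx_normrE.
apply: bigmax_le => [|[i j] _]; last by rewrite /= !mxE ord1 (le_trans (h1 j)).
by rewrite mulr_ge0// (le_trans _ (ltW KM)).
Qed.

Lemma bdmeas_dot a b x u : (forall i, bdmeas a b (fun t => x t 0 i)) ->
  (forall i, bdmeas a b (fun t => u t 0 i)) -> bdmeas a b (fun t => dot (x t) (u t)).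
Proof. by move=> bx bu; apply: bdmeas_sum => i; exact: bdmeasM. Qed.

Lemma bdmeas_mulmx a b A x : (forall i, bdmeas a b (fun t => x t 0 i)) ->
  forall i, bdmeas a b (fun t => (x t *m A) 0 i).
Proof.
move=> bx i; under eq_fun do rewrite mxE; apply: bdmeas_sum => j.
by apply: bdmeasM => //; exact: bdmeas_cst.
Qed.

(** The integrand of [energy] is [derive1 c], whose values off the points of differentiability need
    not be measurable; hence the appeal to [ge0_ae_eq_integral_nonmeas]. *)
Lemma energy_velocity A a b c u :
  (forall i, bdmeas a b (fun t => u t 0 i)) ->
  (\forall t \ae mu, t \in `]a, b[ -> hvel A c t (u t)) ->
  energy a b c = (2^-1 * \int[mu]_(t in `[a, b]) dot (u t) (u t))%:E.
Proof.
move=> bu hu; rewrite /energy EFinM; congr (_ * _)%E.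
have bd : bdmeas a b (fun t => dot (u t) (u t)) by exact: bdmeas_dot.
rewrite /Rintegral fineK; last exact: integrable_fin_num (bdmeas_integrable bd).
apply: ge0_ae_eq_integral_nonmeas => //.
- by apply/measurable_EFinP; exact: bd.1.
- by move=> t _; rewrite lee_fin sumr_ge0// => i _; rewrite sqr_ge0.
- by move=> t _; rewrite lee_fin dot_ge0.
have ab := aeS2 (fun t => @conj _ _) (ae_neq a) (ae_neq b).
have := aeS2 (fun t => @conj _ _) hu ab; apply: aeS.
move=> t [{}hu [ta tb]] /=; rewrite in_itv/= => /andP[at_ tb'].
by rewrite (hvel_derive1 (hu _)) ?in_itv/= ?lt_neqAle 1?eq_sym ?ta ?at_ ?tb.
Qed.

Definition vlipder a b x u :=
  forall i, lipder a b (fun t => x t 0 i) (fun t => u t 0 i).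

Lemma vlipder_bdmeas a b x u i : a <= b -> vlipder a b x u ->
  bdmeas a b (fun t => x t 0 i).
Proof. by move=> ab /(_ i); exact: lipder_bdmeas. Qed.

Lemma vlipder_bdmeasr a b x u i : vlipder a b x u -> bdmeas a b (fun t => u t 0 i).
Proof. by move=> /(_ i)[]. Qed.

Lemma vlipderD a b (y z u v : R -> V) : vlipder a b y u -> vlipder a b z v ->
  vlipder a b (fun t => y t + z t) (fun t => u t + v t).
Proof.
move=> yu zv i; have := lipderD (yu i) (zv i).
by congr lipder; apply/funext => t; rewrite !mxE.
Qed.

Lemma vlipderZ a b (k : R) (y u : R -> V) : a <= b -> vlipder a b y u ->
  vlipder a b (fun t => k *: y t) (fun t => k *: u t).
Proof.
move=> ab yu i; have := lipderZ k ab (yu i).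
by congr lipder; apply/funext => t; rewrite !mxE.
Qed.

Lemma vlipder_cst a b (v : V) : vlipder a b (fun=> v) (fun=> 0).
Proof. by move=> i; rewrite mxE; exact: lipder_cst. Qed.

Lemma vlipderB a b x y u v : a <= b -> vlipder a b x u -> vlipder a b y v ->
  vlipder a b (fun t => x t - y t) (fun t => u t - v t).
Proof.
move=> ab xu yv i; have := lipderB ab (xu i) (yv i).
by congr lipder; apply/funext => t; rewrite !mxE.
Qed.

Lemma vlipder_mulmx a b A x u : a <= b -> vlipder a b x u ->
  vlipder a b (fun t => x t *m A) (fun t => u t *m A).
Proof.
move=> ab xu i.
have := lipder_sum (index_enum _) (fun j => lipderZ (A j i) ab (xu j)).
by congr lipder; apply/funext => t; rewrite mxE; apply: eq_bigr => j _; rewrite mulrC.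
Qed.

Lemma lipder_dot a b x y u v : a <= b -> vlipder a b x u -> vlipder a b y v ->
  lipder a b (fun t => dot (x t) (y t))
             (fun t => dot (u t) (y t) + dot (x t) (v t)).
Proof.
move=> ab xu yv.
apply: lipder_eq (lipder_sum (index_enum _) (fun j => lipderM ab (xu j) (yv j))) _.
by move=> t; rewrite big_split.
Qed.

Lemma ae_vlipder a b x u : vlipder a b x u ->
  \forall t \ae mu, t \in `]a, b[ -> vder x t (u t).
Proof.
move=> xu; have : \forall t \ae mu, forall i, t \in `]a, b[ ->
    is_derive t 1 (fun s => x s 0 i) (u t 0 i).
  by apply: filter_forall => i; have [] := xu i.
by apply: aeS => t xut tab i; exact: xut.
Qed.

(** The velocity is assembled from [lipschitz_FTC] coordinate by coordinate; uniqueness of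
    derivatives identifies it almost everywhere with the frame velocity, which gives the formula for
    the height. *)
Lemma horizontal_curve_lipder A a b c : a < b -> horizontal_curve A a b c ->
  exists u, vlipder a b (fun t => (c t).1) u /\
    lipder a b (fun t => (c t).2) (fun t => 2^-1 * dot ((c t).1 *m A) (u t)).
Proof.
move=> ab [/lipschitz_carnotP[K cK] hc].
have cKi i : {in `[a, b] &, forall s t,
    `|(c s).1 0 i - (c t).1 0 i| <= K * `|s - t|}.
  by move=> s t sab tab; exact: (cK _ _ sab tab).1.
have hv : \forall t \ae mu, t \in `]a, b[ -> exists v, hvel A c t v.
  by apply: aeS hc => t hc /hc /horizontalP.
have dxi i : \forall t \ae mu, t \in `]a, b[ -> derivable (fun s => (c s).1 0 i) t 1.
  by apply: aeS hv => t hv /hv [v [dx _]]; exact: derivable_der (dx i).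
have /(_ _)/cid gi i := lipschitz_FTC ab (cKi i) (dxi i).
pose u t : V := \row_i (sval (gi i)) t.
have xu : vlipder a b (fun t => (c t).1) u.
  move=> i; split; first by exists K.
    under eq_fun do rewrite mxE.
    by have [mg gK _ _] := svalP (gi i); split; [exact: measurable_funTS|exists K].
  have [_ _ gd _] := svalP (gi i); apply: aeS2 (dxi i) gd => t dx gd tab.
  by rewrite mxE gd//; exact/der_derive1/dx.
exists u; split => //; split.
- by exists K => s t sab tab; exact: (cK _ _ sab tab).2.
- apply: bdmeasM; first exact: bdmeas_cst.
  apply: bdmeas_dot => i; last exact: vlipder_bdmeasr xu.
  by apply: bdmeas_mulmx => j; exact: vlipder_bdmeas (ltW ab) xu.
- apply: aeS2 hv (ae_vlipder xu) => t hv xut tab; have [v [dx dz]] := hv tab.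
  by rewrite (vder_unique (xut tab) dx).
Qed.

Lemma ae_hvel_lipder A a b c u :
  vlipder a b (fun t => (c t).1) u ->
  lipder a b (fun t => (c t).2) (fun t => 2^-1 * dot ((c t).1 *m A) (u t)) ->
  \forall t \ae mu, t \in `]a, b[ -> hvel A c t (u t).
Proof.
move=> /ae_vlipder dx [_ _ dz].
by apply: aeS2 dx dz => t dx dz tab; split; [exact: dx|exact: dz].
Qed.

Lemma lipder_horizontal_curve A a b c u :
  vlipder a b (fun t => (c t).1) u ->
  lipder a b (fun t => (c t).2) (fun t => 2^-1 * dot ((c t).1 *m A) (u t)) ->
  horizontal_curve A a b c.
Proof.
move=> xu zu; split; last first.
  apply: aeS (ae_hvel_lipder xu zu) => t hu /hu h; apply/horizontalP.
  by exists (u t).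
apply/lipschitz_carnotP; have [[L zL] _ _] := zu.
have /(_ _)/cid K i : exists K : R, {in `[a, b] &, forall s t,
    `|(c s).1 0 i - (c t).1 0 i| <= K * `|s - t|} by have [] := xu i.
pose M := `|L| + \sum_i `|sval (K i)|.
have Mm (s t k : R) : k <= M -> k * `|s - t| <= M * `|s - t|.
  by move=> kM; rewrite ler_wpM2r.
exists M => s t sab tab; split=> [i|].
  apply: le_trans (svalP (K i) _ _ sab tab) (Mm _ _ _ _).
  rewrite /M (bigD1 i)//= addrCA (le_trans (ler_norm _))// lerDl.
  by rewrite addr_ge0// sumr_ge0.
apply: le_trans (zL _ _ sab tab) (Mm _ _ _ _).
by rewrite (le_trans (ler_norm _))// lerDl sumr_ge0.
Qed.

Lemma energy_lipder A a b c u :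
  vlipder a b (fun t => (c t).1) u ->
  lipder a b (fun t => (c t).2) (fun t => 2^-1 * dot ((c t).1 *m A) (u t)) ->
  energy a b c = (2^-1 * \int[mu]_(t in `[a, b]) dot (u t) (u t))%:E.
Proof.
move=> xu zu; apply: energy_velocity (ae_hvel_lipder xu zu) => i.
exact: vlipder_bdmeasr xu.
Qed.

End horizontal_curves.

(** * Sufficiency: extremals minimize on short intervals *)

Section calibration.
Context {R : realType} {n : nat}.
Local Notation mu := (@lebesgue_measure R).
Local Notation V := 'rV[R]_(2 * n).
Variable A : 'M[R]_(2 * n).
Hypothesis A_skew : A^T = - A.

(** By skew symmetry the right side minus the left side is the square of
    [g - (th / 2) *: (f *m A) + r *: f], plus [(2 * M - r ^+ 2) * dot f f], minus
    [th ^+ 2 / 4 * dot (f *m A) (f *m A)]; the hypotheses bound the last term by [M * dot f f] and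
    [r ^+ 2] by [M]. In the application the bracket is an exact derivative in which [2 * M] is the
    derivative of [r], so what is used is the Riccati inequality [r' >= M + r ^+ 2]. *)
Lemma calibration_ineq (M K th r : R) (x u f g : V) :
  dot (f *m A) (f *m A) <= K * dot f f -> th ^+ 2 * K = 4 * M -> r ^+ 2 <= M ->
  dot u u + 2 * (dot (th *: (u *m A)) f + dot u g
    + th * (2^-1 * dot ((x + f) *m A) (u + g) - 2^-1 * dot (x *m A) u)
    - th / 2 * (dot (u *m A) f + dot (x *m A) g)
    - 2^-1 * (2 * M * dot f f + r * (dot g f + dot f g)))
  <= dot (u + g) (u + g).
Proof.
move=> fK thK rM.
have sq := dot_ge0 (g - (th / 2) *: (f *m A) + r *: f).
have fu : dot (f *m A) u = - dot (u *m A) f by rewrite dot_skew// dotC.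
have ff := dot_skew_id f A_skew.
move: sq; rewrite !(mulmxDl, dotDl, dotDr, dotZl, dotZr, dotNl, dotNr) fu.
rewrite (dotC f (f *m A)) ff (dotC g f) (dotC g u) (dotC g (f *m A)) => sq.
have f0 := dot_ge0 f.
have h1 : th ^+ 2 * dot (f *m A) (f *m A) <= 4 * M * dot f f.
  by rewrite -thK -mulrA ler_wpM2l// sqr_ge0.
have h2 : r ^+ 2 * dot f f <= M * dot f f by rewrite ler_wpM2r.
set a1 := dot (f *m A) (f *m A) in sq h1 *.
move: a1 sq h1 h2 => a1.
set a2 := dot f f; set a3 := dot (u *m A) f; set a4 := dot (f *m A) g.
set a5 := dot g g; set a6 := dot f g; set a7 := dot u g.
set a8 := dot (x *m A) g; set a9 := dot (x *m A) u; set a10 := dot u u.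
rewrite !expr2 => sq h1 h2.
have E : 0 <= a5 - th * a4 + th * th / 4 * a1 + 2 * r * a6 + r * r * a2.
  by apply: le_trans sq _; rewrite le_eqVlt; apply/orP; left; apply/eqP; field.
lra.
Qed.

Variables (v : V) (th : R) (c : R -> V * R).
Let u t : V := v + th *: ((c t).1 *m A).
Hypothesis c_hvel : forall t, hvel A c t (u t).

Lemma vder_extremal_velocity t : vder u t (th *: (u t *m A)).
Proof.
have [dx _] := c_hvel t.
by have := vderD (vder_cst t v) (vderZl th (vder_mulmx A dx)); rewrite add0r.
Qed.

Lemma extremal_vlipder a b : a <= b ->
  vlipder a b (fun t => (c t).1) u /\ vlipder a b u (fun t => th *: (u t *m A)).
Proof.
move=> ab; split=> i; apply: derivable_lipder => // [t tab|].
- exact: (c_hvel t).1.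
- apply: (@der_within_continuous _ _ (fun t => (th *: (u t *m A)) 0 i)) => t _.
  exact: vder_extremal_velocity.
- exact: vder_extremal_velocity.
- have d t := vderZl th (vder_mulmx A (vder_extremal_velocity t)).
  by apply: (@der_within_continuous _ _) => t _; exact: d.
Qed.

Lemma extremal_lipder a b : a <= b ->
  lipder a b (fun t => (c t).2) (fun t => 2^-1 * dot ((c t).1 *m A) (u t)).
Proof.
move=> ab; apply: derivable_lipder => // [t tab|]; first exact: (c_hvel t).2.
apply: der_within_continuous => t _; apply: derZ.
apply: der_dot; last exact: vder_extremal_velocity.
exact: vder_mulmx (c_hvel t).1.
Qed.

Lemma extremal_locally_minimizing : exists2 e : R, 0 < e &
  forall t0 a b : R, a < b -> t0 - e <= a -> b <= t0 + e -> energy_minimizing A a b c.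
Proof.
have [K K0 AK] := dot_mulmx_bounded A.
pose M := th ^+ 2 * K / 4.
have M0 : 0 <= M by rewrite divr_ge0// mulr_ge0 ?sqr_ge0// ltW.
(* With [r t = 2 * M * (t - t0)], the condition [r ^+ 2 <= M] follows from [4 * M * e ^+ 2 <= 1],
   which holds for this [e]; the summand 1 covers [M = 0]. *)
exists (2 * (M + 1))^-1; first by rewrite invr_gt0 mulr_gt0// ltr_wpDl.
move=> t0 a b ab ta tb; have ab' := ltW ab.
have [xu uu] := extremal_vlipder ab'; have zu := extremal_lipder ab'.
split; first exact: lipder_horizontal_curve xu zu.
move=> d hd da db; have [w [xw zw]] := horizontal_curve_lipder ab hd.
rewrite (energy_lipder xu zu) (energy_lipder xw zw) lee_fin ler_wpM2l//.
pose f t : V := (d t).1 - (c t).1; pose g t : V := w t - u t.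
have fg : vlipder a b f g by exact: vlipderB.
pose r t := 2 * M * (t - t0).
have rl : lipder a b r (fun=> 2 * M).
  apply: derivable_lipder => // [t _|]; last exact/continuous_subspaceT/cst_continuous.
  apply: der_eq (derZ (2 * M) (derB (der_id t) (der_cst t t0))) _.
  by rewrite subr0 mulr1.
(* The function differentiated is [dot u f], plus [th] times the difference of heights, minus
   [th / 2 * dot (x *m A) f], minus [r / 2 * dot f f]. It vanishes at both ends, since the curves
   share their endpoints, so its derivative [h] has integral zero. *)
have Hl := lipderB ab' (lipderB ab' (lipderD (lipder_dot ab' uu fg)
    (lipderZ th ab' (lipderB ab' zw zu)))
  (lipderZ (th / 2) ab' (lipder_dot ab' (vlipder_mulmx A ab' xu) fg)))
  (lipderZ 2^-1 ab' (lipderM ab' rl (lipder_dot ab' fg fg))).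
have := lipder_integral ab Hl; set h := (h in \int[_]_(s in _) h s).
have [_ bh _] := Hl; rewrite -/h in bh.
have fa : f a = 0 by rewrite /f da subrr.
have fb : f b = 0 by rewrite /f db subrr.
rewrite fa fb da db !dot0r !subrr !mulr0 !addr0 !subr0 => Ih.
have buu : bdmeas a b (fun t => dot (u t) (u t)).
  by apply: bdmeas_dot => i; exact: vlipder_bdmeasr xu.
have bww : bdmeas a b (fun t => dot (w t) (w t)).
  by apply: bdmeas_dot => i; exact: vlipder_bdmeasr xw.
have b2h : bdmeas a b (fun t => 2 * h t) by apply: bdmeasM => //; exact: bdmeas_cst.
have <- : \int[mu]_(t in `[a, b]) (dot (u t) (u t) + 2 * h t) =
    \int[mu]_(t in `[a, b]) dot (u t) (u t).
  rewrite RintegralD//; [|exact: bdmeas_integrable..].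
  by rewrite RintegralZl// ?Ih ?mulr0 ?addr0//; exact: bdmeas_integrable.
apply: le_Rintegral => //; [exact/bdmeas_integrable/bdmeasD|exact: bdmeas_integrable|].
move=> t /=; rewrite in_itv/= => /andP[at_ tb'].
have wE : w t = u t + g t by rewrite /g addrC subrK.
have dE : (d t).1 = (c t).1 + f t by rewrite /f addrC subrK.
rewrite /h {1 2}wE wE dE; apply: (calibration_ineq (K := K)) => //.
  by rewrite /M; field.
set e := (2 * (M + 1))^-1 in ta tb.
have e1 : 2 * (M + 1) * e = 1 by rewrite mulfV// gt_eqF// mulr_gt0// ltr_wpDl.
have s2 : (t - t0) ^+ 2 <= e ^+ 2 by rewrite !expr2; nra.
have e2 : 4 * (M + 1) ^+ 2 * e ^+ 2 = 1.
  by transitivity ((2 * (M + 1) * e) ^+ 2); [ring|rewrite e1 expr1n].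
have e3 : 4 * M * e ^+ 2 <= 1.
  by rewrite -e2 ler_wpM2r ?sqr_ge0//; nra.
rewrite /r; have -> : (2 * M * (t - t0)) ^+ 2 = M * (4 * M * (t - t0) ^+ 2) by ring.
rewrite ler_piMr//; apply: le_trans e3; rewrite ler_wpM2l//; lra.
Qed.

End calibration.

(** * Necessity: minimizers are extremals *)

Section first_variation_algebra.
Context {R : realType}.

(* The correction [d] restoring the constraint is of order [e ^+ 2], whereas
   the gain in energy is of order [e]. *)
Lemma first_variation (Y p q s rho B : R) : 0 < Y -> 0 <= rho ->
  (forall e d : R, d * Y + e ^+ 2 * p + e * d * q + d ^+ 2 * s = 0 ->
    0 <= - (2 * e * rho) + 2 * d * B + e ^+ 2 * rho + d ^+ 2 * Y) ->
  rho = 0.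
Proof.
move=> Y0; rewrite le_eqVlt => /predU1P[//|r0] H; exfalso.
have [S S0 SY] : exists2 S, 0 < S & S * Y = `|p| + 1.
  by exists ((`|p| + 1) / Y); rewrite ?divr_gt0 ?ltr_wpDl ?divfK ?gt_eqF.
pose C1 := S * `|q| + S ^+ 2 * `|s|.
pose C2 := 2 * S * `|B| + rho + S ^+ 2 * Y.
have C10 : 0 <= C1 by rewrite addr_ge0// mulr_ge0// ?sqr_ge0// ltW.
have C20 : 0 <= C2.
  have := mulr_ge0 (ltW S0) (normr_ge0 B); have := mulr_ge0 (sqr_ge0 S) (ltW Y0).
  by rewrite /C2; lra.
(* Taking [e = 1 / D] ensures at once [e <= 1], [e * C1 <= 1] and [e * C2 <= rho]. *)
pose D := 1 + C1 + C2 / rho.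
have C2r : 0 <= C2 / rho by rewrite divr_ge0// ltW.
have D0 : 0 < D by rewrite /D; lra.
have [e e0 eD] : exists2 e, 0 < e & e * D = 1.
  by exists D^-1; rewrite ?invr_gt0 ?mulVf ?gt_eqF.
have D1 : 1 <= D by rewrite /D; lra.
have e1 : e <= 1 by rewrite -[leRHS]eD ler_peMr// ltW.
have eC1 : e * C1 <= 1 by rewrite -eD ler_pM2l// /D; lra.
have eC2 : e * C2 <= rho.
  have E : C2 = C2 / rho * rho by rewrite divfK// gt_eqF.
  rewrite {1}E mulrA -[leRHS]mul1r -eD ler_pM2r// ler_pM2l// /D; lra.
pose P r := r * Y + p + e * r * q + e ^+ 2 * r ^+ 2 * s.
have ee : e ^+ 2 <= e by rewrite expr2 -[leRHS]mulr1 ler_pM2l.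
have bq : e * S * `|q| + e ^+ 2 * S ^+ 2 * `|s| <= 1.
  apply: le_trans eC1; rewrite /C1 mulrDr (mulrA e S) (mulrA e (S ^+ 2)) lerD2l// ler_wpM2r//.
  by rewrite ler_wpM2r// sqr_ge0.
have eS : 0 <= e * S by rewrite mulr_ge0// ltW.
have eS2 : 0 <= e ^+ 2 * S ^+ 2 by rewrite mulr_ge0// sqr_ge0.
have q1 : e * S * - `|q| <= e * S * q <= e * S * `|q|.
  by rewrite !ler_wpM2l// ?ler_norm// lerNl (le_trans (ler_norm _))// normrN.
have s1 : e ^+ 2 * S ^+ 2 * - `|s| <= e ^+ 2 * S ^+ 2 * s <= e ^+ 2 * S ^+ 2 * `|s|.
  by rewrite !ler_wpM2l// ?ler_norm// lerNl (le_trans (ler_norm _))// normrN.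
have p1 := ler_norm p; have p2 := ler_norm (- p); rewrite normrN in p2.
have PS : 0 <= P S by rewrite /P SY; lra.
have PNS : P (- S) <= 0 by rewrite /P sqrrN !mulNr mulrN mulNr SY; lra.
have cP : {within `[- S, S], continuous P}.
  apply: (@der_within_continuous _ _ (fun r => Y + e * q + e ^+ 2 * (r + r) * s)).
  move=> r _; have dr := der_id r; have dc k := der_cst r k.
  apply: der_eq (derD (derD (derD (derM dr (dc Y)) (dc p)) (derM (derM (dc e) dr) (dc q)))
    (derM (derM (dc (e ^+ 2)) (derM dr dr)) (dc s))) _.
  by ring.
have [||r rS Pr] := @IVT _ P (- S) S 0 _ cP.
- lra.
- by rewrite ge_min PNS/= le_max PS orbT.
have := H e (e ^+ 2 * r); rewrite leNgt => /(_ _)/negP; apply.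
  by rewrite -[RHS](mulr0 (e ^+ 2)) -Pr /P; ring.
have rSn : `|r| <= S by rewrite ler_norml; move: rS; rewrite in_itv.
have rB : r * B <= S * `|B|.
  by rewrite (le_trans (ler_norm _))// normrM ler_wpM2r.
have r2 : r ^+ 2 <= S ^+ 2 by rewrite -(real_normK (num_real r)) lerXn2r// ?nnegrE// ltW.
have e2 : e ^+ 2 <= 1 by rewrite (le_trans ee).
have h1 : e * (r * B) * 2 + e * rho + e * (e ^+ 2 * r ^+ 2 * Y) <= e * C2.
  have t1 : e * (r * B) <= e * (S * `|B|) by rewrite ler_pM2l.
  have t2 : e * (e ^+ 2 * r ^+ 2 * Y) <= e * (S ^+ 2 * Y).
    by rewrite ler_pM2l// ler_pM2r// -[leRHS]mul1r ler_pM// sqr_ge0.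
  by rewrite /C2; lra.
have -> : - (2 * e * rho) + 2 * (e ^+ 2 * r) * B + e ^+ 2 * rho + (e ^+ 2 * r) ^+ 2 * Y
  = e * (- 2 * rho + (e * (r * B) * 2 + e * rho + e * (e ^+ 2 * r ^+ 2 * Y))) by ring.
by rewrite pmulr_rlt0//; lra.
Qed.

End first_variation_algebra.

Ltac bdm := by do ![exact: bdmeas_cst | assumption | apply: bdmeasD | apply: bdmeasM].

Section interval_integral.
Context {R : realType} (a b : R).
Local Notation mu := (@lebesgue_measure R).
Implicit Types (f g : R -> R).
Local Notation I f := (\int[mu]_(t in `[a, b]) f t).

Lemma RintegralZD (k : R) f g : bdmeas a b f -> bdmeas a b g ->
  I (fun t => k * f t + g t) = k * I f + I g.
Proof.
move=> bf bg; rewrite RintegralD// ?RintegralZl//; try exact: bdmeas_integrable.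
by apply: bdmeas_integrable; apply: bdmeasM => //; exact: bdmeas_cst.
Qed.

Lemma Rintegral_dot_cst N (m : 'rV[R]_N) (r : R -> 'rV[R]_N) :
  (forall i, bdmeas a b (fun t => r t 0 i)) -> (forall i, I (fun t => r t 0 i) = 0) ->
  I (fun t => dot m (r t)) = 0.
Proof.
move=> br r0; rewrite /dot; elim: (index_enum _) => [|i s IH].
  by under eq_Rintegral do rewrite big_nil; rewrite Rintegral_cst// mul0r.
under eq_Rintegral do rewrite big_cons.
rewrite RintegralZD ?r0 ?mulr0 ?add0r//; apply: bdmeas_sum => j.
by apply: bdmeasM => //; exact: bdmeas_cst.
Qed.

Lemma Rintegral_eq0_ae f : bdmeas a b f -> (forall t, 0 <= f t) -> I f = 0 ->
  \forall t \ae mu, t \in `]a, b[ -> f t = 0.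
Proof.
move=> bf f0 If.
have H : (\int[mu]_(t in `[a, b]) `|(EFin \o f) t|)%E = 0%E.
  under eq_integral do rewrite /= ger0_norm//.
  rewrite -[LHS]fineK; first by rewrite -/(Rintegral _ _ _) If.
  exact: integrable_fin_num (bdmeas_integrable bf).
have : ae_eq mu [set` `[a, b]] (EFin \o f) (cst 0%E).
  by apply/ae_eq_integral_abs => //; apply/measurable_EFinP; exact: bf.1.
apply: aeS => t /= + tab => /(_ _) ft; apply: EFin_inj; apply: ft.
by move: tab; rewrite !in_itv/= => /andP[/ltW -> /ltW ->].
Qed.

Lemma lipder_ae f g k : lipder a b f g -> bdmeas a b k ->
  (\forall t \ae mu, t \in `]a, b[ -> g t = k t) -> lipder a b f k.
Proof.
move=> [fK bg fg] bk gk; split => //.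
by apply: aeS2 fg gk => t fg gk tab; rewrite -gk//; exact: fg.
Qed.

End interval_integral.

Section minimizers_are_extremal.
Context {R : realType} {n : nat}.
Local Notation mu := (@lebesgue_measure R).
Local Notation V := 'rV[R]_(2 * n).
Variables (A : 'M[R]_(2 * n)) (a b : R) (c : R -> V * R).
Hypotheses (A_skew : A^T = - A) (A_unit : A \in unitmx) (ab : a < b).
Hypothesis c_min : energy_minimizing A a b c.
Local Notation I f := (\int[mu]_(t in `[a, b]) f t).
Local Notation x t := ((c t).1 : V).
Let ab' := ltW ab.

Definition vprim (r : R -> V) (t : R) : V := \row_i \int[mu]_(s in `[a, t]) r s 0 i.

Lemma vlipder_prim (r : R -> V) : (forall i, bdmeas a b (fun t => r t 0 i)) ->
  vlipder a b (vprim r) r.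
Proof.
move=> br i; have := lipder_primitive 0 (br i).
by congr lipder; apply/funext => t; rewrite mxE add0r.
Qed.

Lemma vprim_left (r : R -> V) : vprim r a = 0.
Proof. by apply/rowP => i; rewrite !mxE set_itv1 Rintegral_set1. Qed.

Variable u : R -> V.
Hypotheses (xu : vlipder a b (fun t => x t) u)
  (zu : lipder a b (fun t => (c t).2) (fun t => 2^-1 * dot (x t *m A) (u t))).

(** The competitor is the horizontal lift of [x + f], and the last hypothesis says that this lift
    ends at the height of [c b]. It has this form because integration by parts and skew symmetry
    turn the integral of [dot (f *m A) u] into that of [dot (x *m A) g]. *)
Lemma variation_energy (f g : R -> V) : vlipder a b f g -> f a = 0 -> f b = 0 ->
  I (fun t => dot (x t *m A) (g t)) + 2^-1 * I (fun t => dot (f t *m A) (g t)) = 0 ->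
  0 <= 2 * I (fun t => dot (u t) (g t)) + I (fun t => dot (g t) (g t)).
Proof.
move=> fg fa fb H.
have ug := vlipderD xu fg.
have bu i := vlipder_bdmeasr i xu; have bg i := vlipder_bdmeasr i fg.
have bx i := vlipder_bdmeas i ab' xu; have bf i := vlipder_bdmeas i ab' fg.
have bxA := bdmeas_mulmx A bx; have bfA := bdmeas_mulmx A bf.
pose w t := u t + g t; pose y t := x t + f t.
have bw i := vlipder_bdmeasr i ug.
have by_ i := vlipder_bdmeas i ab' ug.
pose h t := 2^-1 * dot (y t *m A) (w t).
have bh : bdmeas a b h.
  apply: bdmeasM; first exact: bdmeas_cst.
  by apply: bdmeas_dot => // i; exact: bdmeas_mulmx.
pose z t := (c a).2 + \int[mu]_(s in `[a, t]) h s.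
have zw : lipder a b z h by exact: lipder_primitive.
pose d t : V * R := (y t, z t).
have hd : horizontal_curve A a b d by exact: (@lipder_horizontal_curve _ _ A a b d w).
have da : d a = c a.
  by rewrite /d /y /z fa addr0 set_itv1 Rintegral_set1 addr0 -surjective_pairing.
have zb : z b = (c b).2.
  have l1 := lipder_dot ab' (vlipder_mulmx A ab' fg) xu.
  have I1 := lipder_integral ab l1; have I2 := lipder_integral ab zu.
  have [_ bl1 _] := l1; have [_ bz _] := zu.
  rewrite /z (_ : I h = (c b).2 - (c a).2) 1?addrC ?subrK//.
  transitivity (2^-1 * I (fun t => dot (g t *m A) (x t) + dot (f t *m A) (u t)) +
    (1 * I (fun t => 2^-1 * dot (x t *m A) (u t)) +
     (1 * I (fun t => dot (x t *m A) (g t)) + I (fun t => 2^-1 * dot (f t *m A) (g t))))).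
    have bxg := bdmeas_dot bxA bg; have bfg := bdmeas_dot bfA bg.
    have bfg2 : bdmeas a b (fun t => 2^-1 * dot (f t *m A) (g t)).
      by apply: bdmeasM => //; exact: bdmeas_cst.
    rewrite -!RintegralZD; try bdm.
    apply: eq_Rintegral => t _; rewrite /h /y /w.
    rewrite !(mulmxDl, dotDl, dotDr) (dot_skew (g t) _ A_skew) (dotC (g t)).
    by field.
  rewrite I1 I2 RintegralZl//; last exact/bdmeas_integrable/bdmeas_dot.
  by rewrite fa fb !mul0mx !dot0l subrr mulr0 !mul1r H; ring.
have db : d b = c b by rewrite /d /y zb fb addr0 -surjective_pairing.
have := c_min.2 d hd da db.
rewrite (energy_lipder xu zu) (@energy_lipder _ _ A a b d w ug zw) lee_fin ler_pM2l//.
have buu := bdmeas_dot bu bu; have bug := bdmeas_dot bu bg; have bgg := bdmeas_dot bg bg.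
rewrite (_ : I (fun t => dot (w t) (w t)) = 1 * I (fun t => dot (u t) (u t)) +
   (2 * I (fun t => dot (u t) (g t)) + I (fun t => dot (g t) (g t)))).
  by rewrite mul1r lerDl.
rewrite -!RintegralZD; try bdm.
apply: eq_Rintegral => t _; rewrite /w !(dotDl, dotDr) (dotC (g t)); ring.
Qed.

Lemma Rintegral_dotZDr (k d : R) (F r y : R -> V) :
  (forall i, bdmeas a b (fun t => F t 0 i)) ->
  (forall i, bdmeas a b (fun t => r t 0 i)) ->
  (forall i, bdmeas a b (fun t => y t 0 i)) ->
  I (fun t => dot (F t) (k *: r t + d *: y t)) =
  k * I (fun t => dot (F t) (r t)) + d * I (fun t => dot (F t) (y t)).
Proof.
move=> bF br by_; have bFr := bdmeas_dot bF br; have bFy := bdmeas_dot bF by_.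
have bdFy : bdmeas a b (fun t => d * dot (F t) (y t)) by bdm.
rewrite -[X in _ = _ + X]RintegralZl//; last exact: bdmeas_integrable.
rewrite -RintegralZD//.
by apply: eq_Rintegral => t _; rewrite dotDr !dotZr.
Qed.

Lemma Rintegral_dotZDl (k d : R) (F r y : R -> V) :
  (forall i, bdmeas a b (fun t => F t 0 i)) ->
  (forall i, bdmeas a b (fun t => r t 0 i)) ->
  (forall i, bdmeas a b (fun t => y t 0 i)) ->
  I (fun t => dot (k *: r t + d *: y t) (F t)) =
  k * I (fun t => dot (r t) (F t)) + d * I (fun t => dot (y t) (F t)).
Proof.
move=> bF br by_; under eq_Rintegral do rewrite dotC; rewrite Rintegral_dotZDr//.
by congr (_ * _ + _ * _); apply: eq_Rintegral => t _; rewrite dotC.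
Qed.

(** The varied velocity is [u - e *: r + d *: y]: removing [r] lowers the energy at rate [2 * rho],
    while [y] changes the height at first order, at rate [Y], and can restore it. The orthogonality
    hypotheses make the constraint and the energy the polynomials of [first_variation]. *)
Lemma two_parameter_variation (r y : R -> V) (rho Y : R) :
  (forall i, bdmeas a b (fun t => r t 0 i)) ->
  (forall i, bdmeas a b (fun t => y t 0 i)) ->
  (forall i, I (fun t => r t 0 i) = 0) -> (forall i, I (fun t => y t 0 i) = 0) ->
  I (fun t => dot (r t) (y t)) = 0 ->
  I (fun t => dot (x t *m A) (r t)) = 0 -> I (fun t => dot (x t *m A) (y t)) = Y ->
  I (fun t => dot (u t) (r t)) = rho ->
  rho = I (fun t => dot (r t) (r t)) -> Y = I (fun t => dot (y t) (y t)) ->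
  0 < Y -> rho = 0.
Proof.
move=> br by_ Ir Iy Iry IxAr IxAy Iur rhoE YE Ygt0.
have bu i := vlipder_bdmeasr i xu; have bx i := vlipder_bdmeas i ab' xu.
have bxA := bdmeas_mulmx A bx.
pose f1 := vprim r; pose f2 := vprim y.
have l1 : vlipder a b f1 r := vlipder_prim br.
have l2 : vlipder a b f2 y := vlipder_prim by_.
have bf1A := bdmeas_mulmx A (fun i => vlipder_bdmeas i ab' l1).
have bf2A := bdmeas_mulmx A (fun i => vlipder_bdmeas i ab' l2).
have f1b : f1 b = 0 by apply/rowP => i; rewrite !mxE Ir.
have f2b : f2 b = 0 by apply/rowP => i; rewrite !mxE Iy.
have b1r := bdmeas_dot bf1A br; have b1y := bdmeas_dot bf1A by_.
have b2r := bdmeas_dot bf2A br; have b2y := bdmeas_dot bf2A by_.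
apply: (first_variation Ygt0 (p := 2^-1 * I (fun t => dot (f1 t *m A) (r t)))
  (q := 2^-1 * (- I (fun t => dot (f1 t *m A) (y t)) - I (fun t => dot (f2 t *m A) (r t))))
  (s := 2^-1 * I (fun t => dot (f2 t *m A) (y t)))
  (B := I (fun t => dot (u t) (y t)))).
  by rewrite rhoE; apply: Rintegral_ge0 => t _; exact: dot_ge0.
move=> e d H.
pose f t := (- e) *: f1 t + d *: f2 t; pose g t := (- e) *: r t + d *: y t.
have fg : vlipder a b f g by apply: vlipderD; apply: vlipderZ.
have Ilin (F : R -> V) : (forall i, bdmeas a b (fun t => F t 0 i)) ->
    I (fun t => dot (F t) (g t)) =
    - e * I (fun t => dot (F t) (r t)) + d * I (fun t => dot (F t) (y t)).
  by move=> bF; rewrite -Rintegral_dotZDr.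
have bg i : bdmeas a b (fun t => g t 0 i) := vlipder_bdmeasr i fg.
have bfA := bdmeas_mulmx A (fun i => vlipder_bdmeas i ab' fg).
have := @variation_energy f g fg.
rewrite /f /f1 /f2 !vprim_left -/f1 -/f2 f1b f2b !scaler0 addr0 -/f.
move=> /(_ erefl erefl).
rewrite !Ilin// IxAr IxAy Iur.
have -> : I (fun t => dot (g t) (r t)) = - e * rho.
  have -> : I (fun t => dot (g t) (r t)) = I (fun t => dot (r t) (g t)).
    by apply: eq_Rintegral => t _; rewrite dotC.
  by rewrite Ilin// Iry mulr0 addr0 rhoE.
have -> : I (fun t => dot (g t) (y t)) = d * Y.
  have -> : I (fun t => dot (g t) (y t)) = I (fun t => dot (y t) (g t)).
    by apply: eq_Rintegral => t _; rewrite dotC.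
  rewrite Ilin// -YE (_ : I (fun t => dot (y t) (r t)) = 0) ?mulr0 ?add0r//.
  by rewrite -Iry; apply: eq_Rintegral => t _; rewrite dotC.
have Ilin2 (F : R -> V) : (forall i, bdmeas a b (fun t => F t 0 i)) ->
    I (fun t => dot (f t *m A) (F t)) =
    - e * I (fun t => dot (f1 t *m A) (F t)) + d * I (fun t => dot (f2 t *m A) (F t)).
  move=> bF; rewrite -Rintegral_dotZDl//; apply: eq_Rintegral => t _.
  by rewrite /f mulmxDl -!scalemxAl.
rewrite !Ilin2//.
move=> /(_ _)/le_trans; apply; last by rewrite le_eqVlt; apply/orP; left; apply/eqP; ring.
move: H; move: (I (fun t => dot (f1 t *m A) (r t))) (I (fun t => dot (f1 t *m A) (y t)))
  (I (fun t => dot (f2 t *m A) (r t))) (I (fun t => dot (f2 t *m A) (y t))).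
by move=> i1 i2 i3 i4 H; rewrite -[RHS]H; ring.
Qed.

(** In the mean square sense, [u] is projected on the span of the constant vectors and of [x *m A],
    and the residual [r] vanishes for a minimizer. Here [y] is [x *m A] minus its mean [m], [ub] the
    mean of [u], and [th] the projection coefficient along [y], that is the Lagrange multiplier of
    the height. *)
Lemma extremal_velocity_ae : exists (v : V) (th : R),
  \forall t \ae mu, t \in `]a, b[ -> u t = v + th *: (x t *m A).
Proof.
have bu i := vlipder_bdmeasr i xu; have bx i := vlipder_bdmeas i ab' xu.
have bxA := bdmeas_mulmx A bx.
have T0 : b - a != 0 by rewrite subr_eq0 gt_eqF.
have muT : fine (mu `[a, b]) = b - a.
  by rewrite lebesgue_measure_itv/= lte_fin ab.
pose m : V := \row_i (I (fun t => (x t *m A) 0 i) / (b - a)).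
pose y t : V := x t *m A - m.
have by_ i : bdmeas a b (fun t => y t 0 i).
  under eq_fun do rewrite !mxE; apply: bdmeasD; last exact: bdmeas_cst.
  by have := bxA i; under eq_fun do rewrite mxE.
have Iy i : I (fun t => y t 0 i) = 0.
  transitivity (1 * I (fun t => (x t *m A) 0 i) + I (fun=> - m 0 i)).
    rewrite -RintegralZD//; last exact: bdmeas_cst.
    by apply: eq_Rintegral => t _; rewrite mul1r [LHS]mxE [X in _ + X]mxE.
  by rewrite Rintegral_cst// muT [m 0 i]mxE mul1r mulNr divfK// subrr.
pose Y := I (fun t => dot (y t) (y t)).
have byy := bdmeas_dot by_ by_.
have Y0 : 0 <= Y by apply: Rintegral_ge0 => t _; exact: dot_ge0.
(* If [Y = 0], no variation along [y] is available; but then [x *m A] is constant, hence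
   [u *m A = 0], and [u] vanishes almost everywhere since [A] is invertible. *)
have [Y_eq0|Y_neq0] := eqVneq Y 0.
  exists 0, 0.
  have yae := Rintegral_eq0_ae byy (fun t => dot_ge0 (y t)) Y_eq0.
  have xAE i t : t \in `]a, b[ -> (x t *m A) 0 i = m 0 i.
    move=> tab; have l1 := lipder_primitive 0 (bxA i).
    have l2 : lipder a b (fun t => 0 + \int[mu]_(s in `[a, t]) (x s *m A) 0 i) (fun=> m 0 i).
      apply: lipder_ae l1 (bdmeas_cst _ _ _) _; apply: aeS yae => s ys sab.
      by move/eqP: (ys sab); rewrite dot_eq0 subr_eq0 => /eqP ->.
    apply: (der_unique (der_lipder ab l1 tab _) (der_lipder ab l2 tab _)).
      exact: lipder_continuous (vlipder_mulmx A ab' xu i) tab.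
    exact: cst_continuous.
  apply: aeS (ae_vlipder xu) => t dx tab; rewrite scale0r addr0.
  suff uA : u t *m A = 0 by rewrite -(mulmxK A_unit (u t)) uA mul0mx.
  apply: (vder_unique (vder_mulmx A (dx tab))) => i; rewrite mxE.
  apply: der_near (der_cst t (m 0 i)); near=> s.
  by rewrite xAE//; near: s; exact: near_in_itvoo.
have Ygt0 : 0 < Y by rewrite lt_def Y_neq0.
have buy := bdmeas_dot bu by_.
pose th := I (fun t => dot (u t) (y t)) / Y.
pose ub : V := (b - a)^-1 *: (x b - x a).
pose r t : V := u t - ub - th *: y t.
have br i : bdmeas a b (fun t => r t 0 i).
  rewrite /r; under eq_fun do rewrite mxE [X in X + _]mxE [X in _ + X]mxE [X in _ - X]mxE.
  apply: bdmeasD; first by apply: bdmeasD => //; exact: bdmeas_cst.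
  by apply: bdmeasN; apply: bdmeasM => //; exact: bdmeas_cst.
have Ir i : I (fun t => r t 0 i) = 0.
  transitivity ((- th) * I (fun t => y t 0 i) + (1 * I (fun t => u t 0 i)
    + I (fun=> - ub 0 i))).
    rewrite -!RintegralZD; try (have := by_ i; have := bu i; move=> *; bdm).
    apply: eq_Rintegral => t _; rewrite /r; move: (ub) (y t) (u t) => p q s.
    by rewrite !mxE; ring.
  rewrite Iy mulr0 add0r mul1r (lipder_integral ab (xu i)) Rintegral_cst// muT !mxE.
  by rewrite mulNr mulrAC mulVf// mul1r subrr.
have bry := bdmeas_dot br by_; have brr := bdmeas_dot br br; have bur := bdmeas_dot bu br.
have buby : bdmeas a b (fun t => dot ub (y t)).
  by apply: bdmeas_dot => // i; exact: bdmeas_cst.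
have bubr : bdmeas a b (fun t => dot ub (r t)).
  by apply: bdmeas_dot => // i; exact: bdmeas_cst.
have bmr : bdmeas a b (fun t => dot m (r t)).
  by apply: bdmeas_dot => // i; exact: bdmeas_cst.
have bmy : bdmeas a b (fun t => dot m (y t)).
  by apply: bdmeas_dot => // i; exact: bdmeas_cst.
have Iry : I (fun t => dot (r t) (y t)) = 0.
  transitivity ((- th) * Y + ((-1) * I (fun t => dot ub (y t))
     + I (fun t => dot (u t) (y t)))).
    rewrite -!RintegralZD; try bdm.
    apply: eq_Rintegral => t _; rewrite /r; move: (ub) (y t) (u t) => p q s.
    by rewrite !(dotDl, dotNl, dotZl); ring.
  by rewrite Rintegral_dot_cst// mulr0 add0r mulNr divfK// addNr.
pose rho := I (fun t => dot (r t) (r t)).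
have Iur : I (fun t => dot (u t) (r t)) = rho.
  transitivity (1 * rho + (1 * I (fun t => dot ub (r t)) + th * I (fun t => dot (r t) (y t)))).
    have bthry : bdmeas a b (fun t => th * dot (r t) (y t)) by bdm.
    rewrite -[X in _ = _ + (_ + X)]RintegralZl//; last exact: bdmeas_integrable.
    rewrite -!RintegralZD; try bdm.
    apply: eq_Rintegral => t _.
    transitivity (dot (r t + ub + th *: y t) (r t)).
      by congr dot; rewrite /r addrAC subrK subrK.
    rewrite (dotDl (r t + ub)) (dotDl (r t)) (dotZl th) (dotC (y t)); ring.
  by rewrite Iry Rintegral_dot_cst// !mul1r mulr0 !addr0.
have IxAr : I (fun t => dot (x t *m A) (r t)) = 0.
  transitivity (1 * I (fun t => dot m (r t)) + I (fun t => dot (r t) (y t))).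
    rewrite -!RintegralZD; try bdm.
    apply: eq_Rintegral => t _; rewrite mul1r (dotC (r t)) -dotDl.
    by congr dot; rewrite /y addrCA subrr addr0.
  by rewrite Iry Rintegral_dot_cst// mul1r addr0.
have IxAy : I (fun t => dot (x t *m A) (y t)) = Y.
  transitivity (1 * I (fun t => dot m (y t)) + Y).
    rewrite -!RintegralZD; try bdm.
    apply: eq_Rintegral => t _; rewrite mul1r -dotDl.
    by congr dot; rewrite /y addrCA subrr addr0.
  by rewrite Rintegral_dot_cst// mul1r add0r.
have rho0 : rho = 0 by exact: (two_parameter_variation br by_ Ir Iy Iry IxAr IxAy Iur erefl erefl Ygt0).
have rae := Rintegral_eq0_ae brr (fun t => dot_ge0 (r t)) rho0.
exists (ub - th *: m), th; apply: aeS rae => t + tab => /(_ tab)/eqP.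
rewrite dot_eq0 /r /y => /eqP E.
apply/eqP; rewrite -subr_eq0 -E; apply/eqP/rowP => i.
by rewrite !mxE; ring.
Unshelve. all: by end_near. Qed.

End minimizers_are_extremal.

Section extremals.
Context {R : realType} {n : nat}.
Local Notation V := 'rV[R]_(2 * n).
Variable A : 'M[R]_(2 * n).
Hypotheses (A_skew : A^T = - A) (A_unit : A \in unitmx).

(** The affine expression in [x] to which the velocity is equal almost everywhere is itself
    Lipschitz, so [der_lipder] gives the equation at every interior point. *)
Lemma minimizing_hvel (a b : R) (c : R -> V * R) : a < b ->
  energy_minimizing A a b c -> exists (v : V) (th : R),
  {in `]a, b[, forall t, hvel A c t (v + th *: ((c t).1 *m A))}.
Proof.
move=> ab cmin; have ab' := ltW ab.
have [u [xu zu]] := horizontal_curve_lipder ab cmin.1.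
have [v [th uE]] := extremal_velocity_ae A_skew A_unit ab cmin xu zu.
exists v, th; pose w t : V := v + th *: ((c t).1 *m A).
have ww := vlipderD (vlipder_cst a b v) (vlipderZ th ab' (vlipder_mulmx A ab' xu)).
have xw : vlipder a b (fun t => (c t).1) w.
  move=> i; apply: lipder_ae (xu i) _ _.
    exact: lipder_bdmeas ab' (ww i).
  by apply: aeS uE => t uE tab; rewrite uE.
have xww := lipderZ 2^-1 ab' (lipder_dot ab' (vlipder_mulmx A ab' xu) ww).
have zw : lipder a b (fun t => (c t).2) (fun t => 2^-1 * dot ((c t).1 *m A) (w t)).
  apply: lipder_ae zu _ _; first exact: lipder_bdmeas ab' xww.
  by apply: aeS uE => t uE tab; rewrite uE.
move=> t tab; split=> [i|].
  apply: (der_lipder ab (xw i) tab); exact: lipder_continuous (ww i) tab.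
apply: (der_lipder ab zw tab); exact: lipder_continuous xww tab.
Qed.

Lemma horizontal_curve_within_continuous (a b : R) (c : R -> V * R) :
  horizontal_curve A a b c ->
  (forall i, {within `[a, b], continuous (fun t => (c t).1 0 i)}) /\
  {within `[a, b], continuous (fun t => (c t).2)}.
Proof.
move=> [/lipschitz_carnotP[K cK] _].
by split=> [i|]; apply: (lipschitz_within_continuous (K := K)) => s t sab tab;
  have [] := cK s t sab tab.
Qed.

Lemma dot_mulmx_unit_eq0 (x : V) : (dot (x *m A) (x *m A) == 0) = (x == 0).
Proof.
rewrite dot_eq0; apply/eqP/eqP => [xA|->]; last exact: mul0mx.
by rewrite -(mulmxK A_unit x) xA mul0mx.
Qed.

(* Both [dot u u] and the multiplier [dot u' (u *m A) / dot (u *m A) (u *m A)]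
   are locally constant along the velocity [u] of a geodesic, so the extremals
   on small intervals glue without an overlap argument. *)
Lemma geodesic_hvel (c : R -> V * R) : geodesic A c -> exists (v : V) (th : R),
  {in `]0, 1[, forall t, hvel A c t (v + th *: ((c t).1 *m A))}.
Proof.
move=> [hc [s0 [t0 [s01 t01 cst]]] cmin].
have loc (t : R) : t \in `]0, 1[ -> exists (v : V) (th : R),
    \forall s \near t, hvel A c s (v + th *: ((c s).1 *m A)).
  move=> tI; have [|a [b [ab ab01 nab mab]]] := cmin t.
    by move: tI; rewrite !in_itv/= => /andP[/ltW -> /ltW ->].
  have [v [th H]] := minimizing_hvel ab mab; exists v, th.
  have tab : t \in `]a, b[.
    have [e /= e0 eab] : \forall s \near t, s \in `[a, b].
      near=> s; apply: (near nab s) => //.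
      have : s \in `]0, 1[ by near: s; exact: near_in_itvoo.
      by rewrite !in_itv/= => /andP[/ltW -> /ltW ->].
    have : t - e / 2 \in `[a, b].
      by apply: eab; rewrite /ball_/= ltr_norml; apply/andP; split; lra.
    have : t + e / 2 \in `[a, b].
      by apply: eab; rewrite /ball_/= ltr_norml; apply/andP; split; lra.
    rewrite !in_itv/= => /andP[_ tb] /andP[at_ _]; apply/andP; split; lra.
  by near=> s; apply: H; near: s; exact: near_in_itvoo.
pose U t : V := (derive1 c t).1.
have xU (t : R) : t \in `]0, 1[ -> hvel A c t (U t).
  by move=> /loc[v [th /nbhs_singleton H]]; rewrite /U (hvel_derive1 H).
have UE (t : R) : t \in `]0, 1[ -> exists th : R, \forall s \near t,
    vder U s (th *: (U s *m A)).
  move=> tI; have [v [th H]] := loc t tI; exists th.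
  have {}H := nbhs_interior H; near=> s.
  have Hs : \forall r \near s, hvel A c r (v + th *: ((c r).1 *m A)) by near: s.
  have sI : s \in `]0, 1[ by near: s; exact: near_in_itvoo.
  apply: vder_near (_ : vder (fun r => v + th *: ((c r).1 *m A)) s _).
    by near=> r; rewrite /U (hvel_derive1 (near Hs r _)).
  apply: vder_eq (vderD (vder_cst s v) (vderZl th (vder_mulmx A (xU s sI).1))) _.
  by rewrite add0r.
have UU : {in `]0, 1[ &, forall s t, dot (U s) (U s) = dot (U t) (U t)}.
  apply: (@der0_constant_oo _ (fun t => dot (U t) (U t))) => t tI.
  have [th /nbhs_singleton dU] := UE t tI; apply: der_eq (der_dot dU dU) _.
  by rewrite dotZr dotZl (dotC (U t)) dot_skew_id// !mulr0 addr0.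
have hI : (2^-1 : R) \in `]0, 1[.
  by rewrite in_itv/= invr_gt0 ltr0n invf_lt1// ltr1n.
(* Zero speed at one point means zero speed throughout, hence a constant curve, against the
   definition of [geodesic]. Nonzero speed makes the denominator of the multiplier nonzero. *)
have [U0|U0] := eqVneq (U 2^-1) 0.
  exfalso; apply: cst.
  have {}U0 (t : R) : t \in `]0, 1[ -> U t = 0.
    by move=> tI; apply/eqP; rewrite -dot_eq0 (UU _ _ tI hI) U0 dot0l.
  have [cx cz] := horizontal_curve_within_continuous hc.
  have c0 (t : R) : t \in `[0, 1] -> c t = c 0.
    rewrite in_itv/= => /andP[t0_ t1].
    have sub : `[0, t] `<=` `[0, 1] by apply: subset_itvl; rewrite bnd_simp.
    have sI (s : R) : s \in `]0, t[ -> s \in `]0, 1[.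
      by rewrite !in_itv/= => /andP[-> /lt_le_trans]; exact.
    rewrite [LHS]surjective_pairing [RHS]surjective_pairing; congr pair.
      apply/rowP => i; apply: (der0_constant t0_ (continuous_subspaceW sub (cx i))).
      by move=> s /sI sI'; have := (xU s sI').1 i; rewrite U0// mxE.
    apply: (der0_constant t0_ (continuous_subspaceW sub cz)).
    by move=> s /sI sI'; have := (xU s sI').2; rewrite U0// dot0r mulr0.
  by rewrite (c0 _ s01) (c0 _ t01).
have {}U0 (t : R) : t \in `]0, 1[ -> U t != 0.
  by move=> tI; rewrite -dot_eq0 (UU _ _ tI hI) dot_eq0.
pose TH t := dot (derive1 U t) (U t *m A) / dot (U t *m A) (U t *m A).
have THE (t th : R) : t \in `]0, 1[ -> vder U t (th *: (U t *m A)) -> TH t = th.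
  move=> tI /vderP dU; rewrite /TH derive1E (@derive_val _ _ _ _ _ _ _ dU) dotZl mulfK//.
  by rewrite dot_mulmx_unit_eq0 U0.
have THc : {in `]0, 1[ &, forall s t, TH s = TH t}.
  apply: der0_constant_oo => t tI; have [th dU] := UE t tI.
  apply: der_near (der_cst t th); near=> s; apply/esym/THE; last by near: s.
  by near: s; exact: near_in_itvoo.
pose th := TH 2^-1.
have dU (t : R) : t \in `]0, 1[ -> vder U t (th *: (U t *m A)).
  move=> tI; have [th' /nbhs_singleton dU] := UE t tI.
  by rewrite /th -(THc _ _ tI hI) (THE t th').
exists (U 2^-1 - th *: ((c 2^-1).1 *m A)), th => t tI.
rewrite (_ : _ + _ = U t); first exact: xU.
suff -> : U 2^-1 - th *: ((c 2^-1).1 *m A) = U t - th *: ((c t).1 *m A).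
  by rewrite subrK.
apply/rowP => i.
apply: (@der0_constant_oo _ (fun t => (U t - th *: ((c t).1 *m A)) 0 i) 0 1) => //.
move=> s sI; apply: der_eq (vderB (dU s sI) (vderZl th (vder_mulmx A (xU s sI).1)) i) _.
by rewrite subrr mxE.
Unshelve. all: by end_near. Qed.

End extremals.

(** * Spectral decomposition of a nondegenerate skew-symmetric matrix *)

Section real_spectral.
Context {R : rcfType}.

(** Over the complex numbers [S] is hermitian, hence unitarily diagonalizable with real eigenvalues.
    The product of the distinct real factors ['X - r] therefore annihilates [S], and so the real
    minimal polynomial splits with simple roots. *)
Lemma sym_sum_eigenspaces (m : nat) (S : 'M[R]_m) : S^T = S ->
  exists2 rs, uniq rs & (\sum_(r <- rs) eigenspace S r :=: 1%:M)%MS.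
Proof.
case: m S => [|m] S symS.
  by exists [::] => //; apply/eqmxP; rewrite !flatmx0 sub0mx.
apply/diagonalizablePeigen/diagonalizableP.
pose SC := map_mx (real_complex R) S.
have hS : SC \is hermsymmx.
  apply: realsym_hermsym.
    by apply/is_hermitianmxP; rewrite expr0 scale1r map_mx_id// /SC map_trmx symS.
  apply/mxOverP => i j; rewrite mxE.
  by rewrite complex_real.
have /orthomx_spectralP SE := hermitian_normalmx hS.
have Dr := hermitian_spectral_diag_real hS.
set P := spectralmx SC in SE; set D := spectral_diag SC in SE Dr.
pose rs := undup [seq complex.Re (D 0 i) | i <- enum 'I_m.+1].
exists rs; first exact: undup_uniq.
apply: mxminpoly_min; set p := \prod_(x <- rs) _.
apply: (@map_mx_inj _ _ (real_complex R)).
rewrite map_mx0 map_horner_mx -/SC SE horner_mx_uconjC ?spectral_unit//.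
rewrite horner_mx_diag (_ : map_mx _ _ = 0) ?linear0 ?mulmx0 ?mul0mx//.
apply/rowP => i; rewrite !mxE.
have -> : D 0 i = real_complex R (complex.Re (D 0 i)).
  by apply/esym/RRe_real; have /mxOverP := Dr; exact.
rewrite horner_map; apply/eqP; rewrite fmorph_eq0 -/(root _ _) root_prod_XsubC.
by rewrite mem_undup; apply/mapP; exists i => //; rewrite mem_enum.
Qed.

End real_spectral.

Section skew_spectral.
Context {R : realType} {n : nat}.
Local Notation V := 'rV[R]_(2 * n).
Variable A : 'M[R]_(2 * n).
Hypotheses (A_skew : A^T = - A) (A_unit : A \in unitmx).
Let S := A^T *m A.

Let S_sym : S^T = S.
Proof. by rewrite trmx_mul trmxK. Qed.

Let SE : S = - (A *m A).
Proof. by rewrite /S A_skew mulNmx. Qed.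

Let SA : S *m A = A *m S.
Proof. by rewrite SE mulNmx mulmxN mulmxA. Qed.

Let dot_S (x y : V) : dot (x *m S) y = dot x (y *m S).
Proof. by rewrite dot_mulmx S_sym. Qed.

Let eigen_gt0 r : eigenvalue S r -> 0 < r.
Proof.
case/eigenvalueP => v vS v0.
have : r * dot v v = dot (v *m A) (v *m A).
  rewrite -dotZl -vS SE mulmxN dotNl mulmxA (dot_skew (v *m A) v A_skew) opprK.
  by [].
have v1 : 0 < dot v v by rewrite dot_gt0.
have v2 : 0 < dot (v *m A) (v *m A).
  by rewrite dot_gt0; apply: contra v0 => /eqP vA; rewrite -(mulmxK A_unit v) vA mul0mx.
by move=> E; move: v2; rewrite -E pmulr_lgt0.
Qed.

Let eigen_orth (r s : R) (x y : V) : (x <= eigenspace S r)%MS ->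
  (y <= eigenspace S s)%MS -> r != s -> dot x y = 0.
Proof.
move=> /eigenspaceP xr /eigenspaceP ys rs; have := dot_S x y.
rewrite xr ys dotZl dotZr => /eqP; rewrite -subr_eq0 -mulrBl mulf_eq0 subr_eq0.
by rewrite (negPf rs) => /eqP.
Qed.

(** Since [A^T *m A = - (A *m A)] commutes with [A], its eigenspaces are invariant under [A], and on
    the one of eigenvalue [r] the matrix [A] squares to [- r]. Invertibility of [A] makes every [r]
    positive. *)
Lemma skew_spectral : exists (k : nat) (al : 'I_k -> R) (P : 'I_k -> 'M[R]_(2 * n)),
  [/\ forall j, 0 < al j, forall j, singular_value A (al j),
      forall j x, component A (al j) x = x *m P j, \sum_j P j = 1%:M &
   [/\ forall j, P j *m A = A *m P j, forall j, P j *m A *m A = - al j ^+ 2 *: P j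
     & forall i j (x y : V), i != j -> dot (x *m P i) (y *m P j) = 0]].
Proof.
have [rs0 urs0 full0] := sym_sum_eigenspaces S_sym.
(* The list [rs0] may contain numbers with zero eigenspace, which are not eigenvalues; dropping them
   does not change the sum. *)
pose rs := [seq r <- rs0 | eigenvalue S r].
have urs : uniq rs by exact: filter_uniq.
have full : (\sum_(r <- rs) eigenspace S r :=: 1%:M)%MS.
  apply: eqmx_trans full0; rewrite big_filter big_mkcond/=.
  rewrite (eq_bigr (eigenspace S))// => r _; case: ifPn => //.
  by rewrite /eigenvalue negbK => /eqP.
have rsE (j : 'I_(size rs)) : eigenvalue S rs`_j.
  by have := mem_nth 0 (ltn_ord j); rewrite mem_filter => /andP[].
rewrite (big_nth 0) big_mkord in full.
pose E (j : 'I_(size rs)) := eigenspace S rs`_j.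
pose P j := proj_mx (E j) (kermx (E j)^T).
have orthE i j (x y : V) : (x <= E i)%MS -> (y <= E j)%MS -> i != j -> dot x y = 0.
  move=> xi yj ij; apply: (eigen_orth xi yj).
  by rewrite nth_uniq.
(* Both [x - x *m P j] and [x - y j] are orthogonal to [E j], while their difference lies in [E j];
   so that difference is zero. *)
have projE (x : V) (y : 'I_(size rs) -> V) : (forall j, y j <= E j)%MS ->
    x = \sum_j y j -> forall j, x *m P j = y j.
  move=> yE xE j; have := orth_proj_sub (E j) x; have := orth_proj_orth (E j) x.
  rewrite /orth_proj -/(P j) => xP1 xP2; apply/eqP; rewrite -subr_eq0 -dot_eq0.
  have dE : (x *m P j - y j <= E j)%MS by rewrite addmx_sub// eqmx_opp.
  have [D dD] := submxP dE.
  have h1 : dot (x - x *m P j) (x *m P j - y j) = 0.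
    by rewrite dD dotE trmx_mul mulmxA xP1 mul0mx mxE.
  have h2 : dot (x - y j) (x *m P j - y j) = 0.
    rewrite {1}xE (bigD1 j)//= addrAC subrr add0r dot_suml big1// => i ij.
    exact: orthE (yE i) dE ij.
  have -> : dot (x *m P j - y j) (x *m P j - y j) =
      dot (x - y j) (x *m P j - y j) - dot (x - x *m P j) (x *m P j - y j).
    rewrite -dotNl -dotDl; congr dot.
    by rewrite opprB [RHS]addrC subrKA.
  by rewrite h1 h2 subrr.
have decomp (x : V) : exists2 y : 'I_(size rs) -> V,
    (forall j, y j <= E j)%MS & x = \sum_j y j.
  have : (x <= \sum_(i < size rs) E i)%MS by rewrite full submx1.
  case/sub_sumsmxP => u ->; exists (fun j => u j *m E j) => // j.
  exact: submxMl.
have sumP (x : V) : x = \sum_j x *m P j.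
  have [y yE xE] := decomp x; rewrite {1}xE; apply: eq_bigr => j _.
  by rewrite (projE x y).
have PE (x : V) j : (x *m P j <= E j)%MS by exact: proj_mx_sub.
have al2 (j : 'I_(size rs)) : Num.sqrt rs`_j ^+ 2 = rs`_j.
  by rewrite sqr_sqrtr//; exact/ltW/eigen_gt0/rsE.
exists (size rs), (fun j : 'I_(size rs) => Num.sqrt rs`_j), P; split => //.
- by move=> j; rewrite sqrtr_gt0; exact/eigen_gt0/rsE.
- by move=> j; split; [exact: sqrtr_ge0|rewrite al2; exact: rsE].
- by move=> j x; rewrite /component /orth_proj al2.
- apply/row_matrixP => i; rewrite [in RHS]rowE mulmx1 (sumP (delta_mx 0 i)).
  by rewrite -mulmx_sumr -rowE.
have PA (x : V) j : x *m A *m P j = x *m P j *m A.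
  apply: (projE (x *m A) (fun j => x *m P j *m A)) => [i|]; last by rewrite -mulmx_suml -sumP.
  apply/eigenspaceP; have /eigenspaceP xS := PE x i.
  by rewrite -(mulmxA _ A) -/S -SA mulmxA xS -scalemxAl.
split.
- move=> j; apply/row_matrixP => i; rewrite !rowE (mulmxA _ A (P j)) PA.
  by rewrite (mulmxA _ (P j)).
- move=> j; apply/row_matrixP => i.
  rewrite !rowE (mulmxA _ (P j *m A)) (mulmxA _ (P j)) al2.
  have /eigenspaceP := PE (delta_mx 0 i) j; rewrite SE mulmxN mulmxA => /eqP.
  by rewrite eqr_oppLR -scaleNr scalemxAr => /eqP.
- by move=> i j x y ij; exact: orthE (PE x i) (PE y j) ij.
Qed.

End skew_spectral.

(** * The height function of one invariant subspace *)

Section trigonometry.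
Context {R : realType}.
Implicit Types (y s t : R).

Lemma sin_natpi (m : nat) : sin (m%:R * pi) = 0 :> R.
Proof.
rewrite mulr_natl -[pi *+ m]add0r (alternatingn (@sinDpi R)).
by rewrite sin0 mulr0.
Qed.

Lemma sin_neq0 (m : nat) y : m%:R * pi < y < m.+1%:R * pi -> sin y != 0.
Proof.
move=> /andP[my ym].
have -> : y = (y - m%:R * pi) + pi *+ m by rewrite mulr_natl subrK.
rewrite (alternatingn (@sinDpi R)) mulf_neq0 ?signr_eq0// gt_eqF// sin_gt0_pi//.
by rewrite subr_gt0 my/= ltrBlDr; move: ym; rewrite -natr1 mulrDl mul1r addrC.
Qed.

Lemma der_sin t : is_derive t 1 (@sin R) (cos t).
Proof. exact: is_derive_sin. Qed.

Lemma der_cos t : is_derive t 1 (@cos R) (- sin t).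
Proof. exact: is_derive_cos. Qed.

Lemma norm_sin_lipschitz s t : `|sin s - sin t| <= `|s - t|.
Proof.
wlog st : s t / s <= t.
  by move=> H; have [/H|/ltW/H] := leP s t; rewrite // distrC (distrC s).
have d r : r \in `]s, t[ -> is_derive r 1 (@sin R) (cos r) by move=> _; exact: der_sin.
have cf : {within `[s, t], continuous (@sin R)}.
  by apply: (@der_within_continuous _ _ cos) => r _; exact: der_sin.
have [c _ E] := MVT_segment st d cf.
by rewrite distrC E normrM distrC ler_piMl// cos_max.
Qed.

Lemma der_gt0_lt (f df : R -> R) (a b : R) : a < b ->
  (forall t, is_derive t 1 f (df t)) -> (forall t, a < t -> t < b -> 0 < df t) ->
  f a < f b.
Proof.
move=> ab d d0.
have d' t : t \in `]a, b[ -> is_derive t 1 f (df t) by move=> _; exact: d.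
have cf : {within `[a, b], continuous f}.
  by apply: (@der_within_continuous _ f df) => t _; exact: d.
have [c] := MVT ab d' cf.
rewrite in_itv/= => /andP[ac cb] E.
by rewrite -subr_gt0 E mulr_gt0 ?subr_gt0// d0.
Qed.

(** On []0, pi]], the difference of the two sides and its first two derivatives vanish at 0, and the
    third derivative is [t * sin t]. Up to [2 * pi] the sine is nonpositive, and beyond that the
    right side is at least [s > 3]. *)
Lemma cusa_huygens s : 0 < s -> 3 * sin s < s * (2 + cos s).
Proof.
move=> s0; have c1 := cos_geN1 s.
have [sp|ps] := leP s pi; last first.
  have pi2 := @pi_ge2 R; have [s2|s2] := leP s (pi + pi).
    have : sin s <= 0.
      rewrite -[s](subrK pi) sinDpi oppr_le0 sin_ge0_pi//.
      by rewrite subr_ge0 (ltW ps) lerBlDr.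
    by nra.
  by have := sin_le1 s; nra.
have h2 t : 0 < t -> t <= pi -> 0 < sin t - t * cos t.
  move=> t0 tp; have E : (fun t => sin t - t * cos t) 0 = 0 :> R.
    by rewrite sin0 mul0r subr0.
  rewrite -[ltLHS]E; apply: (@der_gt0_lt (fun t => sin t - t * cos t) (fun t => t * sin t)) => //.
    move=> r; apply: der_eq (derB (der_sin r) (derM (der_id r) (der_cos r))) _.
    by ring.
  by move=> r r0 rt; rewrite mulr_gt0// sin_gt0_pi// r0 (lt_le_trans rt).
have h1 t : 0 < t -> t <= pi -> 0 < 2 - 2 * cos t - t * sin t.
  move=> t0 tp; have E : (fun t => 2 - 2 * cos t - t * sin t) 0 = 0 :> R.
    by rewrite cos0 mul0r subr0 mulr1 subrr.
  rewrite -[ltLHS]E; apply: (@der_gt0_lt (fun t => 2 - 2 * cos t - t * sin t)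
    (fun t => sin t - t * cos t)) => //.
    move=> r; apply: der_eq (derB (derB (der_cst r 2) (derZ 2 (der_cos r)))
      (derM (der_id r) (der_sin r))) _.
    by ring.
  by move=> r r0 rt; rewrite h2// (le_trans (ltW rt)).
rewrite -subr_gt0.
have E : (fun t => t * (2 + cos t) - 3 * sin t) 0 = 0 :> R.
  by rewrite sin0 mul0r mulr0 subr0.
rewrite -[ltLHS]E; apply: (@der_gt0_lt (fun t => t * (2 + cos t) - 3 * sin t)
  (fun t => 2 - 2 * cos t - t * sin t)) => //.
  move=> r; apply: der_eq (derB (derM (der_id r) (derD (der_cst r 2) (der_cos r)))
    (derZ 3 (der_sin r))) _.
  by ring.
by move=> r r0 rt; rewrite h1// (le_trans (ltW rt)).
Qed.

(* An arc turning by the angle [2 * y] in the plane of the singular value [a]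
   and ending at squared distance [w] rises by [w * (a / 4) * height y]. *)
Definition height y := (y - sin y * cos y) / sin y ^+ 2.

Definition height' y := 2 * (sin y - y * cos y) / sin y ^+ 3.

Definition height'' y :=
  2 * (y * (1 + 2 * cos y ^+ 2) - 3 * (sin y * cos y)) / sin y ^+ 4.

Lemma heightN y : height (- y) = - height y.
Proof. by rewrite /height sinN cosN sqrrN mulNr opprK -mulNr opprB addrC. Qed.

Lemma der_height y : sin y != 0 -> is_derive y 1 height (height' y).
Proof.
move=> s0; rewrite /height.
apply: der_eq (derM (derB (der_id y) (derM (der_sin y) (der_cos y)))
  (derV _ (derM (der_sin y) (der_sin y)))) _.
  by rewrite mulf_neq0.
rewrite /height'; have := cos2Dsin2 y.
set c := cos y; set s := sin y in s0 * => cs.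
have -> : 1 - (c * c + s * - s) = 2 * s ^+ 2 by rewrite -{1}cs; ring.
have -> : 2 * (s - y * c) = 2 * (s * (c ^+ 2 + s ^+ 2) - y * c) by rewrite cs mulr1.
by field.
Qed.

Lemma der_height' y : sin y != 0 -> is_derive y 1 height' (height'' y).
Proof.
move=> s0; rewrite /height'.
apply: der_eq (derM (derZ 2 (derB (der_sin y) (derM (der_id y) (der_cos y))))
  (derV _ (derM (der_sin y) (derM (der_sin y) (der_sin y))))) _.
  by rewrite !mulf_neq0.
rewrite /height''.
have -> : y * (1 + 2 * cos y ^+ 2) = y * (sin y ^+ 2 + 3 * cos y ^+ 2).
  by rewrite sin2cos2; ring.
by set c := cos y; set s := sin y in s0 *; field.
Qed.

(** The sign of the numerator is the inequality [cusa_huygens] at the double angle [2 * y]. *)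
Lemma height''_gt0 y : 0 < y -> sin y != 0 -> 0 < height'' y.
Proof.
move=> y0 s0; have := @cusa_huygens (y *+ 2); rewrite pmulrn_lgt0// => /(_ y0).
rewrite sin_mulr2n cos_mulr2n => H; rewrite /height'' divr_gt0//; last first.
  by rewrite exprn_even_gt0.
rewrite mulr_gt0// subr_gt0 -(ltr_pM2l (_ : 0 < 2))//.
have <- : 3 * (cos y * sin y *+ 2) = 2 * (3 * (sin y * cos y)) by ring.
have <- : y *+ 2 * (2 + (cos y ^+ 2 *+ 2 - 1)) = 2 * (y * (1 + 2 * cos y ^+ 2)) by ring.
exact: H.
Qed.

Lemma sin_cos_lt y : 0 < y -> sin y * cos y < y.
Proof.
move=> y0; have [y1|y1] := ltP 1 y.
  apply: le_lt_trans y1; rewrite (le_trans (ler_norm _))// normrM.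
  by rewrite mulr_ile1// ?sin_max// cos_max.
have sy : sin y < y.
  have E : (fun t => t - sin t) 0 = 0 :> R by rewrite sin0 subr0.
  rewrite -subr_gt0 -[ltLHS]E.
  apply: (@der_gt0_lt (fun t => t - sin t) (fun t => 1 - cos t)) => // t t0 ty.
  rewrite subr_gt0 lt_neqAle cos_le1 andbT; apply/eqP => ct.
  have : 0 < sin t.
    apply: sin2_gt0; rewrite t0 (lt_le_trans ty)// (le_trans y1)// ler1n//.
  have := sin2cos2 t; rewrite ct expr1n subrr => /eqP.
  by rewrite sqrf_eq0 => /eqP ->; rewrite ltxx.
apply: le_lt_trans sy; rewrite ler_piMr ?cos_le1//.
by apply/ltW/sin2_gt0; rewrite y0 (le_lt_trans y1)// ltr1n.
Qed.

Lemma height_ge0 y : 0 < y -> 0 <= height y.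
Proof. by move=> y0; rewrite divr_ge0 ?sqr_ge0// subr_ge0 ltW// sin_cos_lt. Qed.

(** For [y > 1], dividing by [sin y ^+ 2 <= 1] only increases the numerator, which is at least
    [y - 1]; for [y <= 1] the left side is nonpositive. *)
Lemma height_ge y : 0 < y -> sin y != 0 -> y - 1 <= height y.
Proof.
move=> y0 s0; have s2 : 0 < sin y ^+ 2 by rewrite exprn_even_gt0.
rewrite /height ler_pdivlMr//.
have s1 : sin y ^+ 2 <= 1 by rewrite sin2cos2 gerBl sqr_ge0.
have sc := sin_cos_lt y0.
have sc1 : sin y * cos y <= 1.
  by rewrite (le_trans (ler_norm _))// normrM mulr_ile1// ?sin_max ?cos_max.
have [y1|y1] := leP 1 y; first by nra.
by nra.
Qed.

Lemma height_le y (d : R) : 0 < y -> 0 < d -> d <= `|sin y| ->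
  height y <= (y + 1) / d ^+ 2.
Proof.
move=> y0 d0 ds; have s0 : 0 < `|sin y| by exact: lt_le_trans ds.
have ds2 : d ^+ 2 <= sin y ^+ 2.
  by rewrite -(real_normK (num_real (sin y))) lerXn2r// ?nnegrE// ltW.
have sc1 : - 1 <= sin y * cos y.
  by rewrite lerNl (le_trans (ler_norm _))// normrN normrM mulr_ile1// ?sin_max ?cos_max.
rewrite /height ler_pM//.
- by rewrite subr_ge0 ltW// sin_cos_lt.
- by rewrite invr_ge0 sqr_ge0.
- by rewrite lerD2l lerNl.
- have s2 : 0 < sin y ^+ 2 by rewrite exprn_even_gt0//= -normr_gt0.
  by rewrite lef_pV2 ?posrE// exprn_gt0.
Qed.

End trigonometry.

(** * Solutions of the height equation between consecutive poles *)

Section total_height.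
Context {R : realType} {k : nat}.
Variables (al : 'I_k -> R) (w : 'I_k -> R).
Hypotheses (k_gt0 : (0 < k)%N) (al_gt0 : forall j, 0 < al j) (w_gt0 : forall j, 0 < w j).
Implicit Types (t : R).

Definition total_height t := \sum_j w j * (al j / 4) * height (t * al j / 2).

Definition pole_free t := forall j, sin (t * al j / 2) != 0.

(** Poles are excluded explicitly because division by zero yields 0: there the singular terms of
    [total_height] would silently vanish. *)
Definition solution (z : R) t := [/\ t != 0, pole_free t & total_height t = z].

(* For [0 <= t], the number of poles of [total_height] in the interval ]0, t],
   counted with multiplicity. *)
Definition winding t : nat := (\sum_j Num.truncn (t * al j / (2 * pi)))%N.

Lemma total_heightN t : total_height (- t) = - total_height t.
Proof.
rewrite /total_height -sumrN; apply: eq_bigr => j _.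
by rewrite !mulNr heightN mulrN.
Qed.

Lemma pole_freeN t : pole_free t -> pole_free (- t).
Proof. by move=> pt j; rewrite !mulNr sinN oppr_eq0. Qed.

Lemma solutionN z t : solution z t -> solution (- z) (- t).
Proof.
move=> [t0 pt tz]; split; [by rewrite oppr_eq0|exact: pole_freeN|].
by rewrite total_heightN tz.
Qed.

Lemma der_scale t (a : R) : is_derive t 1 (fun s => s * a / 2) (a / 2).
Proof.
apply: der_eq (derM (derM (der_id t) (der_cst t a)) (der_cst t 2^-1)) _.
by rewrite !mulr0 !addr0 mul1r.
Qed.

Lemma der_total_height t : pole_free t -> is_derive t 1 total_height
  (\sum_j w j * (al j / 4) * (height' (t * al j / 2) * (al j / 2))).
Proof.
move=> pt; apply: der_sum => j; apply: derZ.
exact: (@der_comp _ height (fun s => s * al j / 2) t _ _ (der_height (pt j)) (der_scale t _)).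
Qed.

Definition total_height' t :=
  \sum_j w j * (al j / 4) * (height' (t * al j / 2) * (al j / 2)).

Lemma der_total_height' t : pole_free t -> is_derive t 1 total_height'
  (\sum_j w j * (al j / 4) * (height'' (t * al j / 2) * (al j / 2) * (al j / 2))).
Proof.
move=> pt; apply: der_sum => j; apply: derZ.
have d := @der_comp _ height' (fun s => s * al j / 2) t _ _ (der_height' (pt j))
  (der_scale t _).
by apply: (der_eq (derM d (der_cst t (al j / 2)))); rewrite mulr0 addr0.
Qed.

Lemma total_height''_gt0 t : 0 < t -> pole_free t ->
  0 < \sum_j w j * (al j / 4) * (height'' (t * al j / 2) * (al j / 2) * (al j / 2)).
Proof.
move=> t0 pt.
have term j : 0 < w j * (al j / 4) * (height'' (t * al j / 2) * (al j / 2) * (al j / 2)).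
  have a2 : 0 < al j / 2 by rewrite divr_gt0.
  have a4 : 0 < al j / 4 by rewrite divr_gt0.
  have h0 : 0 < height'' (t * al j / 2).
    by apply: height''_gt0 => //; rewrite divr_gt0// mulr_gt0.
  by apply: mulr_gt0; [exact: mulr_gt0|apply: mulr_gt0 => //; exact: mulr_gt0].
rewrite (bigD1 (Ordinal k_gt0))//= ltr_wpDr//.
by apply: sumr_ge0 => j _; exact: ltW.
Qed.

(** Each summand of [winding] is monotone, so equality of the sums forces equality of every summand,
    and no term crosses a pole. A pole at [t1] is already counted there, hence the hypothesis at
    [t1]. *)
Lemma pole_free_winding t1 t2 t : 0 < t1 -> t1 <= t -> t <= t2 ->
  pole_free t1 -> winding t1 = winding t2 -> pole_free t.
Proof.
move=> t10 t1t tt2 p1 w12 j.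
have p0 : pi != 0 :> R by exact: lt0r_neq0 (pi_gt0 R).
have pp : 0 < 2 * pi :> R by rewrite mulr_gt0// pi_gt0.
have le12 i : (Num.truncn (t1 * al i / (2 * pi)) <= Num.truncn (t2 * al i / (2 * pi)))%N.
  apply: le_truncn; rewrite ler_pM2r ?invr_gt0// ler_pM2r//.
  exact: le_trans tt2.
have eqj : Num.truncn (t1 * al j / (2 * pi)) = Num.truncn (t2 * al j / (2 * pi)).
  apply/eqP; move/eqP: w12; rewrite /winding.
  have [_ ->] := leqif_sum (fun i (_ : xpredT i) => leqif_eq (le12 i)).
  by move=> /forallP /(_ j).
set m := Num.truncn (t1 * al j / (2 * pi)) in eqj.
have yE s : s * al j / (2 * pi) * pi = s * al j / 2.
  by rewrite invfM mulrA mulfVK.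
have ge0 s : 0 < s -> 0 <= s * al j / (2 * pi).
  by move=> s0; rewrite divr_ge0// ltW// mulr_gt0.
apply: (@sin_neq0 _ m); apply/andP; split.
  apply: (@lt_le_trans _ _ (t1 * al j / 2)); last first.
    by rewrite ler_pM2r ?invr_gt0// ler_pM2r.
  rewrite lt_neqAle; apply/andP; split.
    by apply: contra (p1 j) => /eqP <-; rewrite sin_natpi.
  by rewrite -yE ler_pM2r ?pi_gt0// truncn_le ge0.
apply: (@le_lt_trans _ _ (t2 * al j / 2)).
  by rewrite ler_pM2r ?invr_gt0// ler_pM2r.
rewrite -yE ltr_pM2r ?pi_gt0// eqj.
have t20 : 0 < t2 by rewrite (lt_le_trans t10)// (le_trans t1t).
by have /andP[] := truncn_itv (ge0 t2 t20).
Qed.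

(* [total_height] is strictly convex between consecutive poles. *)
Lemma no_three_solutions z t1 t2 t3 : 0 < t1 -> t1 < t2 -> t2 < t3 ->
  solution z t1 -> solution z t2 -> solution z t3 -> winding t1 = winding t3 -> False.
Proof.
move=> t10 t12 t23 [_ p1 z1] [_ p2 z2] [_ p3 z3] w13.
have pf t : t1 <= t -> t <= t3 -> pole_free t.
  by move=> t1t tt3; exact: (pole_free_winding t10 t1t tt3 p1 w13).
have roll (f df : R -> R) a b : t1 <= a -> a < b -> b <= t3 ->
    (forall t, pole_free t -> is_derive t 1 f (df t)) -> f a = f b ->
    exists2 c, a < c < b & df c = 0.
  move=> ta ab bt d fab.
  have [||||c] := @Rolle _ f a b.
  - exact: ab.
  - move=> t; rewrite in_itv/= => /andP[at_ tb]; apply: derivable_der (d t _).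
    by apply: pf; [exact: le_trans (ltW at_)|exact: le_trans (ltW tb) _].
  - apply: (@der_within_continuous _ f df) => t; rewrite in_itv/= => /andP[at_ tb].
    by apply: d; apply: pf; [exact: le_trans at_|exact: le_trans tb _].
  - exact: fab.
  rewrite in_itv/= => acb dc; exists c => //.
  move/andP: acb => [ac cb]; apply: (der_unique (d c _) dc).
  by apply: pf; [exact: le_trans (ltW ac)|exact: le_trans (ltW cb) _].
have [c1 /andP[c11 c12] d1] := roll _ _ t1 t2 (lexx _) t12 (ltW t23) der_total_height
  (etrans z1 (esym z2)).
have [c2 /andP[c21 c22] d2] := roll _ _ t2 t3 (ltW t12) t23 (lexx _) der_total_height
  (etrans z2 (esym z3)).
have [|||c /andP[c3 c4]] := roll _ _ c1 c2 _ _ _ der_total_height' (etrans d1 (esym d2)).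
- exact: ltW.
- exact: lt_trans c21.
- exact: ltW.
move/eqP; rewrite gt_eqF// total_height''_gt0//.
  by rewrite (lt_trans t10)// (lt_trans c11).
by apply: pf; [rewrite (le_trans (ltW c11))// ltW|rewrite (le_trans (ltW c4))// ltW].
Qed.

Lemma winding_le t : 0 <= t -> (winding t)%:R <= t * (\sum_j al j) / (2 * pi).
Proof.
move=> t0; rewrite /winding natr_sum mulr_sumr mulr_suml; apply: ler_sum => j _.
rewrite truncn_le divr_ge0// ?mulr_ge0// ?pi_ge0// ltW//.
Qed.

(** Solutions of the same sign and winding number number at most two, and this bit tells the farther
    one from the nearer one. *)
Definition later_in_fibre z t := `[< exists s, [/\ solution z s, 0 < s * t,
  `|s| < `|t| & winding `|s| = winding `|t|] >].

Definition solution_code z t : nat :=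
  (4 * winding `|t| + 2 * (t < 0)%R + later_in_fibre z t)%N.

Lemma solution_norm z t : solution z t ->
  solution (if t < 0 then - z else z) `|t|.
Proof.
case: ltP => t0 st; first by rewrite ltr0_norm//; exact: solutionN.
by rewrite ger0_norm.
Qed.

(** If [s] and [t] have equal codes and [s] is the smaller in absolute value, the bit of [t] is set,
    hence so is that of [s]. This yields a third solution, still smaller, against
    [no_three_solutions]. For negative solutions the argument is run on absolute values with
    [- z]. *)
Lemma solution_code_inj z s t : solution z s -> solution z t ->
  solution_code z s = solution_code z t -> s = t.
Proof.
move=> ss st cst.
have cst' : [/\ winding `|s| = winding `|t|, (s < 0) = (t < 0) &
    later_in_fibre z s = later_in_fibre z t].
  move: cst; rewrite /solution_code; case: (s < 0); case: (t < 0);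
  case: later_in_fibre; case: later_in_fibre => E; split => //; lia.
wlog lt_st : s t ss st cst cst' / `|s| < `|t|.
  move=> H; have [lt_st|lt_ts|eq_st] := ltgtP `|s| `|t|; first exact: H.
    by apply/esym/H => //; case: cst' => [-> -> ->].
  move: cst' => [_ sg _]; move: eq_st sg.
  have [t0|t0] := ltP t 0; have [s0|s0] := ltP s 0 => //.
    by rewrite !ltr0_norm// => /oppr_inj.
  by rewrite !ger0_norm.
exfalso; move: cst' => [wst sg lst].
have st0 : 0 < s * t.
  have [s0 _ _] := ss; have [t0 _ _] := st.
  move: sg; case: ltP => s1; case: ltP => t1 // _; first by rewrite nmulr_rgt0.
  by rewrite mulr_gt0// lt_def ?s0 ?t0.
have lt1 : later_in_fibre z t by apply/asboolP; exists s.
move: lst; rewrite lt1 => /asboolP[r [sr rs0 lrs wrs]].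
have rg : (r < 0) = (s < 0).
  have [s0|s0] := ltP s 0; have [r0|r0] := ltP r 0 => //.
    by move: rs0; rewrite ltNge mulr_ge0_le0// ltW.
  by move: rs0; rewrite ltNge mulr_le0_ge0// ltW.
have r0 : 0 < `|r| by rewrite normr_gt0; case: sr.
have := solution_norm sr; have := solution_norm ss; have := solution_norm st.
rewrite rg -sg => h1 h2 h3.
by apply: (no_three_solutions r0 lrs lt_st h3 h2 h1); rewrite wrs.
Qed.

Lemma solution_code_lt z t : (solution_code z t < 4 * (winding `|t|).+1)%N.
Proof.
by clear k_gt0; rewrite /solution_code; case: (t < 0); case: later_in_fibre; lia.
Qed.

End total_height.

(** * Number of solutions, uniformly in the weights *)

Section separation.
Context {R : realType}.

(** Induction on the frequencies: a subinterval good for all of them is found inside one good for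
    the previous ones. The same [d] is both the length of the interval and the lower bound, and it
    does not depend on [x]. *)
Lemma sin_separated (s : seq R) (L : R) : 0 < L -> all (fun a => 0 < a) s ->
  exists2 d : R, 0 < d & forall x : R, exists y : R, [/\ x <= y, y + d <= x + L &
    forall a t, a \in s -> y <= t -> t <= y + d -> d <= `|sin (t * a / 2)|].
Proof.
move=> L0; elim: s => [_|a s IH /= /andP[a0 s0]].
  by exists L => // x; exists x; split.
have [d d0 H] := IH s0.
(* The sines at [y] and [y + e] cannot both be small, since [sin h] is at most the sum of their
   absolute values; [e <= 2 / a] gives [h <= 1], so [sin h > 0]. One of them is at least [2 * q],
   and by the Lipschitz bound at least [q] remains on a length [d']. *)
pose e := Num.min (d / 2) (2 / a).
have e0 : 0 < e by rewrite lt_min !divr_gt0.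
have ed : e <= d / 2 by rewrite ge_min lexx.
have ea : e <= 2 / a by rewrite ge_min lexx orbT.
pose h := e * a / 2.
have h0 : 0 < h by rewrite divr_gt0// mulr_gt0.
have h1 : h <= 1 by rewrite ler_pdivrMr// mul1r -ler_pdivlMr.
have sh : 0 < sin h by apply: sin2_gt0; rewrite h0 (le_lt_trans h1)// ltr1n.
pose q := sin h / 4.
have q0 : 0 < q by rewrite divr_gt0.
pose d' := Num.min (d / 2) (Num.min q (2 * q / a)).
have d'0 : 0 < d' by rewrite !lt_min q0 !divr_gt0// mulr_gt0.
have d'1 : d' <= d / 2 by rewrite ge_min lexx.
have d'2 : d' <= q by rewrite !ge_min lexx orbT.
have d'3 : d' * a <= 2 * q by rewrite -ler_pdivlMr// !ge_min lexx !orbT.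
exists d' => // x; have [y [xy yL ys]] := H x.
have [z [yz zy zq]] : exists z, [/\ y <= z, z <= y + e & 2 * q <= `|sin (z * a / 2)|].
  have : sin h <= `|sin ((y + e) * a / 2)| + `|sin (y * a / 2)|.
    have -> : h = (y + e) * a / 2 - y * a / 2 by rewrite /h; ring.
    rewrite sinB (le_trans (ler_norm _))// (le_trans (ler_normB _ _))// !normrM.
    by rewrite lerD// ?ler_piMr ?ler_piMl// cos_max.
  have [yq|yq] := leP (2 * q) `|sin (y * a / 2)| => hs.
    by exists y; split => //; rewrite lerDl ltW.
  by exists (y + e); rewrite lerDl (ltW e0) lexx; split => //; move: hs yq; rewrite /q; lra.
exists z; split; [exact: le_trans yz|lra|] => b t; rewrite in_cons => /predU1P[->|bs] zt td.
  have := norm_sin_lipschitz (z * a / 2) (t * a / 2).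
  have -> : `|z * a / 2 - t * a / 2| = (t - z) * a / 2.
    by rewrite distrC -!mulrBl ger0_norm// divr_ge0// mulr_ge0 ?subr_ge0// ltW.
  have : (t - z) * a <= d' * a by rewrite ler_pM2r// lerBlDl.
  have := ler_normB (sin (z * a / 2) - sin (t * a / 2)) (- sin (t * a / 2)).
  rewrite opprK subrK normrN; lra.
by apply: le_trans (ys b t bs _ _); lra.
Qed.

End separation.

Section solutions.
Context {R : realType} {k : nat}.
Variables (al : 'I_k -> R).
Hypotheses (k_gt0 : (0 < k)%N) (al_gt0 : forall j, 0 < al j).
Let a := \sum_j al j.
Let p0 : 0 < pi :> R := pi_gt0 R.

Lemma al_le_sum j : al j <= a.
Proof. by rewrite /a (bigD1 j)//= lerDl sumr_ge0// => i _; exact: ltW. Qed.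

Let a_gt0 : 0 < a.
Proof. exact: lt_le_trans (al_gt0 (Ordinal k_gt0)) (al_le_sum _). Qed.

Lemma al_lower_bound : exists2 a0 : R, 0 < a0 & forall j, a0 <= al j.
Proof.
exists (\big[Num.min/1]_j al j); last by move=> j; exact: bigmin_le.
by elim/big_ind: _ => // x y x0 y0; rewrite lt_min x0.
Qed.

Lemma solution_norm_le (w : 'I_k -> R) (a0 z t : R) : (forall j, 0 < w j) ->
  0 < a0 -> (forall j, a0 <= al j) -> solution al w z t ->
  `|t| <= 8 / a0 ^+ 2 * (`|z| / \sum_j w j + a / 4).
Proof.
move=> w0 a00 a0al /solution_norm [t0 pt tz].
have t1 : 0 < `|t| by rewrite normr_gt0 -normr_eq0.
have W0 : 0 < \sum_j w j.
  rewrite (bigD1 (Ordinal k_gt0))//= ltr_wpDr//.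
  by apply: sumr_ge0 => j _; exact: ltW.
have : (\sum_j w j) * (`|t| * a0 ^+ 2 / 8 - a / 4) <= `|z|.
  apply: (@le_trans _ _ (total_height al w `|t|)); last first.
    by rewrite tz; case: ifP => _; rewrite (le_trans (ler_norm _))// ?normrN.
  rewrite /total_height mulr_suml; apply: ler_sum => j _.
  rewrite -(mulrA (w j) (al j / 4)) ler_pM2l//.
  have y0 : 0 < `|t| * al j / 2 by rewrite divr_gt0// mulr_gt0.
  apply: (@le_trans _ _ (al j / 4 * (`|t| * al j / 2 - 1))); last first.
    by rewrite ler_pM2l ?divr_gt0//; exact: height_ge.
  have aa : a0 ^+ 2 <= al j ^+ 2 by rewrite lerXn2r// ?nnegrE ltW.
  have := al_le_sum j.
  have : `|t| * a0 ^+ 2 <= `|t| * al j ^+ 2 by rewrite ler_pM2l.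
  by rewrite !expr2; lra.
rewrite mulrC -ler_pdivlMr// => H.
have a2 : 0 < a0 ^+ 2 by rewrite exprn_gt0.
rewrite mulrAC ler_pdivlMr//; lra.
Qed.

Lemma solution_code_bound : exists C K : R, 0 < C /\
  forall (w : 'I_k -> R) (z : R), (forall j, 0 < w j) ->
  exists2 M : nat, M%:R <= C * (`|z| / \sum_j w j) + K &
    forall t, solution al w z t -> (solution_code al w z t < M)%N.
Proof.
have [a0 a00 a0al] := al_lower_bound.
pose c := 8 / a0 ^+ 2 * a / (2 * pi).
have c0 : 0 < c by apply: divr_gt0; apply: mulr_gt0 => //; rewrite divr_gt0// exprn_gt0.
exists (4 * c), (4 * (c * (a / 4)) + 4); split; first by rewrite mulr_gt0.
move=> w z w0; set W := \sum_j w j.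
have W0 : 0 <= W by apply: sumr_ge0 => j _; exact: ltW.
pose B := c * (`|z| / W + a / 4).
have B0 : 0 <= B.
  apply: mulr_ge0; first exact: ltW.
  by apply: addr_ge0; apply: divr_ge0 => //; exact: ltW.
exists (4 * (Num.truncn B).+1)%N.
  rewrite mulnS natrD natrM.
  have : (Num.truncn B)%:R <= B by rewrite truncn_le.
  by rewrite /B; lra.
(* It remains to bound the winding number by [B]: this combines [winding_le] with the bound on
   [|t|]. The factor 4 and the successor come from the encoding. *)
move=> t st; apply: (leq_trans (solution_code_lt al w z t)).
rewrite leq_mul2l/= ltnS truncn_ge_nat//.
apply: le_trans (winding_le al_gt0 (normr_ge0 t)) _.
have := solution_norm_le w0 a00 a0al st; rewrite -/a -/W => H.
have -> : B = 8 / a0 ^+ 2 * (`|z| / W + a / 4) * a / (2 * pi) by rewrite /B /c; ring.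
by rewrite ler_pM2r ?invr_gt0 ?mulr_gt0// ler_pM2r.
Qed.

Section fixed_weights.
Variable w : 'I_k -> R.
Hypothesis w_gt0 : forall j, 0 < w j.

(* [total_height] tends to infinity at the first pole after [t0]. *)
Lemma solution_after (t0 Z : R) j0 : 0 < t0 -> pole_free al t0 ->
  total_height al w t0 <= Z ->
  exists2 t, t0 <= t < t0 + 2 * pi / al j0 & solution al w Z t.
Proof.
move=> t00 pt0 tZ.
pose m j := Num.truncn (t0 * al j / (2 * pi)).
pose q j := (m j).+1%:R * (2 * pi) / al j.
have pp : 0 < 2 * pi :> R by rewrite mulr_gt0.
have itv j : (m j)%:R <= t0 * al j / (2 * pi) < (m j).+1%:R.
  by apply: truncn_itv; rewrite divr_ge0// ltW// mulr_gt0.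
have t0q j : t0 < q j.
  by have /andP[_] := itv j; rewrite /q ltr_pdivlMr// ltr_pdivrMr.
case: (@Order.TotalTheory.arg_minP _ _ _ j0 xpredT q isT) => js _ qmin.
have qj0 : q js <= t0 + 2 * pi / al j0.
  apply: le_trans (qmin j0 isT) _; have /andP[+ _] := itv j0.
  rewrite ler_pdivlMr// => h; rewrite /q ler_pdivrMr// [leRHS]mulrDl divfK ?gt_eqF//.
  by rewrite -natr1 mulrDl mul1r lerD2r.
have pf t : t0 <= t -> t < q js -> pole_free al t.
  move=> t0t tq j; apply: (@sin_neq0 _ (m j)); apply/andP; split.
    apply: (@lt_le_trans _ _ (t0 * al j / 2)); last by rewrite !ler_pM2r ?invr_gt0.
    rewrite lt_neqAle; apply/andP; split.
      by apply: contra (pt0 j) => /eqP <-; rewrite sin_natpi.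
    by have /andP[+ _] := itv j; rewrite ler_pdivlMr// ler_pdivlMr// -mulrA (mulrC 2).
  have := lt_le_trans tq (qmin j isT); rewrite /q ltr_pdivlMr// => h.
  by rewrite ltr_pdivrMr// -mulrA (mulrC pi).
(* Off the poles, [h] is the term [js] minus [Z], multiplied by the squared sine. It is continuous
   through the pole and positive there, so that term exceeds [Z] just before the pole; the other
   terms are nonnegative. *)
pose h t := w js * (al js / 4) * (t * al js / 2 - sin (t * al js / 2) * cos (t * al js / 2))
   - Z * (sin (t * al js / 2) * sin (t * al js / 2)).
have hq : 0 < h (q js).
  rewrite /h (_ : q js * al js / 2 = (m js).+1%:R * pi); last first.
    by rewrite /q divfK ?gt_eqF//; field.
  rewrite sin_natpi !mul0r mulr0 !subr0 !mulr_gt0// divr_gt0//.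
have ch : {for q js, continuous h}.
  have ds (f df : R -> R) (t : R) : (forall s : R, is_derive s 1 f (df s)) ->
      is_derive t 1 (fun s => f (s * al js / 2)) (df (t * al js / 2) * (al js / 2)).
    by move=> d; exact: (@der_comp _ f (fun s => s * al js / 2) t _ _ (d _) (der_scale t _)).
  have d1 := ds _ _ (q js) (@der_sin R); have d2 := ds _ _ (q js) (@der_cos R).
  exact: der_continuous (derB (derZ (w js * (al js / 4)) (derB (der_scale _ _) (derM d1 d2)))
    (derZ Z (derM d1 d1))).
have [e /= e0 eh] : \forall t \near q js, 0 < h t.
  by have := ch; move=> /(@cvgr_gt _ _ _ _ h (h (q js))) /(_ _ hq).
pose t1 := q js - Num.min e (q js - t0) / 2.
have me : 0 < Num.min e (q js - t0) by rewrite lt_min e0 subr_gt0 t0q.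
have m1 : Num.min e (q js - t0) <= e by rewrite ge_min lexx.
have m2 : Num.min e (q js - t0) <= q js - t0 by rewrite ge_min lexx orbT.
have t01 : t0 < t1 by rewrite /t1; have := t0q js; lra.
have t1q : t1 < q js by rewrite /t1; lra.
have h1 : 0 < h t1.
  apply: eh; rewrite /ball_/= /t1 opprB addrC subrK gtr0_norm ?divr_gt0//; lra.
have t10 : 0 < t1 := lt_trans t00 t01.
have Zt1 : Z <= total_height al w t1.
  rewrite /total_height (bigD1 js)//= ler_wpDr//.
    apply: sumr_ge0 => j _; apply: mulr_ge0; first by rewrite ltW// mulr_gt0// divr_gt0.
    by apply: height_ge0; rewrite divr_gt0// mulr_gt0.
  have s2 : 0 < sin (t1 * al js / 2) ^+ 2.
    by rewrite exprn_even_gt0//=; apply: pf => //; exact: ltW.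
  by rewrite /height mulrA ler_pdivlMr// ltW// -subr_gt0 expr2.
have ct : {within `[t0, t1], continuous (total_height al w)}.
  apply: (@der_within_continuous _ _ (total_height' al w)) => t.
  rewrite in_itv/= => /andP[t0t tt1]; apply: der_total_height; apply: pf => //.
  exact: le_lt_trans t1q.
have [|t] := @IVT _ _ _ _ Z (ltW t01) ct.
  by rewrite ge_min tZ/= le_max Zt1 orbT.
rewrite in_itv/= => /andP[t0t tt1] tE; have tq := le_lt_trans tt1 t1q.
exists t; first by rewrite t0t (lt_le_trans tq).
by split => //; [rewrite gt_eqF// (lt_le_trans t00)|exact: pf].
Qed.

End fixed_weights.

Lemma many_solutions : exists C K : R, 0 < C /\
  forall (w : 'I_k -> R) (z : R), (forall j, 0 < w j) ->
  exists m : nat, C * (`|z| / \sum_j w j) + K <= m%:R /\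
    exists g : nat -> R, (forall i, (i < m)%N -> solution al w z (g i)) /\
      {in gtn m &, injective g}.
Proof.
pose j0 := Ordinal k_gt0; pose L := 2 * pi / al j0.
have L0 : 0 < L by rewrite divr_gt0// mulr_gt0.
have all_al : all (fun a => 0 < a) [seq al j | j <- enum 'I_k].
  by apply/allP => _ /mapP[j _ ->].
have [d d0 H] := sin_separated L0 all_al.
(* Chosen so that at the starting point of index [i], which is at most [2 * i.+1%:R * L],
   [height_le] bounds the total height by [i.+1%:R * Q] times the sum of the weights. *)
pose Q := a / 4 * (L * a + 1) / d ^+ 2.
have Q0 : 0 < Q by rewrite divr_gt0 ?exprn_gt0// mulr_gt0 ?divr_gt0// addr_gt0// mulr_gt0.
exists Q^-1, (- 1); split; first by rewrite invr_gt0.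
move=> w z w0; set W := \sum_j w j.
have W0 : 0 < W.
  rewrite /W (bigD1 j0)//= ltr_wpDr//.
  by apply: sumr_ge0 => j _; exact: ltW.
pose B := Q^-1 * (`|z| / W).
have B0 : 0 <= B.
  by apply: mulr_ge0; [rewrite invr_ge0 ltW|rewrite divr_ge0// ltW].
exists (Num.truncn B); split.
  by have /andP[_] := truncn_itv B0; rewrite -natr1 -/B; lra.
have start i : exists t0, [/\ (2 * i + 1)%:R * L <= t0, t0 <= (2 * i + 2)%:R * L,
    pole_free al t0 & forall j, d <= `|sin (t0 * al j / 2)|].
  have [y [xy yL ys]] := H ((2 * i + 1)%:R * L).
  have yd j : d <= `|sin (y * al j / 2)|.
    by apply: ys; rewrite ?lexx ?lerDl ?ltW// map_f// mem_enum.
  exists y; split => //.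
    have -> : (2 * i + 2)%:R = (2 * i + 1)%:R + 1 :> R by rewrite natr1 addn2 addn1.
    by rewrite mulrDl mul1r; lra.
  by move=> j; rewrite -normr_gt0 (lt_le_trans d0).
(* The starting point lies in a window of length [L], and the solution less than one period [L]
   after it; windows spaced by [2 * L] thus give disjoint ranges. The odd multiple keeps the first
   starting point positive. *)
have sol i : (i < Num.truncn B)%N -> exists t,
    [/\ (2 * i + 1)%:R * L <= t, t < (2 * i + 3)%:R * L & solution al w `|z| t].
  rewrite truncn_gt_nat => iB; have [t0 [t1 t2 pt0 td]] := start i.
  have t00 : 0 < t0 by apply: lt_le_trans t1; rewrite mulr_gt0// ltr0n addn1.
  have [|t /andP[tt0 tt1] st] := @solution_after w w0 t0 `|z| j0 t00 pt0.
    have iz : i.+1%:R * Q * W <= `|z|.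
      by move: iB; rewrite /B mulrC ler_pdivlMr// ler_pdivlMr.
    apply: le_trans iz; rewrite mulr_sumr; apply: ler_sum => j _.
    rewrite [leRHS]mulrC -mulrA ler_pM2l//.
    have y0 : 0 < t0 * al j / 2 by rewrite divr_gt0// mulr_gt0.
    apply: (@le_trans _ _ (a / 4 * ((t0 * al j / 2 + 1) / d ^+ 2))).
      apply: ler_pM; [|exact: height_ge0| |exact: height_le].
        by rewrite divr_ge0// ltW.
      by rewrite ler_pM2r// al_le_sum.
    have -> : i.+1%:R * Q = a / 4 * (i.+1%:R * (L * a + 1) / d ^+ 2) by rewrite /Q; ring.
    rewrite ler_pM2l ?divr_gt0// ler_pM2r ?invr_gt0 ?exprn_gt0//.
    have i1 : 1 <= i.+1%:R :> R by rewrite ler1n.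
    have t3 : t0 <= 2 * i.+1%:R * L by rewrite -natrM mulnS addnC.
    have : t0 * al j <= 2 * i.+1%:R * L * a.
      by apply: ler_pM => //; [exact: ltW|exact: ltW|exact: al_le_sum].
    by rewrite mulrDr mulr1; lra.
  exists t; split => //; first exact: le_trans tt0.
  have -> : (2 * i + 3)%:R = (2 * i + 2)%:R + 1 :> R by rewrite natr1 addn2 addn3.
  by rewrite mulrDl mul1r (lt_le_trans tt1)// lerD2r.
pose g i := if (i < Num.truncn B)%N =P true is ReflectT iB then sval (cid (sol i iB)) else 0.
have gP i : (i < Num.truncn B)%N -> [/\ (2 * i + 1)%:R * L <= g i,
    g i < (2 * i + 3)%:R * L & solution al w `|z| (g i)].
  by rewrite /g; case: eqP => // iB _; exact: (svalP (cid (sol i iB))).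
have glt i j : (i < j)%N -> (j < Num.truncn B)%N -> g i < g j.
  move=> ij jB; have [_ gi _] := gP i (ltn_trans ij jB); have [gj _ _] := gP j jB.
  apply: lt_le_trans gi _; apply: le_trans gj.
  by rewrite ler_pM2r// ler_nat; lia.
have ginj : {in gtn (Num.truncn B) &, injective g}.
  move=> i j; rewrite !inE => iB jB gij.
  by have [ij|ij|//] := ltngtP i j; [have := glt _ _ ij jB|have := glt _ _ ij iB];
    rewrite gij ltxx.
have [z0|z0] := leP 0 z.
  by exists g; split => // i /gP[_ _]; rewrite ger0_norm.
exists (fun i => - g i); split; last by move=> i j iB jB /oppr_inj; exact: ginj.
by move=> i /gP[_ _ /solutionN]; rewrite ltr0_norm// opprK.
Qed.

End solutions.

Section counting_bounds.
Context {R : realType} {T : choiceType}.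
Implicit Types (X : set T).

Lemma counting_le_code X (f : T -> nat) (M : nat) :
  (forall x, X x -> (f x < M)%N) -> {in X &, injective f} ->
  (counting X <= M%:R%:E :> \bar R)%E.
Proof.
move=> fM finj; have XM : (X #<= `I_M)%card.
  rewrite -(card_le_eql (inj_card_eq finj)); apply: subset_card_le.
  by move=> _ [x Xx <-]; exact: fM.
have Xfin : finite_set X by apply/finite_set_leP; exists M.
by rewrite /counting asboolT// lee_fin ler_nat geq_card_fset_set.
Qed.

Lemma counting_ge_family X (g : nat -> T) (m : nat) :
  (forall i, (i < m)%N -> X (g i)) -> {in gtn m &, injective g} ->
  (m%:R%:E <= counting X :> \bar R)%E.
Proof.
move=> gX ginj; rewrite /counting; case: ifPn => [/asboolP Xfin|_]; last exact: leey.
rewrite lee_fin ler_nat leq_card_fset_set//.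
have ginj' : {in `I_m &, injective g}.
  by move=> i j /set_mem im /set_mem jm; apply: ginj; rewrite inE.
rewrite -(card_le_eql (inj_card_eq ginj')); apply: subset_card_le.
by move=> _ [i im <-]; exact: gX.
Qed.

End counting_bounds.

(** * Closed form of the extremals and of their endpoints *)

Section explicit_extremals.
Context {R : realType} {n : nat}.
Local Notation V := 'rV[R]_(2 * n).
Variable A : 'M[R]_(2 * n).
Hypotheses (A_skew : A^T = - A).
Variables (k : nat) (al : 'I_k -> R) (P : 'I_k -> 'M[R]_(2 * n)).
Hypotheses (al_gt0 : forall j, 0 < al j) (sumP : \sum_j P j = 1%:M)
  (PA : forall j, P j *m A = A *m P j)
  (PAA : forall j, P j *m A *m A = - al j ^+ 2 *: P j)
  (orthP : forall i j (x y : V), i != j -> dot (x *m P i) (y *m P j) = 0).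

Lemma sum_components (x : V) : x = \sum_j x *m P j.
Proof. by rewrite -mulmx_sumr sumP mulmx1. Qed.

Lemma mul_proj_orth i j (x : V) : i != j -> x *m P i *m P j = 0.
Proof.
move=> ij; apply/eqP; rewrite -dot_eq0.
have : dot (x *m P i *m P j) (x *m P i) = 0 by apply: orthP; rewrite eq_sym.
rewrite {2}(sum_components (x *m P i)) (bigD1 j)//= dotDr dot_sumr big1 ?addr0 => [->//|l lj].
by apply: orthP; rewrite eq_sym.
Qed.

Lemma mul_proj_id j (x : V) : x *m P j *m P j = x *m P j.
Proof.
rewrite [RHS](sum_components (x *m P j)) (bigD1 j)//= big1 ?addr0// => i ij.
by rewrite mul_proj_orth// eq_sym.
Qed.

Lemma sum_proj (F : 'I_k -> V) j : (forall i, F i *m P i = F i) ->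
  (\sum_i F i) *m P j = F j.
Proof.
move=> FP; rewrite mulmx_suml (bigD1 j)//= FP big1 ?addr0// => i ij.
by rewrite -FP mul_proj_orth.
Qed.

Lemma dot_components (x y : V) : dot x y = \sum_j dot (x *m P j) (y *m P j).
Proof.
rewrite {1}(sum_components x) dot_suml; apply: eq_bigr => i _.
rewrite {1}(sum_components y) dot_sumr (bigD1 i)//= big1 ?addr0// => j ji.
by apply: orthP; rewrite eq_sym.
Qed.

Lemma mulPA j (x : V) : x *m P j *m A = x *m A *m P j.
Proof. by rewrite -!mulmxA PA. Qed.

Lemma mulPAA j (x : V) : x *m P j *m A *m A = - al j ^+ 2 *: (x *m P j).
Proof. by rewrite -!mulmxA (mulmxA (P j)) PAA scalemxAr. Qed.

Lemma dotAA j (x : V) : dot (x *m P j *m A) (x *m P j *m A) =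
  al j ^+ 2 * dot (x *m P j) (x *m P j).
Proof. by rewrite (dot_skew _ _ A_skew) mulPAA dotZr mulNr opprK. Qed.

(** For [th != 0], this is the solution of [x' = v + th *: (x *m A)] vanishing at 0: on the range of
    [P j] the matrix [A / al j] squares to [- 1], so the matrix exponential reduces to a sine and a
    cosine. *)
Definition extremal_x (v : V) (th t : R) : V :=
  \sum_j ((sin (th * al j * t) / (th * al j)) *: (v *m P j) +
          ((1 - cos (th * al j * t)) / (th * al j ^+ 2)) *: (v *m P j *m A)).

(** From [u - v = th *: (x *m A)], twice [th] times the rate of the height is [dot u u - dot v u];
    the speed is constant, so this integrates in closed form. *)
Definition extremal_z (v : V) (th t : R) : R :=
  (dot v v * t - dot v (extremal_x v th t)) / (2 * th).

Definition extremal v th t : V * R := (extremal_x v th t, extremal_z v th t).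

Lemma extremal_x0 v th : extremal_x v th 0 = 0.
Proof.
rewrite /extremal_x big1// => j _.
by rewrite mulr0 sin0 cos0 subrr !mul0r !scale0r addr0.
Qed.

Lemma extremal0 v th : extremal v th 0 = 0.
Proof. by rewrite /extremal /extremal_z extremal_x0 dot0r mulr0 subrr mul0r. Qed.

Lemma vder_sum (I : Type) (r : seq I) (x : I -> R -> V) (w : I -> V) t :
  (forall i, vder (x i) t (w i)) -> vder (fun s => \sum_(i <- r) x i s) t (\sum_(i <- r) w i).
Proof.
move=> d; elim: r => [|i r IH].
  by under eq_fun do rewrite big_nil; rewrite big_nil; exact: vder_cst.
by under eq_fun do rewrite big_cons; rewrite big_cons; exact: vderD.
Qed.

Section velocity.
Variables (v : V) (th : R).
Hypothesis th_neq0 : th != 0.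
Local Notation x := (extremal_x v th).
Local Notation u t := (v + th *: (x t *m A)).

Lemma extremal_velocityE t : u t = \sum_j (cos (th * al j * t) *: (v *m P j) +
  (sin (th * al j * t) / al j) *: (v *m P j *m A)).
Proof.
rewrite {1}(sum_components v) /extremal_x mulmx_suml scaler_sumr -big_split/=.
apply: eq_bigr => j _; rewrite mulmxDl -!scalemxAl mulPAA scalerDr !scalerA.
have a0 : al j != 0 by rewrite gt_eqF.
set s := sin _; set c := cos _.
have -> : th * (s / (th * al j)) = s / al j by field; rewrite a0.
have -> : th * ((1 - c) / (th * al j ^+ 2)) * - al j ^+ 2 = c - 1 by field; rewrite a0.
by rewrite scalerBl scale1r addrCA addrC (addrC _ (_ - _)) subrK addrC.
Qed.

Lemma vder_extremal_x t : vder x t (u t).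
Proof.
rewrite extremal_velocityE; apply: vder_sum => j.
have a0 : al j != 0 by rewrite gt_eqF.
have d1 : is_derive t 1 (fun s => th * al j * s) (th * al j).
  by apply: der_eq (derZ (th * al j) (der_id t)) _; rewrite mulr1.
have ds := der_comp (der_sin _) d1; have dc := der_comp (der_cos _) d1.
apply: vderD; apply: vderZr.
  apply: der_eq (derM ds (der_cst t _)) _.
  by rewrite mulr0 addr0; field; rewrite a0.
apply: der_eq (derM (derB (der_cst t 1) dc) (der_cst t _)) _.
by rewrite mulr0 addr0; field; rewrite a0.
Qed.

Lemma vder_extremal_u t : vder (fun t => u t) t (th *: (u t *m A)).
Proof.
apply: vder_eq (vderD (vder_cst t v) (vderZl th (vder_mulmx A (vder_extremal_x t)))) _.
by rewrite add0r.
Qed.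

Lemma extremal_speed t : dot (u t) (u t) = dot v v.
Proof.
have := @is_derive_0_is_cst _ (fun t => dot (u t) (u t)) t 0.
rewrite extremal_x0 mul0mx scaler0 addr0; apply => s.
apply: der_eq (der_dot (vder_extremal_u s) (vder_extremal_u s)) _.
by rewrite dotZl dotZr (dotC (u s)) dot_skew_id// !mulr0 addr0.
Qed.

Lemma extremal_hvel t : hvel A (extremal v th) t (u t).
Proof.
split; first exact: vder_extremal_x.
rewrite /extremal /= /extremal_z.
have d1 := der_dot (vder_cst t v) (vder_extremal_x t).
apply: der_eq (derM (derB (derZ (dot v v) (der_id t)) d1) (der_cst t _)) _.
rewrite dot0l mulr0 addr0 add0r mulr1 -[in LHS](extremal_speed t) {1}dotDl.
rewrite dotZl addrAC subrr add0r; set X := dot _ _; field.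
exact: th_neq0.
Qed.

Lemma extremal_endpoint j (y := th * al j / 2) : x 1 *m P j =
  (sin y * cos y / y) *: (v *m P j) + (sin y ^+ 2 / (y * al j)) *: (v *m P j *m A).
Proof.
have a0 : al j != 0 by rewrite gt_eqF.
rewrite /extremal_x sum_proj; last first.
  by move=> i; rewrite mulmxDl -!scalemxAl mulPA !mul_proj_id.
rewrite !mulr1; have -> : th * al j = y *+ 2 by rewrite -mulr_natr divfK.
rewrite sin_mulr2n cos_mulr2n; congr (_ *: _ + _ *: _).
- rewrite /y; field.
  by rewrite th_neq0 a0.
- rewrite sin2cos2 /y; field.
  by rewrite th_neq0 a0.
Qed.

(** In each invariant plane the projection is a circular arc turning by [2 * y], and its chord is
    [sin y / y] times its length. A zero sine therefore means a closed arc, that is a vanishing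
    component of the endpoint. *)
Lemma extremal_endpoint_norm j (y := th * al j / 2) :
  dot (x 1 *m P j) (x 1 *m P j) = (sin y / y) ^+ 2 * dot (v *m P j) (v *m P j).
Proof.
have a0 : al j != 0 by rewrite gt_eqF.
have y0 : y != 0 by rewrite !mulf_neq0 ?invr_eq0 ?pnatr_eq0.
rewrite extremal_endpoint -/y !(dotDl, dotDr, dotZl, dotZr) dotAA.
rewrite (dotC (v *m P j)) dot_skew_id// !mulr0 addr0 add0r.
set D := dot _ _; have c2 := cos2sin2 y; set s := sin y in c2 *.
have -> : s * cos y / y * (s * cos y / y * D) = s ^+ 2 * cos y ^+ 2 / y ^+ 2 * D.
  by field.
by rewrite c2; field; rewrite y0 a0.
Qed.

Lemma extremal_endpoint_dot j (y := th * al j / 2) :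
  dot (v *m P j) (x 1 *m P j) = sin y * cos y / y * dot (v *m P j) (v *m P j).
Proof.
rewrite extremal_endpoint -/y dotDr !dotZr.
by rewrite (dotC _ (v *m P j *m A)) dot_skew_id// mulr0 addr0.
Qed.

Lemma extremal_height : pole_free al th ->
  extremal_z v th 1 = total_height al (fun j => dot (x 1 *m P j) (x 1 *m P j)) th.
Proof.
move=> pf; rewrite /extremal_z mulr1 (dot_components v v) (dot_components v (x 1)).
rewrite -sumrB mulr_suml; apply: eq_bigr => j _.
rewrite extremal_endpoint_dot extremal_endpoint_norm /height.
have a0 : al j != 0 by rewrite gt_eqF.
have := pf j; set y := th * al j / 2; set s := sin y => s0.
have y0 : y != 0 by rewrite !mulf_neq0 ?invr_eq0 ?pnatr_eq0.
have thE : th = 2 * y / al j by rewrite /y; field; rewrite a0.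
by rewrite thE; field; rewrite ?s0 ?y0 ?a0.
Qed.

Lemma extremal_pole_free : (forall j, x 1 *m P j != 0) -> pole_free al th.
Proof.
move=> xP j; apply: contra (xP j) => /eqP s0.
by rewrite -dot_eq0 extremal_endpoint_norm s0 mul0r expr0n mul0r.
Qed.

End velocity.

Lemma extremal_xB v v' th t :
  extremal_x v th t - extremal_x v' th t = extremal_x (v - v') th t.
Proof.
rewrite /extremal_x -sumrB; apply: eq_bigr => j _.
by rewrite !mulmxBl !scalerBr opprD addrACA.
Qed.

Lemma extremal_x_inj v v' th : th != 0 -> pole_free al th ->
  extremal_x v th 1 = extremal_x v' th 1 -> v = v'.
Proof.
move=> th0 pf E; apply/eqP; rewrite -subr_eq0 (sum_components (v - v')).
rewrite big1// => j _; apply/eqP; rewrite -dot_eq0.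
have := extremal_endpoint_norm (v - v') th0 j.
rewrite -extremal_xB E subrr mul0mx dot0l => /esym/eqP; rewrite mulf_eq0 sqrf_eq0.
rewrite mulf_eq0 (negPf (pf j)) invr_eq0 !mulf_eq0 (negPf th0) invr_eq0 pnatr_eq0.
by rewrite gt_eqF.
Qed.

Lemma extremal_x_surj (p : V) th : th != 0 -> pole_free al th ->
  exists v, extremal_x v th 1 = p.
Proof.
move=> th0 pf; pose y j := th * al j / 2.
(* On the range of [P j], with [J = A / al j], the endpoint map is [sin y / y] times the rotation
   [cos y + sin y * J]; this is its inverse, [y / sin y] times [cos y - sin y * J]. *)
pose F j := (y j * cos (y j) / sin (y j)) *: (p *m P j) - (th / 2) *: (p *m P j *m A).
have FP i : F i *m P i = F i.
  by rewrite /F mulmxBl -!scalemxAl mulPA !mul_proj_id.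
exists (\sum_j F j); rewrite [RHS]sum_components [LHS]sum_components.
apply: eq_bigr => j _; rewrite extremal_endpoint// sum_proj// /F -/(y j).
have a0 : al j != 0 by rewrite gt_eqF.
have y0 : y j != 0 by rewrite !mulf_neq0 ?invr_eq0 ?pnatr_eq0.
have thE : th / 2 = y j / al j by rewrite /y; field; rewrite a0.
have s0 := pf j; rewrite -/(y j) in s0.
rewrite mulmxBl -!scalemxAl mulPAA !scalerBr !scalerA thE.
set s := sin (y j) in s0 *; set c := cos (y j); set q := p *m P j.
have -> : s * c / y j * (y j * c / s) = c ^+ 2 by field; rewrite y0 s0.
have -> : s ^+ 2 / (y j * al j) * (y j * c / s) = s * c / y j * (y j / al j).
  by field; rewrite y0 s0 a0.
have -> : s ^+ 2 / (y j * al j) * (y j / al j) * - al j ^+ 2 = - s ^+ 2.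
  by field; rewrite y0 a0.
by rewrite scaleNr opprK addrA subrK -scalerDl cos2Dsin2 scale1r.
Qed.

End explicit_extremals.

(** * From geodesics to solutions of the height equation *)

Section geodesics.
Context {R : realType} {n : nat}.
Local Notation V := 'rV[R]_(2 * n).
Variable A : 'M[R]_(2 * n).
Hypotheses (A_skew : A^T = - A) (A_unit : A \in unitmx).

(** The difference [e] of the horizontal parts solves [e' = th *: (e *m A)], so [dot e e] is
    constant by skew symmetry and vanishes at 0. The heights then have the same derivative. *)
Lemma extremal_unique (v : V) (th : R) (c d : R -> V * R) :
  horizontal_curve A 0 1 c -> horizontal_curve A 0 1 d -> c 0 = d 0 ->
  {in `]0, 1[, forall t, hvel A c t (v + th *: ((c t).1 *m A))} ->
  {in `]0, 1[, forall t, hvel A d t (v + th *: ((d t).1 *m A))} ->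
  {in `[0, 1], forall t, c t = d t}.
Proof.
move=> hc hd cd0 uc ud.
have [cx cz] := horizontal_curve_within_continuous hc.
have [dx dz] := horizontal_curve_within_continuous hd.
pose e t : V := (c t).1 - (d t).1.
have de (t : R) : t \in `]0, 1[ -> vder e t (th *: (e t *m A)).
  move=> tI; apply: vder_eq (vderB (uc t tI).1 (ud t tI).1) _.
  by rewrite opprD addrACA subrr add0r -scalerBr -mulmxBl.
have sub (t : R) : t <= 1 -> `[0, t] `<=` `[0, 1].
  by move=> t1; apply: subset_itvl; rewrite bnd_simp.
have sI (t s : R) : t <= 1 -> s \in `]0, t[ -> s \in `]0, 1[.
  by move=> t1; rewrite !in_itv/= => /andP[-> /lt_le_trans]; exact.
have ce : {within `[0, 1], continuous (fun t => dot (e t) (e t))}.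
  have ci i : {within `[0, 1], continuous (fun t => e t 0 i)}.
    have -> : (fun t => e t 0 i) = (fun t => (c t).1 0 i - (d t).1 0 i).
      by apply/funext => t; rewrite !mxE.
    by move=> t; apply: cvgB; [exact: cx|exact: dx].
  have [f fE cf] : exists2 f, f = (fun t => dot (e t) (e t)) &
      {within `[0, 1], continuous f}.
    rewrite /dot; elim: (index_enum _) => [|i r [f fE cf]].
      exists (fun=> 0); first by apply/funext => t; rewrite big_nil.
      by move=> t; exact: cvg_cst.
    exists (fun t => e t 0 i * e t 0 i + f t).
      by apply/funext => t; rewrite big_cons fE.
    by move=> t; apply: cvgD; [apply: cvgM; exact: ci|exact: cf].
  by rewrite -fE.
have e0 t : t \in `[0, 1] -> e t = 0.
  rewrite in_itv/= => /andP[t0 t1]; apply/eqP; rewrite -dot_eq0.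
  rewrite (@der0_constant _ (fun t => dot (e t) (e t)) 0 t t0).
  - by rewrite /e cd0 subrr dot0l.
  - exact: continuous_subspaceW (sub t t1) ce.
  - move=> s /(sI t s t1) sI'; apply: der_eq (der_dot (de s sI') (de s sI')) _.
    by rewrite dotZl dotZr (dotC (e s)) dot_skew_id// !mulr0 addr0.
have xE (t : R) : t \in `[0, 1] -> (c t).1 = (d t).1 by move=> /e0 /subr0_eq.
move=> t tI; rewrite [LHS]surjective_pairing [RHS]surjective_pairing xE//.
congr pair; move: tI; rewrite in_itv/= => /andP[t0 t1]; apply/subr0_eq.
rewrite (@der0_constant _ (fun t => (c t).2 - (d t).2) 0 t t0).
- by rewrite cd0 subrr.
- apply: continuous_subspaceW (sub t t1) _.
  by move=> s; apply: cvgB; [exact: cz|exact: dz].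
- move=> s /(sI t s t1) sI'; apply: der_eq (derB (uc s sI').2 (ud s sI').2) _.
  rewrite xE ?subrr//; move: sI'; rewrite !in_itv/= => /andP[/ltW -> /ltW ->]//.
Qed.

Variables (k : nat) (al : 'I_k -> R) (P : 'I_k -> 'M[R]_(2 * n)).
Hypotheses (k_gt0 : (0 < k)%N) (al_gt0 : forall j, 0 < al j) (sumP : \sum_j P j = 1%:M)
  (PA : forall j, P j *m A = A *m P j)
  (PAA : forall j, P j *m A *m A = - al j ^+ 2 *: P j)
  (orthP : forall i j (x y : V), i != j -> dot (x *m P i) (y *m P j) = 0).
Local Notation extremal := (extremal A al P).

Lemma extremal_hvelT v th : th != 0 ->
  forall t, hvel A (extremal v th) t (v + th *: ((extremal v th t).1 *m A)).
Proof. by move=> th0 t; exact: (extremal_hvel A_skew al_gt0 sumP PAA). Qed.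

Lemma extremal_horizontal v th : th != 0 -> horizontal_curve A 0 1 (extremal v th).
Proof.
move=> th0; have [xu _] := extremal_vlipder (extremal_hvelT v th0) ler01.
exact: lipder_horizontal_curve xu (extremal_lipder (extremal_hvelT v th0) ler01).
Qed.

Lemma extremal_geodesic v th : th != 0 -> extremal v th 1 != 0 ->
  geodesic A (extremal v th).
Proof.
move=> th0 e1; split; first exact: extremal_horizontal.
  exists 1, 0; rewrite !in_itv/= !lexx ler01; split => //.
  by rewrite extremal0; exact/eqP.
move=> t; rewrite in_itv/= => /andP[t0 t1].
have [e e0 emin] := extremal_locally_minimizing A_skew (extremal_hvelT v th0).
exists (Num.max 0 (t - e)), (Num.min 1 (t + e)).
have ab : Num.max 0 (t - e) < Num.min 1 (t + e).
  rewrite gt_max !lt_min ltr01 ltr_wpDl//= ltrD2l gtrN// andbT.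
  by rewrite ltrBlDr (le_lt_trans t1)// ltrDl.
split; first exact: ab.
- apply: subset_itv; rewrite bnd_simp; first by rewrite le_max lexx.
  by rewrite ge_min lexx.
- near=> s; rewrite !in_itv/= => /andP[s0 s1].
  have : `|t - s| < e by near: s; exact: nbhsx_ballx.
  rewrite ltr_norml => /andP[h1 h2].
  rewrite ge_max le_min s0 s1/= lerBlDr -lerBlDl (ltW h2)/=.
  by move: h1; rewrite ltrBrDl ltrBlDr => /ltW.
- by apply: (emin t _ _ ab); rewrite ?le_max ?ge_min lexx orbT.
Unshelve. all: by end_near. Qed.

(** Equal curves have equal velocities [u], and differentiating these gives
    [th *: (u *m A) = th' *: (u *m A)]. The vector [u *m A] is nonzero because the speed is that of
    [v], and [v != 0] since the curve leaves the origin. *)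
Lemma extremal_frequency_inj v v' th th' : th != 0 -> th' != 0 ->
  extremal_x A al P v th 1 != 0 ->
  {in `[0, 1], forall t, extremal v th t = extremal v' th' t} -> th = th'.
Proof.
move=> th0 th'0 x1 E.
pose u s := v + th *: (extremal_x A al P v th s *m A).
pose u' s := v' + th' *: (extremal_x A al P v' th' s *m A).
have nI (t : R) : t \in `]0, 1[ -> \forall s \near t, s \in `]0, 1[.
  by move=> tI; have := near_in_itvoo tI.
have xE (s : R) : s \in `]0, 1[ -> extremal_x A al P v th s = extremal_x A al P v' th' s.
  by move=> sI; have [] := E s (subset_itv_oo_cc sI).
have uE (t : R) : t \in `]0, 1[ -> u t = u' t.
  move=> tI; apply: vder_unique (extremal_hvelT v' th'0 t).1.
  apply: vder_near (extremal_hvelT v th0 t).1.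
  by near=> s; apply: xE; near: s; exact: nI.
have hI : 2^-1 \in `]0, (1 : R)[ by rewrite in_itv/= invr_gt0 invf_lt1 ?ltr0n// ltr1n.
have : th *: (u 2^-1 *m A) = th' *: (u 2^-1 *m A).
  rewrite [in RHS](uE _ hI); apply: vder_unique (vder_extremal_u al_gt0 sumP PAA v' th'0 2^-1).
  apply: vder_near (vder_extremal_u al_gt0 sumP PAA v th0 2^-1).
  by near=> s; apply: uE; near: s; exact: nI.
move=> /eqP; rewrite -subr_eq0 -scalerBl scaler_eq0 => /orP[|]; first by rewrite subr_eq0 => /eqP.
rewrite -dot_eq0 dot_mulmx_unit_eq0// -dot_eq0 (extremal_speed A_skew al_gt0 sumP PAA)//.
rewrite dot_eq0 => /eqP v0; move: x1; rewrite v0 /extremal_x big1 ?eqxx// => j _.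
by rewrite !mul0mx !scaler0 addr0.
Unshelve. all: by end_near. Qed.

Lemma straight_velocity c (v : V) : horizontal_curve A 0 1 c -> c 0 = 0 ->
  {in `]0, 1[, forall t, hvel A c t v} -> v = (c 1).1.
Proof.
move=> hc c0 cv; have [cx _] := horizontal_curve_within_continuous hc.
apply/rowP => i; apply/esym/subr0_eq.
have := @der0_constant _ (fun t => (c t).1 0 i - t * v 0 i) 0 1 ler01.
rewrite c0 mxE mul0r subrr mul1r; apply.
  move=> t; apply: cvgB; first exact: cx.
  apply: cvgM; last exact: cvg_cst.
  by apply: (@der_within_continuous _ id (fun=> 1)) => s _; exact: der_id.
move=> t tI; apply: der_eq (derB ((cv t tI).1 i) (derM (der_id t) (der_cst t _))) _.
by rewrite mul1r mulr0 addr0 subrr.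
Qed.

Lemma geodesic_count_bounds (x : V) (z : R) (w := fun j => dot (x *m P j) (x *m P j)) :
  (forall j, x *m P j != 0) ->
  (forall (g : nat -> R) (m : nat), (forall i, (i < m)%N -> solution al w z (g i)) ->
    {in gtn m &, injective g} -> (m%:R%:E <= geodesic_count A (x, z))%E) /\
  (forall M : nat, (forall t, solution al w z t -> (solution_code al w z t < M)%N) ->
    (geodesic_count A (x, z) <= M.+1%:R%:E)%E).
Proof.
move=> xP; have w_gt0 j : 0 < w j by rewrite dot_gt0.
have x0 : x != 0.
  by apply: contra (xP (Ordinal k_gt0)) => /eqP ->; rewrite mul0mx.
split.
  move=> g m gs ginj.
  have exv i : exists v, (i < m)%N -> extremal v (g i) 1 = (x, z).
    case: (ltnP i m) => im; last by exists 0.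
    have [g0 gp gz] := gs i im.
    have [v vx] := extremal_x_surj al_gt0 sumP PA PAA orthP x g0 gp.
    exists v => _; rewrite /extremal vx; congr pair.
    by rewrite (extremal_height A_skew al_gt0 sumP PA PAA orthP)// vx.
  pose v i := sval (cid (exv i)).
  have vP i : (i < m)%N -> extremal (v i) (g i) 1 = (x, z).
    by rewrite /v; case: (cid _).
  pose G i := (extremal (v i) (g i)) \_ `[0, 1].
  apply: (@counting_ge_family _ _ _ G) => [i im|i j].
    have [g0 _ _] := gs i im; exists (extremal (v i) (g i)) => //; split.
    - apply: extremal_geodesic => //; rewrite vP//.
      by apply: contra x0 => /eqP[->].
    - exact: extremal0.
    - exact: vP.
  rewrite !inE => im jm Gij; apply: ginj; rewrite ?inE//.
  have [gi _ _] := gs i im; have [gj _ _] := gs j jm.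
  apply: (@extremal_frequency_inj (v i) (v j)) => // [|t tI].
    by have [->] := vP i im.
  have := congr1 (fun f => f t) Gij; rewrite /G !patchE.
  by have -> : t \in [set` `[0 : R, 1]] by rewrite inE.
move=> M codeM.
(* [Q r q] says that [q] is a pair of parameters for some curve restricting to [r]. [F] merely
   chooses one such pair for each geodesic; injectivity comes from [Qinj], by which parameters
   determine [r]. *)
pose Q r (q : V * R) := exists c, [/\ horizontal_curve A 0 1 c, c 0 = 0, c 1 = (x, z),
  {in `]0, 1[, forall t, hvel A c t (q.1 + q.2 *: ((c t).1 *m A))} & c \_ `[0, 1] = r].
have [F FQ] : exists F, forall r, geodesics_to A (x, z) r -> Q r (F r).
  have /choice[F FQ] : forall r, exists q, geodesics_to A (x, z) r -> Q r q.
    move=> r; have [[c [cg c0 c1] cr]|nr] := pselect (geodesics_to A (x, z) r); last first.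
      by exists (0, 0).
    have [v [th cv]] := geodesic_hvel A_skew A_unit cg.
    by exists (v, th) => _; exists c; split => //; case: cg.
  by exists F.
have Qsol r v th : th != 0 -> Q r (v, th) ->
    solution al w z th /\ extremal_x A al P v th 1 = x.
  move=> th0 [c [hc c0 c1 cv _]].
  have : c 1 = extremal v th 1.
    have cd0 : c 0 = extremal v th 0 by rewrite c0 extremal0.
    apply: (extremal_unique hc (extremal_horizontal v th0) cd0 cv).
      by move=> t _; exact: extremal_hvelT.
    by rewrite in_itv/= ler01 lexx.
  rewrite c1 => -[xE zE].
  have pf : pole_free al th.
    apply: (extremal_pole_free A_skew al_gt0 sumP PA PAA orthP (v := v) th0) => j.
    by rewrite -xE.
  split; last exact: esym.
  split; [exact: th0|exact: pf|].
  rewrite zE (extremal_height A_skew al_gt0 sumP PA PAA orthP v th0 pf).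
  by rewrite -xE.
have Qinj r s q : Q r q -> Q s q -> r = s.
  move=> [c [hc c0 _ cv <-]] [d [hd d0 _ dv <-]].
  apply/funext => t; rewrite !patchE; case: ifPn => // /set_mem tI.
  by apply: (extremal_unique hc hd _ cv dv tI); rewrite c0 d0.
have Q0 r v : Q r (v, 0) -> v = x.
  move=> [c [hc c0 c1 cv _]]; rewrite -[RHS](congr1 fst c1); apply: straight_velocity => //.
  by move=> t tI; have := cv t tI; rewrite /= scale0r addr0.
(* The code 0 is reserved for [th = 0], where the initial velocity must be [x]; shifting the other
   codes by one turns [M] into [M.+1]. *)
pose code r := if (F r).2 == 0 then 0%N else (solution_code al w z (F r).2).+1.
apply: (@counting_le_code _ _ _ code) => [r /FQ|r s /set_mem/FQ + /set_mem/FQ +].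
  rewrite /code; case: (F r) => v th /= Qr; case: ifPn => // th0.
  by rewrite ltnS; apply: codeM; have [] := Qsol _ _ _ th0 Qr.
rewrite /code; case: (F r) (F s) => v th [v' th'] /= Qr Qs.
case: ifPn => [/eqP th0|th0]; case: ifPn => [/eqP th'0|th'0] //.
  move=> _; rewrite th0 in Qr; rewrite th'0 in Qs.
  by move: Qr Qs (Q0 _ _ Qr) (Q0 _ _ Qs) => Qr Qs vx v'x; subst v v'; exact: Qinj Qr Qs.
move=> [] cE; have [sr xr] := Qsol _ _ _ th0 Qr; have [ss xs] := Qsol _ _ _ th'0 Qs.
have tE := solution_code_inj k_gt0 al_gt0 w_gt0 sr ss cE; subst th'.
have [_ pf _] := sr; suff vE : v = v' by subst v'; exact: Qinj Qr Qs.
by apply: (extremal_x_inj A_skew al_gt0 sumP PA PAA orthP th0 pf); rewrite xr xs.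
Qed.

End geodesics.

Theorem theorem2 (R : realType) (n : nat) (A : 'M[R]_(2 * n))
    (n_gt0 : (0 < n)%N) (A_skew : A^T = - A) (A_nondeg : A \in unitmx) :
  exists C1 C2 R1 R2 : R, 0 < C1 /\ 0 < C2 /\
    forall (x : 'rV[R]_(2 * n)) (z : R),
      (forall alpha : R, singular_value A alpha -> component A alpha x != 0) ->
      ((C1 * (`|z| / sqnorm x) + R1)%:E <= geodesic_count A (x, z))%E /\
      (geodesic_count A (x, z) <= (C2 * (`|z| / sqnorm x) + R2)%:E)%E.
Proof.
have [k [al [P [al_gt0 al_sv compE sumP [PA PAA orthP]]]]] := skew_spectral A_skew A_nondeg.
have k_gt0 : (0 < k)%N.
  case: k al P al_gt0 al_sv compE sumP PA PAA orthP => [|//] al P _ _ _ + _ _ _.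
  have i0 : (0 < 2 * n)%N by rewrite muln_gt0.
  rewrite big_ord0 => /matrixP/(_ (Ordinal i0) (Ordinal i0)) /eqP.
  by rewrite !mxE eqxx eq_sym oner_eq0.
have [C1 [K1 [C1_gt0 lower]]] := many_solutions k_gt0 al_gt0.
have [C2 [K2 [C2_gt0 upper]]] := solution_code_bound k_gt0 al_gt0.
exists C1, C2, K1, (K2 + 1); split=> //; split=> // x z xcomp.
have xP j : x *m P j != 0 by rewrite -compE; exact: xcomp.
have w_gt0 j : 0 < dot (x *m P j) (x *m P j) by rewrite dot_gt0.
(* By orthogonality of the components, the sum of the weights in the two counting estimates is the
   squared norm of [x]. *)
have -> : sqnorm x = \sum_j dot (x *m P j) (x *m P j).
  by rewrite -(dot_components sumP orthP); apply: eq_bigr => i _; rewrite expr2.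
have [lo up] := geodesic_count_bounds A_skew A_nondeg k_gt0 al_gt0 sumP PA PAA orthP z xP.
split.
  have [m [mle [g [gsol ginj]]]] := lower _ z w_gt0.
  by apply: le_trans (lo g m gsol ginj); rewrite lee_fin.
have [M Mle Mcode] := upper _ z w_gt0.
by apply: le_trans (up M Mcode) _; rewrite lee_fin -natr1 addrA lerD2r.
Qed.
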